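(* Every weighted projective stack is a toric Deligne-Mumford stack: for every $(n+1)$-tuple $Q=(q_0,\dots,q_n)$ of positive integers there is a stacky fan $\mathbf{\Sigma}$ such that the weighted projective stack $\mathbf{P}(Q)$ of type $Q$ is the toric Deligne-Mumford stack $\mathcal{X}(\mathbf{\Sigma})$.
   Context: Everything is algebraic over $\mathbb{C}$. Weighted projective stack. For $Q=(q_0,\dots,q_n)$ a tuple of positive integers, $\mathbf{P}(Q):=[(\mathbb{C}^{n+1}\setminus\{0\})/\mathbb{C}^*]$ is the quotient stack for the action $\lambda(x_0,\dots,x_n)=(\lambda^{q_0}x_0,\dots,\lambda^{q_n}x_n)$. Stacky fans. A stacky fan $\mathbf{\Sigma}=(N,\Sigma,\beta)$ consists of a finitely generated abelian group $N$ of rank $d$, a simplicial fan $\Sigma\subset N\otimes_{\mathbb{Z}}\mathbb{Q}$ with $m$ rays, and a homomorphism $\beta:\mathbb{Z}^m\to N$ determined by elements $b_1,\dots,b_m\in N$, such that $\beta$ has finite cokernel and the images $\overline{b}_1,\dots,\overline{b}_m$ in $\overline{N}=N/N_{tor}$ generate the simplicial fan $\Sigma$ (i.e. $\overline{b}_i$ generates the $i$-th ray). Gale dual. Write $A^{\star}=\mathrm{Hom}_{\mathbb{Z}}(A,\mathbb{Z})$. Choose a free resolution $0\to\mathbb{Z}^r\stackrel{R}{\to}\mathbb{Z}^{d+r}\to N\to 0$ and a lift $B:\mathbb{Z}^m\to\mathbb{Z}^{d+r}$ of $\beta$. Then $DG(\beta):=\mathrm{coker}([B\,R]^{\star}:(\mathbb{Z}^{d+r})^{\star}\to(\mathbb{Z}^{m+r})^{\star})$,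 and $\beta^{\vee}:\mathbb{Z}^m\cong(\mathbb{Z}^m)^{\star}\to DG(\beta)$ is the composite of the inclusion $(\mathbb{Z}^m)^{\star}\subset(\mathbb{Z}^{m+r})^{\star}$ with the quotient map. Toric Deligne-Mumford stack. Let $J_\Sigma\subset\mathbb{C}[z_1,\dots,z_m]$ be the irrelevant ideal, generated by the monomials $\prod_{\rho_i\not\subset\sigma}z_i$ for $\sigma\in\Sigma$, and $Z=\mathbb{C}^m\setminus V(J_\Sigma)$. Let $G=\mathrm{Hom}(DG(\beta),\mathbb{C}^* )$, acting on $Z$ through $\alpha=\mathrm{Hom}(\beta^{\vee},\mathbb{C}^* ):G\to(\mathbb{C}^* )^m$. Then $\mathcal{X}(\mathbf{\Sigma}):=[Z/G]$. *)

(* Defs.v *)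
From HB Require Import structures.
From mathcomp Require Import all_boot all_order all_algebra.
From mathcomp Require Import ring_quotient.
From mathcomp Require Import boolp classical_sets cardinality reals.
From mathcomp Require Import complex.

Set Implicit Arguments.
Unset Strict Implicit.
Unset Printing Implicit Defensive.

Import Order.TTheory GRing.Theory Num.Theory.

Local Open Scope classical_set_scope.
Local Open Scope ring_scope.

(* Stacks over a field k are handled as categories over the category of
   affine k-schemes, i.e. the opposite of the category of commutative
   k-algebras; a stack for the etale topology is determined by its restriction
   to affine schemes. The zero ring (the empty scheme) is allowed, whence
   comPzRingType rather than comAlgType. *)

Record calg (k : fieldType) := CAlg {
  calg_ring :> comPzRingType;
  calg_str : {rmorphism k -> calg_ring} }.

Record alg_hom (k : fieldType) (A B : calg k) := AlgHom {
  alg_hom_fun :> {rmorphism A -> B};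
  alg_hom_str : forall c : k, alg_hom_fun (calg_str A c) = calg_str B c }.

Section AlgHom.
Variable k : fieldType.
Implicit Types A B C D : calg k.

Lemma alg_hom_ext A B (f g : alg_hom A B) : f =1 g -> f = g.
Proof.
case: f g => [f f_str] [g g_str] /= fg.
have {fg} fg : f = g.
  have {fg} : (f : A -> B) = g by apply/funext.
  move: f g {f_str g_str} => [f [[f1] [f2]]] [g [[g1] [g2]]] /= fg.
  case: _ / fg g1 g2 => g1 g2.
  by rewrite (Prop_irrelevance f1 g1) (Prop_irrelevance f2 g2).
by case: _ / fg g_str => g_str; rewrite (Prop_irrelevance f_str g_str).
Qed.

Definition alg_id A : alg_hom A A := @AlgHom k A A idfun (fun=> erefl).

Fact alg_comp_str A B C (g : alg_hom B C) (f : alg_hom A B) (c : k) :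
  (g \o f) (calg_str A c) = calg_str C c.
Proof. by rewrite /= !alg_hom_str. Qed.

Definition alg_comp A B C (g : alg_hom B C) (f : alg_hom A B) : alg_hom A C :=
  AlgHom (alg_comp_str g f).

Lemma alg_compA A B C D (h : alg_hom C D) (g : alg_hom B C) (f : alg_hom A B) :
  alg_comp h (alg_comp g f) = alg_comp (alg_comp h g) f.
Proof. exact: alg_hom_ext. Qed.

Lemma alg_comp1f A B (f : alg_hom A B) : alg_comp (alg_id B) f = f.
Proof. exact: alg_hom_ext. Qed.

Lemma alg_compf1 A B (f : alg_hom A B) : alg_comp f (alg_id A) = f.
Proof. exact: alg_hom_ext. Qed.

End AlgHom.

Section Etale.
Variable k : fieldType.
Implicit Types A B C : calg k.

(* A polynomial in n variables is a list of terms (coefficient, exponents). *)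
Definition poly_eval A B n (f : alg_hom A B)
    (p : seq (A * {ffun 'I_n -> nat})) (x : 'I_n -> B) : B :=
  \sum_(t <- p) f t.1 * \prod_(i < n) x i ^+ t.2 i.

(* B is isomorphic to A[x_1, .., x_n] / (rels), through the universal property
   of that quotient. *)
Definition finitely_presented A B (f : alg_hom A B) : Prop :=
  exists (n : nat) (rels : seq (seq (A * {ffun 'I_n -> nat}))) (x : 'I_n -> B),
    (forall p, p \in rels -> poly_eval f p x = 0) /\
    (forall C (g : alg_hom A C) (y : 'I_n -> C),
       (forall p, p \in rels -> poly_eval g p y = 0) ->
       exists! h : alg_hom B C,
         alg_comp h f = g /\ forall i, h (x i) = y i).

Definition formally_etale A B (f : alg_hom A B) : Prop :=
  forall (C D : calg k) (p : alg_hom C D),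
    (forall d : D, exists c : C, p c = d) ->
    (forall c c' : C, p c = 0 -> p c' = 0 -> c * c' = 0) ->
    forall (u : alg_hom A C) (v : alg_hom B D),
      alg_comp p u = alg_comp v f ->
      exists! w : alg_hom B C, alg_comp w f = u /\ alg_comp p w = v.

Definition etale A B (f : alg_hom A B) : Prop :=
  finitely_presented f /\ formally_etale f.

Definition prime_ideal (A : comPzRingType) (P : set A) : Prop :=
  [/\ P 0, (forall a b, P a -> P b -> P (a + b)),
      (forall a b, P b -> P (a * b)), ~ P 1 &
      forall a b, P (a * b) -> P a \/ P b].

Definition spec_surjective A B (f : alg_hom A B) : Prop :=
  forall P : set A, prime_ideal P ->
    exists2 P' : set B, prime_ideal P' & f @^-1` P' = P.

(* A finite covering family A -> A_i amounts to the single cover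
   A -> \prod_i A_i. *)
Definition etale_cover A B (f : alg_hom A B) : Prop :=
  etale f /\ spec_surjective f.

End Etale.

Section Spaces.
Variable k : fieldType.
Implicit Types A B C : calg k.

(* Spaces and groups over k through their functors of points. *)
Record kfunctor := KFunctor {
  pts :> calg k -> Type;
  pts_map : forall A B, alg_hom A B -> pts A -> pts B;
  pts_map_id : forall A (x : pts A), pts_map (alg_id A) x = x;
  pts_map_comp : forall A B C (g : alg_hom B C) (f : alg_hom A B) (x : pts A),
    pts_map (alg_comp g f) x = pts_map g (pts_map f x) }.

Record kgroup := KGroup {
  gpts :> calg k -> groupType;
  gpts_map : forall A B, alg_hom A B -> gpts A -> gpts B;
  gpts_map_id : forall A (x : gpts A), gpts_map (alg_id A) x = x;
  gpts_map_comp : forall A B C (g : alg_hom B C) (f : alg_hom A B) (x : gpts A),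
    gpts_map (alg_comp g f) x = gpts_map g (gpts_map f x);
  gpts_mapM : forall A B (f : alg_hom A B) (x y : gpts A),
    gpts_map f (x * y)%g = (gpts_map f x * gpts_map f y)%g }.

Record kgroup_hom (G H : kgroup) := KGroupHom {
  ghom :> forall A, G A -> H A;
  ghomM : forall A (x y : G A), ghom (x * y)%g = (ghom x * ghom y)%g;
  ghom_nat : forall A B (f : alg_hom A B) (x : G A),
    ghom (gpts_map f x) = gpts_map f (ghom x) }.

Record kaction (G : kgroup) (X : kfunctor) := KAction {
  act : forall A, G A -> X A -> X A;
  act1 : forall A (x : X A), act 1%g x = x;
  actM : forall A (g h : G A) (x : X A), act (g * h)%g x = act g (act h x);
  act_nat : forall A B (f : alg_hom A B) (g : G A) (x : X A),
    pts_map f (act g x) = act (gpts_map f g) (pts_map f x) }.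

Fact kspec_map_id B A (x : alg_hom B A) : alg_comp (alg_id A) x = x.
Proof. exact: alg_comp1f. Qed.

Fact kspec_map_comp D A B C (g : alg_hom B C) (f : alg_hom A B)
  (x : alg_hom D A) : alg_comp (alg_comp g f) x = alg_comp g (alg_comp f x).
Proof. by rewrite alg_compA. Qed.

Definition kspec (B : calg k) : kfunctor :=
  @KFunctor (fun A => alg_hom B A) (fun A C (f : alg_hom A C) x => alg_comp f x)
    (@kspec_map_id B) (@kspec_map_comp B).

End Spaces.

Section CategoryOver.
Variable k : fieldType.
Implicit Types A B : calg k.

(* A category over affine k-schemes: [ob A] are the objects over Spec A, and
   a morphism x -> y lies over the morphism of schemes dual to [base]. *)
Record cat_over := CatOver {
  ob : calg k -> Type;
  hom : forall A B, ob A -> ob B -> Type;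
  base : forall A B (x : ob A) (y : ob B), hom x y -> alg_hom B A;
  idh : forall A (x : ob A), hom x x;
  comph : forall A B C (x : ob A) (y : ob B) (z : ob C),
    hom y z -> hom x y -> hom x z;
  comp1h : forall A B (x : ob A) (y : ob B) (f : hom x y), comph (idh y) f = f;
  comph1 : forall A B (x : ob A) (y : ob B) (f : hom x y), comph f (idh x) = f;
  comphA : forall A B C D (x : ob A) (y : ob B) (z : ob C) (t : ob D)
    (h : hom z t) (g : hom y z) (f : hom x y),
    comph h (comph g f) = comph (comph h g) f;
  base_id : forall A (x : ob A), base (idh x) = alg_id A;
  base_comp : forall A B C (x : ob A) (y : ob B) (z : ob C)
    (g : hom y z) (f : hom x y),
    base (comph g f) = alg_comp (base f) (base g) }.

Record fun_over (X Y : cat_over) := FunOver {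
  fob : forall A, ob X A -> ob Y A;
  fhom : forall A B (x : ob X A) (y : ob X B), hom x y -> hom (fob x) (fob y);
  fhom_base : forall A B (x : ob X A) (y : ob X B) (f : hom x y),
    base (fhom f) = base f;
  fhom_id : forall A (x : ob X A), fhom (idh x) = idh (fob x);
  fhom_comp : forall A B C (x : ob X A) (y : ob X B) (z : ob X C)
    (g : hom y z) (f : hom x y), fhom (comph g f) = comph (fhom g) (fhom f) }.

Definition iso_in_fibre (X : cat_over) A (x y : ob X A) : Prop :=
  exists (f : hom x y) (g : hom y x),
    [/\ base f = alg_id A, comph g f = idh x & comph f g = idh y].

(* Isomorphism of stacks over k. *)
Definition stack_iso (X Y : cat_over) : Prop :=
  exists F : fun_over X Y,
    (forall A B (x : ob X A) (y : ob X B), bijective (@fhom X Y F A B x y)) /\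
    (forall A (y : ob Y A), exists x : ob X A, iso_in_fibre (fob F x) y).

End CategoryOver.

Section QuotientStack.
Variables (k : fieldType) (G : kgroup k) (X : kfunctor k) (aX : kaction G X).
Implicit Types A B C : calg k.

(* A principal G-bundle Spec tot -> Spec A, locally trivial for the etale
   topology. G is meant to be an affine group scheme, so that the total space of
   a principal bundle is automatically affine over its base. *)
Record torsor (A : calg k) := Torsor {
  tot : calg k;
  tproj : alg_hom A tot;
  tact : kaction G (kspec tot);
  tact_proj : forall C (g : G C) (p : kspec tot C),
    alg_comp (act tact g p) tproj = alg_comp p tproj;
  tact_simply_transitive : forall C (p p' : kspec tot C),
    alg_comp p tproj = alg_comp p' tproj -> exists! g : G C, act tact g p = p';
  tlocal_section : exists (A' : calg k) (c : alg_hom A A'),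
    etale_cover c /\ exists s : alg_hom tot A', alg_comp s tproj = c }.

Record quot_ob (A : calg k) := QuotOb {
  qtors : torsor A;
  qmap : forall C, kspec (tot qtors) C -> X C;
  qmap_nat : forall B C (f : alg_hom B C) (p : kspec (tot qtors) B),
    qmap (pts_map f p) = pts_map f (qmap p);
  qmap_equiv : forall C (g : G C) (p : kspec (tot qtors) C),
    qmap (act (tact qtors) g p) = act aX g (qmap p) }.

Record quot_hom A B (x : quot_ob A) (y : quot_ob B) := QuotHom {
  qbase : alg_hom B A;
  qtot : alg_hom (tot (qtors y)) (tot (qtors x));
  qhom_proj :
    alg_comp qtot (tproj (qtors y)) = alg_comp (tproj (qtors x)) qbase;
  qhom_act : forall C (g : G C) (p : kspec (tot (qtors x)) C),
    alg_comp (act (tact (qtors x)) g p) qtot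
    = act (tact (qtors y)) g (alg_comp p qtot);
  qhom_map : forall C (p : kspec (tot (qtors x)) C),
    qmap (q := y) (alg_comp p qtot) = qmap p }.

Lemma quot_hom_ext A B (x : quot_ob A) (y : quot_ob B) (f g : quot_hom x y) :
  qbase f = qbase g -> qtot f = qtot g -> f = g.
Proof.
case: f g => [f1 f2 f3 f4 f5] [g1 g2 g3 g4 g5] /= e1 e2.
by case: _ / e1 g3 => g3; case: _ / e2 g3 g4 g5 => g3 g4 g5;
  congr QuotHom; exact: Prop_irrelevance.
Qed.

Definition quot_id A (x : quot_ob A) : quot_hom x x.
Proof.
exists (alg_id A) (alg_id _).
- by rewrite alg_comp1f alg_compf1.
- by move=> C g p; rewrite !alg_compf1.
- by move=> C p; rewrite alg_compf1.
Defined.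

Definition quot_comp A B C (x : quot_ob A) (y : quot_ob B) (z : quot_ob C)
  (g : quot_hom y z) (f : quot_hom x y) : quot_hom x z.
Proof.
exists (alg_comp (qbase f) (qbase g)) (alg_comp (qtot f) (qtot g)).
- by rewrite -alg_compA qhom_proj !alg_compA qhom_proj.
- by move=> D h p; rewrite !alg_compA qhom_act qhom_act.
- by move=> D p; rewrite alg_compA !qhom_map.
Defined.

Definition quotient_stack : cat_over k.
Proof.
refine (@CatOver k quot_ob quot_hom qbase quot_id quot_comp _ _ _ _ _).
- by move=> A B x y f; apply: quot_hom_ext; rewrite /= alg_compf1.
- by move=> A B x y f; apply: quot_hom_ext; rewrite /= alg_comp1f.
- by move=> *; apply: quot_hom_ext; rewrite /= alg_compA.
- by [].
- by [].
Defined.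

End QuotientStack.

Section Units.
Variables (k : fieldType).
Implicit Types A B C : calg k.

Definition units (A : comPzRingType) : Type :=
  {u : A * A | u.1 * u.2 == 1}.

HB.instance Definition _ (A : comPzRingType) := Choice.on (units A).

Variable A0 : comPzRingType.
Implicit Types u v w : units A0.

Definition uval (A : comPzRingType) (u : units A) : A := (val u).1.

Lemma units_inj : injective (@uval A0).
Proof.
move=> [[u u'] /= hu] [[v v'] /= hv]; rewrite /uval /= => uv; apply: val_inj => /=.
rewrite -{}uv in hv *; congr pair.
by rewrite -[u']mulr1 -(eqP hv) mulrA [u' * u]mulrC (eqP hu) mul1r.
Qed.

Fact unit1_subproof : (1 : A0) * 1 == 1. Proof. by rewrite mulr1. Qed.
Fact unitV_subproof u : (val u).2 * (val u).1 == 1.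
Proof. by rewrite mulrC (valP u). Qed.
Fact unitM_subproof u v :
  ((val u).1 * (val v).1) * ((val u).2 * (val v).2) == 1.
Proof. by rewrite mulrACA (eqP (valP u)) (eqP (valP v)) mulr1. Qed.

Definition unit1 : units A0 := exist _ (1, 1) unit1_subproof.
Definition unitV u : units A0 := exist _ ((val u).2, (val u).1) (unitV_subproof u).
Definition unitM u v : units A0 :=
  exist _ ((val u).1 * (val v).1, (val u).2 * (val v).2) (unitM_subproof u v).

Fact unitMA : associative unitM.
Proof. by move=> u v w; apply: units_inj; rewrite /uval /= mulrA. Qed.
Fact unitM1 : right_id unit1 unitM.
Proof. by move=> u; apply: units_inj; rewrite /uval /= mulr1. Qed.
Fact unit1M : left_id unit1 unitM.
Proof. by move=> u; apply: units_inj; rewrite /uval /= mul1r. Qed.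
Fact unitVM : left_inverse unit1 unitV unitM.
Proof. by move=> u; apply: units_inj; rewrite /uval /= (eqP (unitV_subproof u)). Qed.
Fact unitMV : right_inverse unit1 unitV unitM.
Proof. by move=> u; apply: units_inj; rewrite /uval /= (eqP (valP u)). Qed.

HB.instance Definition _ := isGroup.Build (units A0)
  unitMA unit1M unitM1 unitVM unitMV.

End Units.

Section Tori.
Variable k : fieldType.
Implicit Types A B C : calg k.

Fact units_map_subproof A B (f : alg_hom A B) (u : units A) :
  f (val u).1 * f (val u).2 == 1.
Proof. by rewrite -rmorphM (eqP (valP u)) rmorph1. Qed.

Definition units_map A B (f : alg_hom A B) (u : units A) : units B :=
  exist _ (f (val u).1, f (val u).2) (units_map_subproof f u).

Fact units_map_id A (u : units A) : units_map (alg_id A) u = u.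
Proof. exact: units_inj. Qed.
Fact units_map_comp A B C (g : alg_hom B C) (f : alg_hom A B) (u : units A) :
  units_map (alg_comp g f) u = units_map g (units_map f u).
Proof. exact: units_inj. Qed.
Fact units_mapM A B (f : alg_hom A B) (u v : units A) :
  units_map f (u * v)%g = (units_map f u * units_map f v)%g.
Proof. by apply: units_inj; rewrite /uval /= rmorphM. Qed.

Definition Gm : kgroup k :=
  @KGroup k (fun A => units A) units_map units_map_id units_map_comp units_mapM.

(* The group Hom(M, Gm) over k, with A-points Hom(M, units A). *)
Section Diag.
Variable M : zmodType.

Definition diag_pts (A : comPzRingType) : Type :=
  {chi : M -> units A | forall x y, chi (x + y) = (chi x * chi y)%g}.

HB.instance Definition _ (A : comPzRingType) := gen_eqMixin (diag_pts A).
HB.instance Definition _ (A : comPzRingType) := gen_choiceMixin (diag_pts A).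

Lemma diag_ext (A : comPzRingType) (chi psi : diag_pts A) :
  sval chi =1 sval psi -> chi = psi.
Proof.
case: chi psi => [f Hf] [g Hg] /= /funext e.
by case: _ / e Hg => Hg; congr exist; exact: Prop_irrelevance.
Qed.

Section Group.
Variable A : comPzRingType.
Implicit Types chi psi : diag_pts A.

Lemma unitsC (u v : units A) : (u * v)%g = (v * u)%g.
Proof. by apply: units_inj; rewrite /uval /= mulrC. Qed.

Fact diag1_subproof (x y : M) : (1 : units A)%g = (1 * 1)%g.
Proof. by rewrite mulg1. Qed.
Fact diagV_subproof chi x y :
  ((sval chi (x + y))^-1)%g = ((sval chi x)^-1 * (sval chi y)^-1)%g.
Proof. by rewrite (svalP chi) invgM unitsC. Qed.
Fact diagM_subproof chi psi x y :
  (sval chi (x + y) * sval psi (x + y))%g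
  = ((sval chi x * sval psi x) * (sval chi y * sval psi y))%g.
Proof.
rewrite (svalP chi) (svalP psi) -!mulgA; congr (_ * _)%g.
by rewrite !mulgA [(sval chi y * _)%g]unitsC.
Qed.

Definition diag1 : diag_pts A := exist _ (fun=> 1%g) diag1_subproof.
Definition diagV chi : diag_pts A :=
  exist _ (fun x => ((sval chi x)^-1)%g) (diagV_subproof chi).
Definition diagM chi psi : diag_pts A :=
  exist _ (fun x => (sval chi x * sval psi x)%g) (diagM_subproof chi psi).

Fact diagMA : associative diagM.
Proof. by move=> ? ? ?; apply: diag_ext => x /=; rewrite mulgA. Qed.
Fact diag1M : left_id diag1 diagM.
Proof. by move=> ?; apply: diag_ext => x /=; rewrite mul1g. Qed.
Fact diagM1 : right_id diag1 diagM.
Proof. by move=> ?; apply: diag_ext => x /=; rewrite mulg1. Qed.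
Fact diagVM : left_inverse diag1 diagV diagM.
Proof. by move=> ?; apply: diag_ext => x /=; rewrite mulVg. Qed.
Fact diagMV : right_inverse diag1 diagV diagM.
Proof. by move=> ?; apply: diag_ext => x /=; rewrite mulgV. Qed.

HB.instance Definition _ := isGroup.Build (diag_pts A)
  diagMA diag1M diagM1 diagVM diagMV.

End Group.

Fact diag_map_subproof A B (f : alg_hom A B) (chi : diag_pts A) (x y : M) :
  units_map f (sval chi (x + y))
  = (units_map f (sval chi x) * units_map f (sval chi y))%g.
Proof. by rewrite (svalP chi) units_mapM. Qed.

Definition diag_map A B (f : alg_hom A B) (chi : diag_pts A) : diag_pts B :=
  exist _ (fun x => units_map f (sval chi x)) (diag_map_subproof f chi).

Fact diag_map_id A (chi : diag_pts A) : diag_map (alg_id A) chi = chi.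
Proof. by apply: diag_ext => x /=; rewrite units_map_id. Qed.
Fact diag_map_comp A B C (g : alg_hom B C) (f : alg_hom A B) (chi : diag_pts A) :
  diag_map (alg_comp g f) chi = diag_map g (diag_map f chi).
Proof. by apply: diag_ext => x /=; rewrite units_map_comp. Qed.
Fact diag_mapM A B (f : alg_hom A B) (chi psi : diag_pts A) :
  diag_map f (chi * psi)%g = (diag_map f chi * diag_map f psi)%g.
Proof. by apply: diag_ext => x /=; rewrite units_mapM. Qed.

Definition diag_group : kgroup k :=
  @KGroup k (fun A => diag_pts A) diag_map diag_map_id diag_map_comp diag_mapM.

Definition diag_eval (x : M) : kgroup_hom diag_group Gm.
Proof. by exists (fun A (chi : diag_pts A) => sval chi x). Defined.

End Diag.

Definition Gm_pow (q : nat) : kgroup_hom Gm Gm.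
Proof.
exists (fun A (u : units A) => (u ^+ q)%g).
- by move=> A u v; rewrite expgMn //; apply: unitsC.
- move=> A B f u /=; elim: q => [|q IHq]; last by rewrite !expgS units_mapM IHq.
  by apply: units_inj; rewrite /uval /= rmorph1.
Defined.

End Tori.

Section MonomialComplement.
Variables (k : fieldType) (m : nat) (D : set {set 'I_m}).
Implicit Types A B C : calg k.

Definition in_ideal (A : comPzRingType) (S : set A) (a : A) : Prop :=
  exists2 s : seq (A * A),
    (forall p, p \in s -> S p.2) & a = \sum_(p <- s) p.1 * p.2.

Lemma in_ideal_map (A B : comPzRingType) (f : {rmorphism A -> B})
    (S : set A) (T : set B) (a : A) :
  (forall x, S x -> exists c y, T y /\ f x = c * y) ->
  in_ideal S a -> in_ideal T (f a).
Proof.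
move=> ST [s Ss ->]; elim: s Ss => [|[a0 x] s IHs] Ss.
  by exists [::] => //; rewrite !big_nil rmorph0.
have [|t Tt E] := IHs; first by move=> p ps; apply: Ss; rewrite inE ps orbT.
have [|c [y [Ty fx]]] := ST x; first by apply: (Ss (a0, x)); rewrite mem_head.
exists ((f a0 * c, y) :: t) => [p|].
  by rewrite inE => /predU1P[->|/Tt].
by rewrite !big_cons /= rmorphD rmorphM fx E mulrA.
Qed.

Definition monomials (A : comPzRingType) (z : {ffun 'I_m -> A}) : set A :=
  [set a | exists2 I, D I & a = \prod_(i in I) z i].

(* A-points of the open subscheme k^m \ V(J), where J is generated by the
   monomials \prod_(i in I) z_i for I in D: the pullback of J is the unit
   ideal. *)
Definition mcompl_pts (A : comPzRingType) : Type :=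
  {z : {ffun 'I_m -> A} | in_ideal (monomials z) 1}.

Lemma mcompl_ext (A : comPzRingType) (z w : mcompl_pts A) :
  sval z = sval w -> z = w.
Proof.
case: z w => [z Hz] [w Hw] /= e; case: _ / e Hw => Hw.
by congr exist; exact: Prop_irrelevance.
Qed.

Fact mcompl_map_subproof A B (f : alg_hom A B) (z : mcompl_pts A) :
  in_ideal (monomials [ffun i => f (sval z i)]) 1.
Proof.
rewrite -(rmorph1 f); apply: in_ideal_map (svalP z) => _ [I DI ->].
exists 1, (\prod_(i in I) f (sval z i)); split; last by rewrite mul1r rmorph_prod.
by exists I => //; apply: eq_bigr => i _; rewrite ffunE.
Qed.

Definition mcompl_map A B (f : alg_hom A B) (z : mcompl_pts A) : mcompl_pts B :=
  exist _ [ffun i => f (sval z i)] (mcompl_map_subproof f z).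

Fact mcompl_map_id A (z : mcompl_pts A) : mcompl_map (alg_id A) z = z.
Proof. by apply: mcompl_ext; apply/ffunP => i; rewrite ffunE. Qed.
Fact mcompl_map_comp A B C (g : alg_hom B C) (f : alg_hom A B) (z : mcompl_pts A) :
  mcompl_map (alg_comp g f) z = mcompl_map g (mcompl_map f z).
Proof. by apply: mcompl_ext; apply/ffunP => i; rewrite !ffunE. Qed.

Definition mcompl : kfunctor k :=
  @KFunctor k (fun A => mcompl_pts A) mcompl_map mcompl_map_id mcompl_map_comp.

(* The action of G on k^m \ V(J) through a homomorphism to Gm^m, given by m
   characters. *)
Variables (G : kgroup k) (w : 'I_m -> kgroup_hom G (Gm k)).

Fact mcompl_act_subproof A (g : G A) (z : mcompl_pts A) :
  in_ideal (monomials [ffun i => uval (w i A g) * sval z i]) 1.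
Proof.
rewrite -[1]/(idfun 1).
apply: (in_ideal_map (f := idfun)) (svalP z) => _ [I DI ->].
exists (\prod_(i in I) (val (w i A g)).2).
exists (\prod_(i in I) (uval (w i A g) * sval z i)); split.
  by exists I => //; apply: eq_bigr => i _; rewrite ffunE.
rewrite -big_split /=; apply: eq_bigr => i _.
by rewrite mulrA /uval (eqP (unitV_subproof _)) mul1r.
Qed.

Definition mcompl_act_fun A (g : G A) (z : mcompl_pts A) : mcompl_pts A :=
  exist _ [ffun i => uval (w i A g) * sval z i] (mcompl_act_subproof g z).

Definition mcompl_act : kaction G mcompl.
Proof.
refine (@KAction k G mcompl mcompl_act_fun _ _ _).
- move=> A z; apply: mcompl_ext; apply/ffunP => i; rewrite ffunE.
  suff -> : w i A 1%g = 1%g by rewrite /uval /= mul1r.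
  by apply: (mulgI (w i A 1%g)); rewrite -ghomM !mulg1.
- move=> A g h z; apply: mcompl_ext; apply/ffunP => i.
  by rewrite !ffunE ghomM /uval /= mulrA.
- move=> A B f g z; apply: mcompl_ext; apply/ffunP => i.
  by rewrite !ffunE ghom_nat rmorphM.
Defined.

End MonomialComplement.

(* The ideal generated by the coordinates defines the origin. *)
Definition weighted_projective_stack (k : fieldType) (n : nat)
    (Q : n.+1.-tuple nat) : cat_over k :=
  quotient_stack
    (mcompl_act [set [set i]%SET | i in [set: 'I_n.+1]]
       (fun i => Gm_pow k (tnth Q i))).

Section Fans.
Variable V : vectType rat.
Implicit Types (sigma tau : set V) (X : seq V).

Definition cone X : set V :=
  [set v | exists2 c : 'I_(size X) -> rat,
     (forall i, 0 <= c i) & v = \sum_i c i *: X`_i].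

Definition simplicial_cone sigma : Prop :=
  exists2 X : seq V, free X & sigma = cone X.

Definition face tau sigma : Prop :=
  exists u : {linear V -> rat^o},
    (forall v, sigma v -> 0 <= u v) /\ tau = sigma `&` [set v | u v = 0].

Record simplicial_fan (F : set (set V)) : Prop := SimplicialFan {
  fan_finite : finite_set F;
  fan_neq0 : F !=set0;
  fan_simplicial : forall sigma, F sigma -> simplicial_cone sigma;
  fan_face : forall sigma tau, F sigma -> face tau sigma -> F tau;
  fan_meet : forall sigma tau, F sigma -> F tau ->
    face (sigma `&` tau) sigma /\ face (sigma `&` tau) tau }.

End Fans.

Definition lin_of (N : zmodType) (m : nat) (b : 'I_m -> N) (z : 'cV[int]_m) : N :=
  \sum_i b i *~ z i 0.

(* sf_iota : N -> sf_NQ is a model of N -> N (x) Q : its kernel is the torsion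
   subgroup and every vector has a multiple in its image. It identifies
   N / N_tor with its image, so that sf_iota (sf_b i) plays the role of the image
   of b_i in N / N_tor. *)
Record stacky_fan := StackyFan {
  sf_N : zmodType;
  sf_N_fg : exists s : seq sf_N, forall x, exists c : 'cV[int]_(size s),
    x = lin_of (fun i : 'I_(size s) => s`_i) c;
  sf_d : nat;
  sf_NQ : vectType rat;
  sf_rank : \dim {:sf_NQ} = sf_d;
  sf_iota : {additive sf_N -> sf_NQ};
  sf_iota_ker : forall x,
    sf_iota x = 0 <-> exists2 j : nat, (0 < j)%N & x *+ j = 0;
  sf_iota_span : forall v, exists2 j : nat, (0 < j)%N &
    exists x, v *+ j = sf_iota x;
  sf_fan : set (set sf_NQ);
  sf_fanP : simplicial_fan sf_fan;
  sf_m : nat;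
  sf_b : 'I_sf_m -> sf_N;
  sf_b_coker : exists s : seq sf_N, forall x,
    exists2 y, y \in s & exists z : 'cV[int]_sf_m, x = y + lin_of sf_b z;
  sf_b_neq0 : forall i, sf_iota (sf_b i) != 0;
  sf_b_ray : forall i, sf_fan (cone [:: sf_iota (sf_b i)]);
  sf_b_inj : injective (fun i => cone [:: sf_iota (sf_b i)]);
  sf_b_surj : forall v, v != 0 -> sf_fan (cone [:: v]) ->
    exists i, cone [:: v] = cone [:: sf_iota (sf_b i)] }.

Arguments sf_fan : clear implicits.

Definition sf_beta (S : stacky_fan) : 'cV[int]_(sf_m S) -> sf_N S :=
  lin_of (@sf_b S).

Definition sf_ray (S : stacky_fan) (i : 'I_(sf_m S)) : set (sf_NQ S) :=
  cone [:: sf_iota S (sf_b i)].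

(* A free resolution 0 -> Z^r -> Z^(d+r) -> N -> 0 and a lift of beta. *)
Record gale_datum (S : stacky_fan) := GaleDatum {
  gd_r : nat;
  gd_p : {additive 'cV[int]_(sf_d S + gd_r) -> sf_N S};
  gd_R : 'M[int]_(sf_d S + gd_r, gd_r);
  gd_R_inj : injective (fun y : 'cV[int]_gd_r => gd_R *m y);
  gd_exact : forall x, gd_p x = 0 <-> exists y : 'cV[int]_gd_r, x = gd_R *m y;
  gd_p_surj : forall t, exists x, gd_p x = t;
  gd_B : 'M[int]_(sf_d S + gd_r, sf_m S);
  gd_lift : forall z, gd_p (gd_B *m z) = sf_beta z }.

Section Cokernel.
Variables (p q : nat) (M : 'M[int]_(p, q)).

Definition im_pred : {pred 'cV[int]_p} :=
  fun v => `[< exists u : 'cV[int]_q, v = M *m u >].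

Fact im_pred_zmod : zmod_closed im_pred.
Proof.
split=> [|v v' /asboolP[u ->] /asboolP[u' ->]]; apply/asboolP.
  by exists 0; rewrite mulmx0.
by exists (u - u'); rewrite mulmxBr.
Qed.

HB.instance Definition _ :=
  GRing.isZmodClosed.Build 'cV[int]_p im_pred im_pred_zmod.

Definition coker : zmodType := Quotient.quot im_pred.

Definition coker_proj (v : 'cV[int]_p) : coker :=
  (\pi_(Quotient.quot im_pred) v)%qT.

End Cokernel.

Section Toric.
Variables (k : fieldType) (S : stacky_fan) (D : gale_datum S).

(* The dual of Z^a is identified with Z^a by the dual basis, so that duals of
   maps are transposes. *)
Definition DG : zmodType := coker (row_mx (gd_B D) (gd_R D))^T.

Definition gale_dual (z : 'cV[int]_(sf_m S)) : DG :=
  coker_proj (row_mx (gd_B D) (gd_R D))^T (col_mx z 0).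

(* One generator for each cone sigma: the product of the z_i such that the i-th
   ray is not contained in sigma. *)
Definition irrelevant : set {set 'I_(sf_m S)} :=
  [set [set i | ~~ `[< sf_ray i `<=` sigma >]]%SET | sigma in sf_fan S].

Definition toric_weight (i : 'I_(sf_m S)) : kgroup_hom (diag_group k DG) (Gm k) :=
  diag_eval k (gale_dual (delta_mx i 0)).

Definition toric_stack : cat_over k :=
  quotient_stack (mcompl_act irrelevant toric_weight).

End Toric.

(* Main.v *)
Require Import Defs.
From mathcomp Require Import all_boot all_algebra.
From mathcomp Require Import reals complex.
From HB Require Import structures.
From mathcomp Require Import all_order.
From mathcomp Require Import boolp classical_sets cardinality.

Set Implicit Arguments.
Unset Strict Implicit.
Unset Printing Implicit Defensive.

Import GRing.Theory.
Local Open Scope ring_scope.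

(** The stacky fan is N = Z^(d+1) / Z w, where w is the tuple of weights and d + 1
    the number of weights, with b_i the class of the i-th basis vector and the
    fan of projective space: its cones are spanned by the proper subsets of
    b_0, .., b_d. The relation \sum_i w_i b_i = 0 makes
    0 -> Z -> Z^(d+1) -> N -> 0 a free resolution, with first map w, that lifts
    beta by the identity.

    DG(beta) does not depend on the resolution and the lift: two choices are
    compared by a map of complexes, unique up to homotopy ([cyclic_gale]).
    For d > 0 the resolution above shows that DG(beta) is infinite cyclic and that
    beta^vee sends the i-th basis vector to w_i times a generator
    ([wps_cyclic]). Hence G is Gm, acting with the weights w. The irrelevant ideal
    is generated by the products of the coordinates over all nonempty sets of
    indices, hence by the coordinates, so that the open set on which G acts is the
    complement of the origin. Isomorphic groups acting compatibly on isomorphic spaces have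
    isomorphic quotient stacks ([quotient_stack_iso]).

    For d = 0 the images of the b_i in N (x) Q vanish, so that there are no rays:
    with q the only weight, N = Z / q, m = 0, the open set is a point and G is
    mu_q, the group of q-torsion points of Gm. Then one has to identify
    [Gm / Gm], with Gm acting on itself by the q-th power, with the classifying
    stack of mu_q
    ([root_stack_iso]). A Gm-torsor T with an invertible function f of weight q
    goes to the mu_q-torsor f = 1 in T. What makes this an equivalence is that
    a q-th root of an invertible function exists after the extension
    C -> C' = C[s] / (s^q - u), which is an etale cover as q is invertible, and that
    elements descend from C' to C:
    c in C' comes from C if and only if it has the same images under the two maps
    from C' to C'[x] / (x^q - 1) given by s |-> s and s |-> x s
    ([root_equalizer]). So a morphism between the loci f = 1 extends to the whole
    torsors: to define it on a point p, divide p by a q-th root of f(p), apply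
    the morphism, and multiply by the root; the result descends because the
    root is unique up to mu_q. Conversely a mu_q-torsor Spec E corresponds to a
    grading of E by Z / q, and the Gm-torsor that it induces has the coordinate
    ring \bigoplus_(i in Z) E_(i mod q), given below by generators and
    relations; that Gm acts simply transitively on it is proved after
    adjoining roots, where it is the same statement for E, and then
    descended. *)

(** * Algebras given by generators and relations *)

Section Presentation.
Local Open Scope quotient_scope.
Variables (k : fieldType) (A : calg k) (I : Type).

Inductive term :=
  TConst of A | TVar of I | TAdd of term & term | TMul of term & term
| TOpp of term.

Fixpoint teval (C : comPzRingType) (g : A -> C) (y : I -> C) (t : term) : C :=
  match t with
  | TConst a => g a
  | TVar i => y i
  | TAdd s t => teval g y s + teval g y t
  | TMul s t => teval g y s * teval g y t
  | TOpp t => - teval g y t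
  end.

Lemma teval_hom (B C : calg k) (h : alg_hom B C) (g : A -> B) (y : I -> B) t :
  h (teval g y t) = teval (h \o g) (h \o y) t.
Proof.
elim: t => //= [s IHs t IHt|s IHs t IHt|t IHt].
- by rewrite rmorphD IHs IHt.
- by rewrite rmorphM IHs IHt.
- by rewrite rmorphN IHt.
Qed.

Variable rel : term -> Prop.

Definition solution (C : calg k) (g : alg_hom A C) (y : I -> C) : Prop :=
  forall t, rel t -> teval g y t = 0.

(** Two terms are identified when every solution of the relations gives them
    the same value. This impredicative definition makes the ring axioms and
    the universal property immediate. *)
Definition cong (s t : term) : bool :=
  `[< forall (C : calg k) (g : alg_hom A C) (y : I -> C),
        solution g y -> teval g y s = teval g y t >].

HB.instance Definition _ := gen_eqMixin term.
HB.instance Definition _ := gen_choiceMixin term.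

Fact cong_refl : reflexive cong. Proof. by move=> t; apply/asboolP. Qed.
Fact cong_sym : symmetric cong.
Proof. by move=> s t; apply/asboolP/asboolP => H C g y ?; rewrite H. Qed.
Fact cong_trans : transitive cong.
Proof.
by move=> s t u /asboolP H /asboolP K; apply/asboolP => C g y ?; rewrite H ?K.
Qed.

Canonical cong_equiv := EquivRel cong cong_refl cong_sym cong_trans.

Definition pres_ring := {eq_quot cong_equiv}.
HB.instance Definition _ := Choice.on pres_ring.

Let cls (t : term) : pres_ring := \pi t.

Lemma pres_eqP s t :
  cls s = cls t <-> forall (C : calg k) (g : alg_hom A C) (y : I -> C),
    solution g y -> teval g y s = teval g y t.
Proof. by split=> [/eqquotP/asboolP //|H]; apply/eqquotP/asboolP. Qed.

Lemma teval_repr (t : term) (C : calg k) (g : alg_hom A C) (y : I -> C) :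
  solution g y -> teval g y (repr (cls t)) = teval g y t.
Proof. by move: C g y; apply/pres_eqP; rewrite /cls reprK. Qed.

Let add (x y : pres_ring) := cls (TAdd (repr x) (repr y)).
Let mul (x y : pres_ring) := cls (TMul (repr x) (repr y)).
Let opp (x : pres_ring) := cls (TOpp (repr x)).

Let addE s t : add (cls s) (cls t) = cls (TAdd s t).
Proof. by apply/pres_eqP => C g y sol /=; rewrite !teval_repr. Qed.
Let mulE s t : mul (cls s) (cls t) = cls (TMul s t).
Proof. by apply/pres_eqP => C g y sol /=; rewrite !teval_repr. Qed.
Let oppE s : opp (cls s) = cls (TOpp s).
Proof. by apply/pres_eqP => C g y sol /=; rewrite !teval_repr. Qed.

Let clsW (P : pres_ring -> Prop) : (forall t, P (cls t)) -> forall x, P x.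
Proof. by move=> H x; rewrite -[x]reprK; apply: H. Qed.

Fact pres_addA : associative add.
Proof.
elim/clsW => s; elim/clsW => t; elim/clsW => u; rewrite !addE.
by apply/pres_eqP => C g y sol /=; rewrite addrA.
Qed.
Fact pres_addC : commutative add.
Proof.
elim/clsW => s; elim/clsW => t; rewrite !addE.
by apply/pres_eqP => C g y sol /=; rewrite addrC.
Qed.
Fact pres_add0 : left_id (cls (TConst 0)) add.
Proof.
elim/clsW => s; rewrite !addE.
by apply/pres_eqP => C g y sol /=; rewrite rmorph0 add0r.
Qed.
Fact pres_addN : left_inverse (cls (TConst 0)) opp add.
Proof.
elim/clsW => s; rewrite oppE !addE.
by apply/pres_eqP => C g y sol /=; rewrite rmorph0 addNr.
Qed.

HB.instance Definition _ :=
  GRing.isZmodule.Build pres_ring pres_addA pres_addC pres_add0 pres_addN.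

Fact pres_mulA : associative mul.
Proof.
elim/clsW => s; elim/clsW => t; elim/clsW => u; rewrite !mulE.
by apply/pres_eqP => C g y sol /=; rewrite mulrA.
Qed.
Fact pres_mulC : commutative mul.
Proof.
elim/clsW => s; elim/clsW => t; rewrite !mulE.
by apply/pres_eqP => C g y sol /=; rewrite mulrC.
Qed.
Fact pres_mul1 : left_id (cls (TConst 1)) mul.
Proof.
elim/clsW => s; rewrite !mulE.
by apply/pres_eqP => C g y sol /=; rewrite rmorph1 mul1r.
Qed.
Fact pres_mulDl : left_distributive mul add.
Proof.
elim/clsW => s; elim/clsW => t; elim/clsW => u; rewrite !(addE, mulE).
by apply/pres_eqP => C g y sol /=; rewrite mulrDl.
Qed.

HB.instance Definition _ := GRing.Zmodule_isComPzRing.Build pres_ring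
  pres_mulA pres_mulC pres_mul1 pres_mulDl.

Let const (a : A) : pres_ring := cls (TConst a).

Fact pres_const_additive : zmod_morphism const.
Proof.
move=> a b; apply: etrans (_ : add (const a) (opp (const b)) = _) => //.
rewrite oppE addE.
by apply/pres_eqP => C g y sol /=; rewrite rmorphB.
Qed.
Fact pres_const_multiplicative : monoid_morphism const.
Proof.
split=> // a b; apply: etrans (_ : mul (const a) (const b) = _) => //.
by rewrite mulE; apply/pres_eqP => C g y sol /=; rewrite rmorphM.
Qed.
HB.instance Definition _ :=
  GRing.isZmodMorphism.Build A pres_ring const pres_const_additive.
HB.instance Definition _ :=
  GRing.isMonoidMorphism.Build A pres_ring const pres_const_multiplicative.

Definition pres_const : {rmorphism A -> pres_ring} := const.

Definition pres : calg k :=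
  CAlg (GRing.RMorphism.clone _ _ (pres_const \o calg_str A) _).

Definition pres_in : alg_hom A pres :=
  @AlgHom k A pres pres_const (fun=> erefl).

Definition pres_var (i : I) : pres := cls (TVar i).

Lemma pres_teval t : teval pres_in pres_var t = cls t.
Proof.
elim: t => //= [s -> t ->|s -> t ->|t ->].
- exact: addE.
- exact: mulE.
- exact: oppE.
Qed.

Lemma pres_surj (x : pres) : exists t, x = teval pres_in pres_var t.
Proof. by exists (repr x); rewrite pres_teval /cls reprK. Qed.

Lemma pres_solution : solution pres_in pres_var.
Proof.
move=> t tr; rewrite pres_teval; apply/pres_eqP => C g y sol /=.
by rewrite sol // rmorph0.
Qed.

Lemma pres_hom_ext (C : calg k) (f g : alg_hom pres C) :
  alg_comp f pres_in = alg_comp g pres_in ->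
  (forall i, f (pres_var i) = g (pres_var i)) -> f = g.
Proof.
move=> fg fgv; apply: alg_hom_ext => x; have [t ->] := pres_surj x.
rewrite !teval_hom; elim: t => //= [a|s -> t ->|s -> t ->|t ->] //.
exact: (congr1 (fun h : alg_hom A C => h a) fg).
Qed.

Section Lift.
Variables (C : calg k) (g : alg_hom A C) (y : I -> C) (sol : solution g y).

Let lift (x : pres_ring) : C := teval g y (repr x).

Fact pres_lift_additive : zmod_morphism lift.
Proof.
elim/clsW => s; elim/clsW => t.
rewrite [- _]oppE [_ + _]addE /lift !teval_repr //.
Qed.
Fact pres_lift_multiplicative : monoid_morphism lift.
Proof.
split; first by rewrite /lift [X in repr X]/1 teval_repr //= rmorph1.
by elim/clsW => s; elim/clsW => t; rewrite [_ * _]mulE /lift !teval_repr.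
Qed.
HB.instance Definition _ :=
  GRing.isZmodMorphism.Build pres_ring C lift pres_lift_additive.
HB.instance Definition _ :=
  GRing.isMonoidMorphism.Build pres_ring C lift pres_lift_multiplicative.

Fact pres_lift_str (c : k) : lift (calg_str pres c) = calg_str C c.
Proof. by rewrite /lift [X in repr X]/(cls _) teval_repr //= alg_hom_str. Qed.

Definition pres_lift : alg_hom pres C :=
  @AlgHom k pres C lift pres_lift_str.

Lemma pres_lift_in : alg_comp pres_lift pres_in = g.
Proof.
by apply: alg_hom_ext => a; rewrite /= /lift [X in repr X]/(cls _) teval_repr.
Qed.

Lemma pres_lift_var i : pres_lift (pres_var i) = y i.
Proof. by rewrite /= /lift /pres_var teval_repr. Qed.

End Lift.

End Presentation.
#[global] Opaque pres_in pres_lift pres_var.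

(** * Units and homomorphisms *)

Arguments uval : simpl never.

Section UnitFacts.
Variable A : comPzRingType.
Implicit Types u v : units A.

Lemma uval1 : uval (1%g : units A) = 1. Proof. by []. Qed.
Lemma uvalM u v : uval (u * v)%g = uval u * uval v. Proof. by []. Qed.
Lemma uvalMV u : uval u * uval u^-1%g = 1. Proof. exact: (eqP (valP u)). Qed.
Lemma uvalVM u : uval u^-1%g * uval u = 1. Proof. by rewrite mulrC uvalMV. Qed.
Lemma uvalX u n : uval (u ^+ n)%g = uval u ^+ n.
Proof. by elim: n => // n IHn; rewrite expgS exprS uvalM IHn. Qed.

Lemma unit_commute u v : commute u v. Proof. exact: unitsC. Qed.

Lemma unitXM u v n : ((u * v) ^+ n)%g = (u ^+ n * v ^+ n)%g.
Proof. by rewrite expgMn //; apply: unit_commute. Qed.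

Lemma uval_mulI u x y : uval u * x = uval u * y -> x = y.
Proof. by move/(congr1 ( *%R (uval u^-1%g))); rewrite !mulrA !uvalVM !mul1r. Qed.

Definition mkunit (x y : A) (xy : x * y = 1) : units A :=
  exist _ (x, y) (introT eqP xy).

End UnitFacts.

Section UnitMaps.
Variable k : fieldType.
Implicit Types A B C : calg k.

Lemma uval_map A B (f : alg_hom A B) (u : units A) :
  uval (units_map f u) = f (uval u).
Proof. by []. Qed.

Lemma units_map1 A B (f : alg_hom A B) : units_map f 1%g = 1%g.
Proof. by apply: units_inj; rewrite uval_map rmorph1. Qed.

Lemma units_mapV A B (f : alg_hom A B) (u : units A) :
  units_map f u^-1%g = (units_map f u)^-1%g.
Proof. by apply: units_inj. Qed.

Lemma units_mapX A B (f : alg_hom A B) (u : units A) n :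
  units_map f (u ^+ n)%g = (units_map f u ^+ n)%g.
Proof. by apply: units_inj; rewrite uval_map !uvalX rmorphXn. Qed.

Lemma units_map_inj A B (f : alg_hom A B) :
  injective f -> injective (units_map f).
Proof. by move=> fI u v /(congr1 (@uval B)) /fI /units_inj. Qed.

Lemma alg_comp_appl A B C (f : alg_hom A B) (g : alg_hom B C) (h : alg_hom A C)
  a : alg_comp g f = h -> g (f a) = h a.
Proof. by move=> <-. Qed.

Lemma alg_comp_inj A B C (f : alg_hom B C) (g h : alg_hom A B) :
  injective f -> alg_comp f g = alg_comp f h -> g = h.
Proof.
by move=> fI e; apply: alg_hom_ext => a; apply: fI; apply: (alg_comp_appl a e).
Qed.

Lemma alg_hom_factor A B C (i : alg_hom A B) (w : alg_hom C B) :
  injective i -> (forall c, exists a, i a = w c) ->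
  exists f : alg_hom C A, alg_comp i f = w.
Proof.
move=> iI /choice[f fE].
have fB : zmod_morphism f by move=> x y; apply: iI; rewrite rmorphB !fE rmorphB.
have fM : monoid_morphism f.
  by split=> [|x y]; apply: iI; rewrite ?rmorph1 ?rmorphM !fE ?rmorph1 ?rmorphM.
pose fA := GRing.isZmodMorphism.Build C A f fB.
pose fMM := GRing.isMonoidMorphism.Build C A f fM.
pose F : {rmorphism C -> A} := HB.pack f fA fMM.
have Fs c : F (calg_str C c) = calg_str A c.
  by apply: iI; rewrite /= fE !alg_hom_str.
by exists (AlgHom Fs); apply: alg_hom_ext => c /=; apply: fE.
Qed.

End UnitMaps.

(** * Adjoining a root of a unit *)

(** As 'X^q - u is monic, the powers of 'X of exponent less than q are independent
    in the quotient by it. *)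
Lemma root_model (R : comNzRingType) (q : nat) (u : R) : (0 < q)%N ->
  exists (D : comPzRingType) (g : {rmorphism R -> D}) (x : D),
    x ^+ q = g u /\
    forall c : 'I_q -> R, \sum_i g (c i) * x ^+ i = 0 -> forall i, c i = 0.
Proof.
move=> q_gt0; pose h : {poly R} := 'X^q - u%:P.
have sh : size h = q.+1 by rewrite size_XnsubC.
have hE : mk_monic h = h.
  by rewrite /mk_monic sh ltnS q_gt0 monicXnsubC.
exists {poly %/ h}, (GRing.RMorphism.clone R {poly %/ h} (in_qpoly h \o polyC) _).
exists (in_qpoly h 'X); split.
  rewrite -rmorphXn /= -[X in in_qpoly h X](subrK u%:P) rmorphD /= -/h.
  suff -> : in_qpoly h h = 0 by rewrite add0r.
  by apply/val_inj; rewrite /= hE Pdiv.RingMonic.rmodpp // monicXnsubC.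
move=> c c0 i; move: c0.
under eq_bigr => j _ do rewrite -rmorphXn /= -rmorphM.
rewrite -rmorph_sum => /(congr1 val) /=; rewrite hE.
have -> : \sum_(j < q) (c j)%:P * 'X^j
    = \poly_(j < q) (if insub j is Some j' then c j' else 0).
  rewrite poly_def; apply: eq_bigr => j _.
  by rewrite mul_polyC insubT ?ltn_ord // => H; congr (c _ *: _); apply: val_inj.
rewrite Pdiv.CommonRing.rmodp_small; last by rewrite sh ltnS size_poly.
move=> /(congr1 (fun p : {poly R} => p`_i)); rewrite coef_poly ltn_ord coef0.
by rewrite insubT // => H <-; congr c; apply: val_inj.
Qed.

Lemma root_model_pz (C : comPzRingType) (q : nat) (u : C) :
  1 != 0 :> C -> (0 < q)%N ->
  exists (D : comPzRingType) (g : {rmorphism C -> D}) (x : D),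
    x ^+ q = g u /\
    forall c : 'I_q -> C, \sum_i g (c i) * x ^+ i = 0 -> forall i, c i = 0.
Proof.
move=> C_neq0.
pose nz := GRing.PzSemiRing_isNonZero.Build C C_neq0.
pose R : comNzRingType := HB.pack (C : Type) C nz.
exact: (@root_model R q u).
Qed.

Section RootExt.
Variables (k : fieldType) (q : nat) (q_gt0 : (0 < q)%N) (C : calg k).
Variable u : units C.

Definition root_rel (t : term C unit) : Prop :=
  t = TAdd (iter q (TMul (TVar _ tt)) (TConst _ 1)) (TOpp (TConst _ (uval u))).

Definition rootext : calg k := pres root_rel.
Definition root_in : alg_hom C rootext := pres_in root_rel.
Let rt : rootext := pres_var root_rel tt.

Lemma teval_exp D (g : alg_hom C D) (y : unit -> D) n (t : term C unit) :
  teval g y (iter n (TMul t) (TConst _ 1)) = teval g y t ^+ n.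
Proof.
by elim: n => [|n IHn]; rewrite ?expr0 ?exprS -?IHn //=; apply: rmorph1.
Qed.

Lemma root_solution D (g : alg_hom C D) (r : units D) :
  (r ^+ q)%g = units_map g u -> solution root_rel g (fun=> uval r).
Proof.
move=> /(congr1 (@uval _)); rewrite uvalX uval_map => rq t ->.
rewrite -[LHS]/(teval g _ _ - g (uval u)) teval_exp.
by apply/eqP; rewrite subr_eq0 -rq.
Qed.

Let rtX : rt ^+ q = root_in (uval u).
Proof.
have /eqP := pres_solution (erefl : root_rel _).
rewrite -[X in X == _]/(teval _ _ _ - root_in (uval u)) teval_exp subr_eq0.
by move/eqP.
Qed.

Fact root_unit : rt * (rt ^+ q.-1 * root_in (uval u^-1%g)) = 1.
Proof. by rewrite mulrA -exprS prednK // rtX -rmorphM uvalMV rmorph1. Qed.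

Definition troot : units rootext := mkunit root_unit.

Let uval_root : uval troot = rt. Proof. by []. Qed.

Lemma trootX : (troot ^+ q)%g = units_map root_in u.
Proof. by apply: units_inj; rewrite uvalX uval_map rtX. Qed.

Definition root_lift D (g : alg_hom C D) (r : units D)
  (rq : (r ^+ q)%g = units_map g u) : alg_hom rootext D :=
  pres_lift (root_solution rq).

Lemma root_lift_in D (g : alg_hom C D) (r : units D)
  (rq : (r ^+ q)%g = units_map g u) : alg_comp (root_lift rq) root_in = g.
Proof. exact: pres_lift_in. Qed.

Lemma root_lift_root D (g : alg_hom C D) (r : units D)
  (rq : (r ^+ q)%g = units_map g u) : units_map (root_lift rq) troot = r.
Proof. by apply: units_inj; rewrite uval_map /uval pres_lift_var. Qed.

Lemma root_hom_ext D (f g : alg_hom rootext D) :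
  alg_comp f root_in = alg_comp g root_in ->
  units_map f troot = units_map g troot -> f = g.
Proof.
move=> fg /(congr1 (@uval _)); rewrite !uval_map => fgr.
by apply: pres_hom_ext => // -[].
Qed.

Opaque root_in.

Definition root_comb (c : 'I_q -> C) : rootext :=
  \sum_(i < q) root_in (c i) * uval troot ^+ i.

Let spanned x := exists c, x = root_comb c.

Let spanned_monom a n : spanned (root_in a * uval troot ^+ n).
Proof.
exists (fun i => if (i : nat) == (n %% q)%N then a * uval u ^+ (n %/ q) else 0).
have nq : (n %% q < q)%N by rewrite ltn_mod.
rewrite /root_comb (bigD1 (Ordinal nq)) //= eqxx big1 ?addr0 => [|i].
  rewrite {1}(divn_eq n q) exprD mulnC exprM [_ ^+ q]rtX rmorphM rmorphXn.
  by rewrite mulrA.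
by rewrite -val_eqE /= => /negPf ->; rewrite rmorph0 mul0r.
Qed.

Let spannedD x y : spanned x -> spanned y -> spanned (x + y).
Proof.
move=> [c ->] [d ->]; exists (fun i => c i + d i).
by rewrite /root_comb -big_split; apply: eq_bigr => i _; rewrite rmorphD mulrDl.
Qed.

Let spanned0 : spanned 0.
Proof.
by exists (fun=> 0); rewrite /root_comb big1 // => i _; rewrite rmorph0 mul0r.
Qed.

Let spannedN x : spanned x -> spanned (- x).
Proof.
move=> [c ->]; exists (fun i => - c i).
by rewrite /root_comb -sumrN; apply: eq_bigr => i _; rewrite rmorphN mulNr.
Qed.

Let spannedM x y : spanned x -> spanned y -> spanned (x * y).
Proof.
move=> [c ->] [d ->]; rewrite [_ * _]mulr_suml.
apply: big_ind => // i _; rewrite mulr_sumr; apply: big_ind => // j _.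
rewrite mulrACA -rmorphM -exprD; exact: spanned_monom.
Qed.

Lemma root_span x : exists c, x = root_comb c.
Proof.
have [t ->] := pres_surj x; elim: t => /= [a|[]|s IHs t IHt|s IHs t IHt|t IHt].
- by have := spanned_monom a 0; rewrite expr0 mulr1.
- by have := spanned_monom 1 1; rewrite rmorph1 mul1r expr1.
- exact: spannedD.
- exact: spannedM.
- exact: spannedN.
Qed.

(** Over a nonzero ring, a combination of the powers of the adjoined root is
    zero only if it is zero in every algebra that contains a q-th root of u, in
    particular in the quotient of the polynomial ring by 'X^q - u. *)
Lemma root_free c : root_comb c = 0 -> forall i, c i = 0.
Proof.
move=> c0 i; have [C0|C_neq0] := eqVneq (1 : C) 0.
  by rewrite -[c i]mulr1 C0 mulr0.
have [D [g [x [xq gfree]]]] := root_model_pz (uval u) C_neq0 q_gt0.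
pose Dk := @CAlg k D (GRing.RMorphism.clone _ _ (g \o calg_str C) _).
pose gk : alg_hom C Dk := @AlgHom k C Dk g (fun=> erefl).
have sol : solution root_rel gk (fun=> x).
  move=> t ->; rewrite -[LHS]/(teval gk _ _ - gk (uval u)) teval_exp.
  by apply/eqP; rewrite subr_eq0 /= xq.
apply: gfree; have := congr1 (pres_lift sol) c0.
rewrite rmorph0 rmorph_sum => {2}<-; apply: eq_bigr => j _.
rewrite rmorphM rmorphXn (alg_comp_appl _ (pres_lift_in sol)) uval_root.
by rewrite (pres_lift_var sol).
Qed.

Lemma root_in_inj : injective root_in.
Proof.
move=> a b ab; apply/eqP; rewrite -subr_eq0; apply/eqP.
pose c (i : 'I_q) := if (i : nat) == 0%N then a - b else 0.
apply: (@root_free c _ (Ordinal q_gt0)).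
rewrite /root_comb (bigD1 (Ordinal q_gt0)) //= big1 => [|i].
  by rewrite /c /= expr0 mulr1 rmorphB ab subrr addr0.
by rewrite -val_eqE /c /= => /negPf ->; rewrite rmorph0 mul0r.
Qed.

Lemma root_comb_inj c d : root_comb c = root_comb d -> c =1 d.
Proof.
move=> cd i; apply/eqP; rewrite -subr_eq0; apply/eqP.
apply: (@root_free (fun i => c i - d i)).
rewrite -[RHS](subrr (root_comb c)) {2}cd /root_comb -sumrB.
by apply: eq_bigr => j _; rewrite rmorphB mulrBl.
Qed.

End RootExt.
Arguments troot {k q} q_gt0 {C} u.
Arguments root_in {k q C} u.
Arguments rootext {k} q {C} u.
Arguments root_hom_ext {k q} q_gt0 {C u D f g}.

Lemma expr1D_sq0 (R : comPzRingType) (x : R) n :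
  x * x = 0 -> (1 + x) ^+ n = 1 + x *+ n.
Proof.
move=> x2; elim: n => [|n IHn]; first by rewrite expr0 mulr0n addr0.
rewrite exprS IHn mulrDl mul1r mulrDr mulr1 mulrnAr x2 mul0rn addr0.
by rewrite mulrS [x + _]addrC addrA.
Qed.

(** * Descent and etaleness along the adjunction of a root *)

Section RootEqualizer.
Variables (k : fieldType) (q : nat) (q_gt0 : (0 < q)%N) (C : calg k).
Variable u : units C.

Let S := rootext q u.
Let S2 := rootext q (1%g : units S).

(** On spectra, [root_twist] is the action of mu_q on the q-th roots of u: it
    sends the root s to x s, where x^q = 1. *)
Fact root_twist_subproof :
  ((troot q_gt0 1%g * units_map (root_in 1%g) (troot q_gt0 u)) ^+ q)%g
  = units_map (alg_comp (root_in (1%g : units S)) (root_in u)) u :> units S2.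
Proof.
by rewrite unitXM trootX units_map1 mul1g -units_mapX trootX units_map_comp.
Qed.

Definition root_twist : alg_hom S S2 := root_lift root_twist_subproof.

(** Comparing the coefficients of x^i, the two images of \sum_i c_i s^i are equal
    only if c_i s^i = 0 for i > 0. *)
Lemma root_equalizer z :
  root_in (1%g : units S) z = root_twist z -> exists c, root_in u c = z.
Proof.
have [c zE] := root_span q_gt0 z; rewrite {2}zE => e.
pose d1 (i : 'I_q) := if i == Ordinal q_gt0 then z else 0.
pose d2 (i : 'I_q) := root_in u (c i) * uval (troot q_gt0 u) ^+ i.
have /root_comb_inj/(_ (Ordinal q_gt0)) :
    root_comb q_gt0 (1%g : units S) d1 = root_comb q_gt0 (1%g : units S) d2.
  have -> : root_comb q_gt0 (1%g : units S) d1 = root_in 1%g z.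
    rewrite /root_comb (bigD1 (Ordinal q_gt0)) //= big1 => [|i ne0].
      by rewrite /d1 eqxx expr0 mulr1 addr0.
    by rewrite /d1 (negPf ne0) rmorph0 mul0r.
  rewrite e rmorph_sum; apply: eq_bigr => i _; rewrite !rmorphM !rmorphXn.
  rewrite (alg_comp_appl _ (root_lift_in root_twist_subproof)).
  rewrite -[root_twist _]uval_map (root_lift_root q_gt0) uvalM exprMn.
  by rewrite -mulrA [_ * uval (troot _ _) ^+ _]mulrC.
by rewrite /d1 /d2 eqxx expr0 mulr1 => ->; exists (c (Ordinal q_gt0)).
Qed.

End RootEqualizer.

Section RootEtale.
Variables (k : fieldType) (q : nat) (q_gt0 : (0 < q)%N).
Implicit Types A B C : calg k.

(** A q-th root c0 modulo an ideal of square zero is corrected by a factor 1 + x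
    with x in the ideal; as (1 + x)^q = 1 + q x and q is invertible, there is
    exactly one such x. *)
Lemma root_formally_etale C (u : units C) :
  q%:R != 0 :> k -> formally_etale (root_in (q := q) u).
Proof.
move=> q_neq0 D E p p_surj p_sq0 U v Uv.
pose r := troot q_gt0 u.
have qV (x : D) : x * calg_str D q%:R^-1 *+ q = x.
  rewrite -mulrnAr -rmorphMn /= -mulr_natl.
  by rewrite divff // rmorph1 mulr1.
have UvE a : p (U a) = v (root_in u a).
  by have := congr1 (fun h : alg_hom C E => h a) Uv.
have [c0 c0E] := p_surj (v (uval r)).
(* The defect of c0, an element of the kernel of p. *)
pose d := c0 ^+ q - U (uval u).
have pd : p d = 0.
  rewrite rmorphB rmorphXn c0E -rmorphXn -uvalX trootX UvE uval_map.
  by rewrite subrr.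
pose x := - (d * U (uval u^-1%g)) * calg_str D q%:R^-1.
have px : p x = 0 by rewrite !(rmorphM, rmorphN) pd mul0r oppr0 mul0r.
pose c := c0 * (1 + x).
have cq : c ^+ q = U (uval u).
  rewrite exprMn expr1D_sq0; last exact: p_sq0.
  rewrite /x qV.
  have -> : c0 ^+ q = U (uval u) + d by rewrite addrC subrK.
  rewrite mulrDl !mulrDr !mulr1 !mulrN [d * (d * _)]mulrA (p_sq0 _ _ pd pd) mul0r oppr0.
  by rewrite addr0 mulrCA -rmorphM uvalMV rmorph1 mulr1 -addrA addNr addr0.
have cU : c * (c ^+ q.-1 * U (uval u^-1%g)) = 1.
  by rewrite mulrA -exprS prednK // cq -rmorphM uvalMV rmorph1.
have ruE : ((mkunit cU) ^+ q)%g = units_map U u.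
  by apply: units_inj; rewrite uvalX uval_map -cq.
exists (root_lift ruE); split.
  split; first exact: root_lift_in.
  apply: (root_hom_ext q_gt0).
    by rewrite -alg_compA root_lift_in.
  rewrite units_map_comp (root_lift_root q_gt0); apply: units_inj.
  rewrite !uval_map -[uval (mkunit cU)]/c rmorphM c0E rmorphD rmorph1 px addr0 mulr1.
  by [].
move=> w [wU wv]; apply: (root_hom_ext q_gt0); rewrite ?root_lift_in //.
rewrite (root_lift_root q_gt0).
pose c' := units_map w r; rewrite -/c'.
pose t := (c' * (mkunit cU)^-1)%g.
have tq : (t ^+ q = 1)%g.
  by rewrite unitXM expVgn ruE -units_mapX trootX -units_map_comp wU mulgV.
have pt : p (uval t - 1) = 0.
  rewrite rmorphB rmorph1 -uval_map units_mapM units_mapV -units_map_comp wv.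
  apply/eqP; rewrite subr_eq0 -uval1; apply/eqP; congr uval.
  apply: (mulIg (units_map p (mkunit cU))); rewrite mulgVK mul1g.
  apply: units_inj; rewrite !uval_map -[uval (mkunit cU)]/c rmorphM c0E rmorphD.
  by rewrite rmorph1 px addr0 mulr1.
have t1 : t = 1%g.
  apply: units_inj; rewrite uval1 -[LHS](subrK 1) addrC -[RHS]addr0; congr (_ + _).
  have : (uval t - 1) *+ q = 0.
    apply: (addrI 1); rewrite addr0 -expr1D_sq0; last exact: p_sq0.
    by rewrite [1 + _]addrC subrK -uvalX tq.
  move/(congr1 (fun y => y * calg_str D q%:R^-1)); rewrite mul0r mulrnAl.
  by rewrite qV.
by rewrite -[RHS](mulgVK (mkunit cU)) -/t t1 mul1g.
Qed.

Lemma formally_etale_comp A B C (g : alg_hom B C) (f : alg_hom A B) :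
  formally_etale g -> formally_etale f -> formally_etale (alg_comp g f).
Proof.
move=> gE fE D E p p_surj p_sq0 u v uv.
have [w [[wf wp] w_uniq]] :=
  fE D E p p_surj p_sq0 u (alg_comp v g) (etrans uv (alg_compA _ _ _)).
have [t [[tg tp] t_uniq]] := gE D E p p_surj p_sq0 w v wp.
exists t; split; first by rewrite alg_compA tg.
move=> t' [t'gf t'p]; apply: t_uniq; split=> //; apply/esym/w_uniq.
by rewrite -alg_compA t'gf alg_compA t'p.
Qed.

Section PolyEval.
Variables (A B : calg k) (f : alg_hom A B) (n : nat).
Implicit Type p : seq (A * {ffun 'I_n -> nat}).

Lemma poly_eval_cat p p' (x : 'I_n -> B) :
  poly_eval f (p ++ p') x = poly_eval f p x + poly_eval f p' x.
Proof. exact: big_cat. Qed.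

Lemma poly_eval_opp p (x : 'I_n -> B) :
  poly_eval f [seq (- t.1, t.2) | t <- p] x = - poly_eval f p x.
Proof.
by rewrite /poly_eval big_map -sumrN; apply: eq_bigr => t _; rewrite rmorphN mulNr.
Qed.

Definition term_mul (s t : A * {ffun 'I_n -> nat}) : A * {ffun 'I_n -> nat} :=
  (s.1 * t.1, [ffun i => (s.2 i + t.2 i)%N]).

Lemma poly_eval_mul p p' (x : 'I_n -> B) :
  poly_eval f [seq term_mul s t | s <- p, t <- p'] x
  = poly_eval f p x * poly_eval f p' x.
Proof.
rewrite /poly_eval big_allpairs_dep mulr_suml; apply: eq_bigr => s _.
rewrite mulr_sumr; apply: eq_bigr => t _ /=; rewrite rmorphM mulrACA -big_split.
by congr (_ * _); apply: eq_bigr => i _; rewrite ffunE exprD.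
Qed.

Lemma poly_eval_monom a (x : 'I_n -> B) i m :
  poly_eval f [:: (a, [ffun j => if j == i then m else 0%N])] x = f a * x i ^+ m.
Proof.
rewrite /poly_eval big_seq1 (bigD1 i) //= big1 => [|j ji].
  by rewrite ffunE eqxx mulr1.
by rewrite ffunE (negPf ji) expr0.
Qed.

Lemma poly_eval_const a (x : 'I_n -> B) :
  poly_eval f [:: (a, [ffun=> 0%N])] x = f a.
Proof.
by rewrite /poly_eval big_seq1 /= big1 ?mulr1 // => j _; rewrite ffunE expr0.
Qed.

Lemma poly_eval_hom (C : calg k) (h : alg_hom B C) p (x : 'I_n -> B) :
  h (poly_eval f p x) = poly_eval (alg_comp h f) p (h \o x).
Proof.
rewrite rmorph_sum; apply: eq_bigr => t _; rewrite rmorphM rmorph_prod.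
by congr (_ * _); apply: eq_bigr => i _; rewrite rmorphXn.
Qed.

End PolyEval.

Lemma teval_poly A n (t : term A 'I_n) :
  exists p : seq (A * {ffun 'I_n -> nat}),
    forall B (f : alg_hom A B) x, teval f x t = poly_eval f p x.
Proof.
elim: t => [a|i|s [p pE] t [p' pE']|s [p pE] t [p' pE']|t [p pE]].
- by exists [:: (a, [ffun=> 0%N])] => B f x; rewrite poly_eval_const.
- exists [:: (1, [ffun j => if j == i then 1%N else 0%N])] => B f x.
  by rewrite poly_eval_monom rmorph1 mul1r expr1.
- by exists (p ++ p') => B f x; rewrite poly_eval_cat /= pE pE'.
- by eexists => B f x; rewrite /= pE pE' -poly_eval_mul.
- by eexists => B f x; rewrite /= pE -poly_eval_opp.
Qed.

Definition poly_term A n (p : seq (A * {ffun 'I_n -> nat})) : term A 'I_n :=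
  foldr (fun t : A * {ffun 'I_n -> nat} => TAdd (TMul (TConst _ t.1)
    (foldr (fun i => TMul (iter (t.2 i) (TMul (TVar _ i)) (TConst _ 1)))
       (TConst _ 1) (index_enum 'I_n)))) (TConst _ 0) p.

Lemma poly_termE A B (f : alg_hom A B) n p (x : 'I_n -> B) :
  teval f x (poly_term p) = poly_eval f p x.
Proof.
rewrite /poly_eval; elim: p => [|t p IHp] /=; first by rewrite big_nil rmorph0.
rewrite big_cons IHp; congr (_ * _ + _).
elim: (index_enum _) => [|i s IHs] /=; first by rewrite big_nil rmorph1.
rewrite big_cons IHs; congr (_ * _).
by elim: (t.2 i) => [|m IHm] /=; rewrite ?expr0 ?rmorph1 // exprS IHm.
Qed.

(** The subalgebra generated by the generators has the same universal property
    as the whole algebra. Here the subalgebra is replaced by the algebra with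
    the same generators and relations, whose elements are visibly polynomials
    in the generators. *)
Lemma presentation_surj A B (f : alg_hom A B) n
    (rels : seq (seq (A * {ffun 'I_n -> nat}))) (x : 'I_n -> B) :
  (forall p, p \in rels -> poly_eval f p x = 0) ->
  (forall C (g : alg_hom A C) (y : 'I_n -> C),
       (forall p, p \in rels -> poly_eval g p y = 0) ->
       exists! h : alg_hom B C,
         alg_comp h f = g /\ forall i, h (x i) = y i) ->
  forall b, exists p, b = poly_eval f p x.
Proof.
move=> x0 univ b.
pose rel (t : term A 'I_n) := exists2 p, p \in rels & t = poly_term p.
have [|h [[hf hx] _]] := univ _ (pres_in rel) (@pres_var _ _ _ rel).
  by move=> p pr; rewrite -poly_termE; apply: pres_solution; exists p.
have sol : solution rel f x by move=> _ [p pr ->]; rewrite poly_termE x0.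
have jh : alg_comp (pres_lift sol) h = alg_id B.
  have [j [_ j_uniq]] := univ _ f x x0.
  rewrite -(j_uniq (alg_id B)) ?alg_comp1f //; apply/esym/j_uniq; split.
    by rewrite -alg_compA hf pres_lift_in.
  by move=> i; rewrite /= hx (pres_lift_var sol).
have [t tE] := pres_surj (h b); have [p pE] := teval_poly t.
exists p; rewrite -pE -[LHS](alg_comp_appl b jh) tE teval_hom.
elim: {tE pE} t => //= [a|i|s -> t ->|s -> t ->|t ->] //.
  exact: (congr1 (fun h : alg_hom A B => h a) (pres_lift_in sol)).
exact: pres_lift_var.
Qed.

(** The equation s^q = u becomes a relation over A once u is written as a polynomial
    in the generators of B. *)
Lemma finitely_presented_root A B (f : alg_hom A B) (u : units B) :
  finitely_presented f ->
  finitely_presented (alg_comp (root_in (q := q) u) f).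
Proof.
move=> [n [rels [x [x0 univ]]]].
have [pu puE] := presentation_surj x0 univ (uval u).
pose wide (p : seq (A * {ffun 'I_n -> nat})) : seq (A * {ffun 'I_n.+1 -> nat}) :=
  [seq (t.1, [ffun i : 'I_n.+1 => if unlift ord_max i is Some j then t.2 j else 0%N])
     | t : A * {ffun 'I_n -> nat} <- p].
have wideE C (g : alg_hom A C) (y : 'I_n.+1 -> C) p :
    poly_eval g (wide p) y = poly_eval g p (y \o lift ord_max).
  rewrite /poly_eval big_map; apply: eq_bigr => t _ /=; congr (_ * _).
  rewrite (bigD1_ord ord_max) //= ffunE unlift_none expr0 mul1r.
  by apply: eq_bigr => i _; rewrite ffunE liftK.
pose prt := (1 : A, [ffun j => if j == ord_max then q else 0%N] : {ffun 'I_n.+1 -> nat})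
  :: [seq (- t.1, t.2) | t <- wide pu].
have prtE C (g : alg_hom A C) (y : 'I_n.+1 -> C) :
    poly_eval g prt y = y ord_max ^+ q - poly_eval g pu (y \o lift ord_max).
  rewrite /prt -cat1s poly_eval_cat poly_eval_opp wideE poly_eval_monom.
  by rewrite rmorph1 mul1r.
pose r := uval (troot q_gt0 u).
pose x' i := if unlift ord_max i is Some j then root_in u (x j) else r.
have x'l : x' \o lift ord_max = root_in u \o x.
  by apply/funext => i; rewrite /x' /= liftK.
exists n.+1, (prt :: [seq wide p | p <- rels]), x'; split.
  move=> p; rewrite inE => /predU1P[->|/mapP[p' p'r ->]].
    rewrite prtE x'l -poly_eval_hom -puE /x' unlift_none /r -uvalX trootX.
    by rewrite uval_map subrr.
  by rewrite wideE x'l -poly_eval_hom x0 // rmorph0.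
move=> C g y y0.
have [|h [[hf hx] h_uniq]] := univ C g (y \o lift ord_max).
  by move=> p pr; rewrite -wideE y0 // inE map_f ?orbT.
have yq : y ord_max ^+ q = h (uval u).
  have := y0 prt (mem_head _ _); rewrite prtE puE poly_eval_hom hf => /eqP.
  rewrite subr_eq0 => /eqP ->; congr poly_eval; apply/funext => i.
  by rewrite /= hx.
have yU : y ord_max * (y ord_max ^+ q.-1 * h (uval u^-1%g)) = 1.
  by rewrite mulrA -exprS prednK // yq -rmorphM uvalMV rmorph1.
have yr : ((mkunit yU) ^+ q)%g = units_map h u.
  by apply: units_inj; rewrite uvalX uval_map -yq.
have yr_root : root_lift yr r = y ord_max.
  by rewrite -[LHS]uval_map (root_lift_root q_gt0).
exists (root_lift yr); split.
  split; first by rewrite alg_compA root_lift_in.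
  move=> i; rewrite /x'; case: unliftP => [j ->|->//].
  by rewrite (alg_comp_appl _ (root_lift_in yr)) hx.
move=> w [wf wy]; apply: (root_hom_ext q_gt0).
  rewrite root_lift_in; apply: h_uniq; rewrite -alg_compA wf; split=> // i.
  by have := wy (lift ord_max i); rewrite /x' liftK.
rewrite (root_lift_root q_gt0); apply: units_inj; rewrite uval_map -/r.
by have := wy ord_max; rewrite /x' unlift_none => ->.
Qed.

End RootEtale.

Local Open Scope classical_set_scope.

Section PrimeDisjoint.
Variables (A : comPzRingType) (I0 M : set A).

Definition is_ideal (I : set A) : Prop :=
  [/\ I 0, (forall a b, I a -> I b -> I (a + b)) & forall a b, I b -> I (a * b)].

Hypotheses (I0_ideal : is_ideal I0) (M1 : M 1).
Hypothesis MM : forall a b, M a -> M b -> M (a * b).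
Hypothesis I0M : forall a, I0 a -> ~ M a.

Let good (I : set A) := [/\ is_ideal I, I0 `<=` I & forall a, I a -> ~ M a].

(** Krull's argument: an ideal that contains I0 and is maximal among those that do
    not meet the multiplicative set M is prime. *)
Lemma exists_prime_disjoint : exists Q : set A,
  [/\ prime_ideal Q, I0 `<=` Q & forall a, Q a -> ~ M a].
Proof.
(* The empty set is admitted because it is the union of the empty chain. *)
have [|Q [goodQ maxQ]] := @Zorn_bigcup A (fun I => I = set0 \/ good I).
  move=> F Fgood Ftot.
  have [[I FI goodI]|nogood] := pselect (exists2 I, F I & good I); last first.
    left; rewrite bigcup0 // => I FI; have [//|goodI] := Fgood _ FI.
    by case: nogood; exists I.
  have Fideal J a : F J -> J a -> is_ideal J.
    by move=> FJ Ja; have [J0|[]//] := Fgood _ FJ; move: Ja; rewrite J0.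
  right; split; first split.
  - by exists I => //; have [[]] := goodI.
  - move=> a b [J FJ Ja] [K FK Kb]; have [JK|KJ] := Ftot _ _ FJ FK.
      exists K => //; have [_ KD _] := Fideal _ _ FK Kb.
      by apply: KD => //; apply: JK.
    exists J => //; have [_ JD _] := Fideal _ _ FJ Ja.
    by apply: JD => //; apply: KJ.
  - move=> a b [J FJ Jb]; exists J => //.
    by have [_ _ JM] := Fideal _ _ FJ Jb; apply: JM.
  - by move=> a I0a; exists I => //; have [_ I0I _] := goodI; apply: I0I.
  - move=> a [J FJ Ja]; have [J0|[_ _ JM]] := Fgood _ FJ; last exact: JM.
    by move: Ja; rewrite J0.
have {}goodQ : good Q.
  case: goodQ => // Q0; case: (maxQ I0); last by right; split.
  by rewrite Q0; split=> // /(_ 0); apply; have [] := I0_ideal.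
have [[Q0 QD QM] I0Q QnM] := goodQ.
exists Q; split=> //; split=> // [Q1|a b Qab]; first exact: (QnM 1).
(* The ideal generated by Q and x. *)
pose ext x := [set z : A | exists y, Q (z - y * x)].
have extP x : ~ Q x -> exists m, ext x m /\ M m.
  move=> nQx; apply: contrapT => noM.
  have Qext : Q `<=` ext x by move=> z Qz; exists 0; rewrite mul0r subr0.
  apply: (maxQ (ext x)).
    split=> // /(_ x) ; apply/not_implyP; split=> //.
    by exists 1; rewrite mul1r subrr.
  right; split; first split.
  - exact: Qext.
  - move=> z w [y Qy] [y' Qy']; exists (y + y').
    by rewrite mulrDl opprD addrACA; apply: QD.
  - by move=> z w [y Qy]; exists (z * y); rewrite -mulrA -mulrBr; apply: QM.
  - by apply: subset_trans Qext.
  - by move=> z extz Mz; apply: noM; exists z.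
have [Qa|/extP[m [[y Qy] Mm]]] := pselect (Q a); first by left.
have [Qb|/extP[m' [[y' Qy'] Mm']]] := pselect (Q b); first by right.
exfalso; apply: (QnM (m * m')); last exact: MM.
have -> : m * m' = m' * (m - y * a) + (y * a * (m' - y' * b) + y * y' * (a * b)).
  rewrite !mulrBr [y * a * (y' * b)]mulrACA subrK.
  by rewrite [m' * m]mulrC [m' * (y * a)]mulrC subrK.
by apply: (QD); [apply: (QM) | apply: (QD); apply: (QM)].
Qed.

End PrimeDisjoint.

Section RootCover.
Variables (k : fieldType) (q : nat) (q_gt0 : (0 < q)%N).
Implicit Types A B C : calg k.

(** A prime over P is found among the ideals that contain the extension of P and
    do not meet the image of the complement of P. The extension of P is such an
    ideal because by freeness its elements have their coefficients in P. *)
Lemma root_spec_surjective C (u : units C) :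
  spec_surjective (root_in (q := q) u).
Proof.
move=> P [P0 PD PM P1 Pprime].
pose PS := [set z : rootext q u | in_ideal (root_in u @` P) z].
pose M := [set z : rootext q u | exists2 m, ~ P m & z = root_in u m].
have PS_coef z : PS z -> exists2 c, forall i, P (c i) & z = root_comb q_gt0 u c.
  move=> [s sP ->] {z}; elim: s sP => [|[a b] s IHs] sP.
    exists (fun=> 0) => //.
    by rewrite big_nil /root_comb big1 // => i _; rewrite rmorph0 mul0r.
  have [|c cP cE] := IHs; first by move=> p ps; apply: sP; rewrite inE ps orbT.
  have [p Pp /= pE] := sP (a, b) (mem_head _ _).
  have [d dE] := root_span q_gt0 a.
  exists (fun i => d i * p + c i) => [i|]; first by apply: PD => //; apply: PM.
  rewrite big_cons cE /= -pE dE /root_comb mulr_suml -big_split.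
  by apply: eq_bigr => i _; rewrite rmorphD rmorphM mulrDl mulrAC.
have [||||Q [Qprime PSQ QM]] := @exists_prime_disjoint (rootext q u) PS M.
- split; first by exists [::] => //; rewrite big_nil.
    move=> _ _ [s sP ->] [t tP ->]; exists (s ++ t); last by rewrite big_cat.
    by move=> p; rewrite mem_cat => /orP[/sP|/tP].
  move=> a _ [s sP ->]; exists [seq (a * p.1, p.2) | p <- s].
    by move=> _ /mapP[p /sP sPp ->].
  by rewrite big_map mulr_sumr; apply: eq_bigr => p _; rewrite mulrA.
- by exists 1 => //; rewrite rmorph1.
- move=> _ _ [m nPm ->] [m' nPm' ->]; exists (m * m'); last by rewrite rmorphM.
  by move=> /Pprime[].
- move=> z /PS_coef[c cP zc] [m nPm zm]; apply: nPm.
  pose d (i : 'I_q) := if i == Ordinal q_gt0 then m else 0.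
  have /root_comb_inj/(_ (Ordinal q_gt0)) : root_comb q_gt0 u d = root_comb q_gt0 u c.
    rewrite -zc zm /root_comb (bigD1 (Ordinal q_gt0)) //= big1 => [|i ne0].
      by rewrite /d eqxx expr0 mulr1 addr0.
    by rewrite /d (negPf ne0) rmorph0 mul0r.
  by rewrite /d eqxx => ->.
exists Q => //; apply/seteqP; split=> [a Qa|a Pa].
  by apply: contrapT => nPa; apply: (QM _ Qa); exists a.
apply: PSQ; exists [:: (1, root_in u a)]; last by rewrite big_seq1 mul1r.
by move=> p; rewrite inE => /eqP -> /=; exists a.
Qed.

Lemma etale_cover_root A B (f : alg_hom A B) (u : units B) :
  q%:R != 0 :> k ->
  etale_cover f -> etale_cover (alg_comp (root_in (q := q) u) f).
Proof.
move=> q_neq0 [[f_fp f_et] f_surj]; split; first split.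
- exact: finitely_presented_root.
- by apply: formally_etale_comp => //; apply: root_formally_etale.
- move=> P /f_surj[P' P'_prime <-].
  have [P'' P''_prime <-] := root_spec_surjective u P'_prime.
  by exists P''.
Qed.

End RootCover.

(** * Quotient stacks by isomorphic actions *)

Section QuotIso.
Variables (k : fieldType) (G : kgroup k) (X : kfunctor k) (aX : kaction G X).

Lemma quot_hom_iso A (x y : quot_ob aX A) (f : quot_hom x y)
    (t : alg_hom (tot (qtors x)) (tot (qtors y))) :
  qbase f = alg_id A ->
  alg_comp (qtot f) t = alg_id _ -> alg_comp t (qtot f) = alg_id _ ->
  iso_in_fibre (X := quotient_stack aX) x y.
Proof.
move=> f1 ft tf.
have tproj_t : alg_comp t (tproj (qtors x)) = alg_comp (tproj (qtors y)) (alg_id A).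
  have := qhom_proj f; rewrite f1 !alg_compf1 => <-.
  by rewrite alg_compA tf alg_comp1f.
have t_act C (g : G C) (p : kspec (tot (qtors y)) C) :
    alg_comp (act (tact (qtors y)) g p) t = act (tact (qtors x)) g (alg_comp p t).
  rewrite -[p in LHS]alg_compf1 -tf alg_compA -qhom_act -alg_compA ft.
  by rewrite alg_compf1.
have t_map C (p : kspec (tot (qtors y)) C) : qmap (q := x) (alg_comp p t) = qmap p.
  by rewrite -(qhom_map f) -alg_compA tf alg_compf1.
exists f, (QuotHom tproj_t t_act t_map).
by split=> //; apply: quot_hom_ext; rewrite //= f1 alg_comp1f.
Qed.

End QuotIso.

Section Transport.
Variables (k : fieldType) (G H : kgroup k) (X Y : kfunctor k).
Variables (aX : kaction G X) (aY : kaction H Y).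
Variables (theta : kgroup_hom G H) (theta' : kgroup_hom H G).
Hypotheses (thetaK : forall A, cancel (theta A) (theta' A)).
Hypotheses (theta'K : forall A, cancel (theta' A) (theta A)).
Variable (tau : forall A, X A -> Y A).
Hypothesis tau_nat : forall A B (f : alg_hom A B) x,
  tau (pts_map f x) = pts_map f (tau x).
Hypothesis tau_act : forall A (g : G A) (x : X A),
  tau (act aX g x) = act aY (theta A g) (tau x).

Lemma kghom1 (G1 G2 : kgroup k) (f : kgroup_hom G1 G2) A : f A 1%g = 1%g.
Proof. by apply: (mulgI (f A 1%g)); rewrite -ghomM !mulg1. Qed.

Definition transport_act (Z : kfunctor k) (a : kaction G Z) : kaction H Z.
Proof.
refine (@KAction k H Z (fun A h z => act a (theta' A h) z) _ _ _).
- by move=> A z; rewrite kghom1 act1.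
- by move=> A h h' z; rewrite ghomM actM.
- by move=> A B f h z; rewrite act_nat ghom_nat.
Defined.

Definition transport_torsor A (P : torsor G A) : torsor H A.
Proof.
refine (@Torsor k H A (tot P) (tproj P) (transport_act (tact P)) _ _ _).
- by move=> C h p; apply: tact_proj.
- move=> C p p' /(tact_simply_transitive (t := P))[g [gp g_uniq]].
  exists (theta C g); split=> [|h hp]; first by rewrite /= thetaK.
  by rewrite (g_uniq _ hp) theta'K.
- exact: tlocal_section.
Defined.

Definition transport_ob A (x : quot_ob aX A) : quot_ob aY A.
Proof.
refine (@QuotOb k H Y aY A (transport_torsor (qtors x))
  (fun C p => tau (qmap (q := x) p)) _ _).
- by move=> B C f p; rewrite qmap_nat tau_nat.
- by move=> C h p; rewrite /= qmap_equiv tau_act theta'K.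
Defined.

Definition transport_hom A B (x : quot_ob aX A) (y : quot_ob aX B)
  (f : quot_hom x y) : quot_hom (transport_ob x) (transport_ob y).
Proof.
refine (@QuotHom k H Y aY A B (transport_ob x) (transport_ob y) (qbase f) (qtot f) _ _ _).
- exact: (qhom_proj f).
- by move=> C h p; apply: (qhom_act f).
- by move=> C p; congr tau; apply: (qhom_map f).
Defined.

Definition transport_functor : fun_over (quotient_stack aX) (quotient_stack aY).
Proof.
refine (@FunOver k (quotient_stack aX) (quotient_stack aY)
  transport_ob transport_hom _ _ _).
- by [].
- by move=> A x; apply: quot_hom_ext.
- by move=> A B C x y z g f; apply: quot_hom_ext.
Defined.

Hypothesis tau_inj : forall A, injective (tau (A := A)).

Lemma transport_hom_bij A B (x : quot_ob aX A) (y : quot_ob aX B) :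
  bijective (@transport_hom A B x y).
Proof.
have back_act (f : quot_hom (transport_ob x) (transport_ob y)) C (g : G C)
    (p : kspec (tot (qtors x)) C) :
    alg_comp (act (tact (qtors x)) g p) (qtot f)
    = act (tact (qtors y)) g (alg_comp p (qtot f)).
  by have := qhom_act f (theta C g) p; rewrite /= thetaK.
have back_map (f : quot_hom (transport_ob x) (transport_ob y)) C
    (p : kspec (tot (qtors x)) C) : qmap (q := y) (alg_comp p (qtot f)) = qmap p.
  by apply: tau_inj; apply: (qhom_map f p).
exists (fun f : quot_hom (transport_ob x) (transport_ob y) =>
   @QuotHom k G X aX A B x y (qbase f) (qtot f) (qhom_proj f)
   (back_act f) (back_map f)).
  by move=> f; apply: quot_hom_ext.
by move=> f; apply: quot_hom_ext.
Qed.

End Transport.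

Lemma quotient_stack_iso (k : fieldType) (G H : kgroup k) (X Y : kfunctor k)
    (aX : kaction G X) (aY : kaction H Y)
    (theta : kgroup_hom G H) (theta' : kgroup_hom H G)
    (tau : forall A, X A -> Y A) (tau' : forall A, Y A -> X A) :
  (forall A, cancel (theta A) (theta' A)) -> (forall A, cancel (theta' A) (theta A)) ->
  (forall A, cancel (tau A) (tau' A)) -> (forall A, cancel (tau' A) (tau A)) ->
  (forall A B (f : alg_hom A B) x, tau B (pts_map f x) = pts_map f (tau A x)) ->
  (forall A (g : G A) (x : X A), tau A (act aX g x) = act aY (theta A g) (tau A x)) ->
  stack_iso (quotient_stack aX) (quotient_stack aY).
Proof.
move=> thetaK theta'K tauK tau'K tau_nat tau_act.
have tau'_nat A B (f : alg_hom A B) y : tau' B (pts_map f y) = pts_map f (tau' A y).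
  by apply: (can_inj (tauK B)); rewrite tau_nat !tau'K.
have tau'_act A (h : H A) (y : Y A) : tau' A (act aY h y) = act aX (theta' A h) (tau' A y).
  by apply: (can_inj (tauK A)); rewrite tau_act !tau'K theta'K.
exists (transport_functor thetaK theta'K tau_nat tau_act); split.
  by move=> A B x y; apply: transport_hom_bij => C; apply: can_inj (tauK C).
move=> A y; pose x : quot_ob aX A := transport_ob theta'K thetaK tau'_nat tau'_act y.
exists x; pose x' := transport_ob thetaK theta'K tau_nat tau_act x.
have f_proj : alg_comp (alg_id _) (tproj (qtors y))
    = alg_comp (tproj (qtors x')) (alg_id A).
  by rewrite alg_comp1f alg_compf1.
have f_act C (h : H C) (p : kspec (tot (qtors x')) C) :
    alg_comp (act (tact (qtors x')) h p) (alg_id _)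
    = act (tact (qtors y)) h (alg_comp p (alg_id _)).
  by rewrite !alg_compf1 /= theta'K.
have f_map C (p : kspec (tot (qtors x')) C) :
    qmap (q := y) (alg_comp p (alg_id _)) = qmap (q := x') p.
  by rewrite /= alg_compf1 tau'K.
pose f := @QuotHom k H Y aY A A x' y (alg_id A) (alg_id (tot (qtors y))) f_proj f_act f_map.
exact: (@quot_hom_iso k H Y aY A x' y f (alg_id _) erefl (alg_compf1 _) (alg_compf1 _)).
Qed.

Local Notation "g ** f" := (alg_comp g f) (at level 40, left associativity).

Lemma kghomV (k : fieldType) (G1 G2 : kgroup k) (f : kgroup_hom G1 G2) A (g : G1 A) :
  f A g^-1%g = (f A g)^-1%g.
Proof. by apply: (mulgI (f A g)); rewrite -ghomM !mulgV kghom1. Qed.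

(** * The quotient of the punctured line by a power of the standard action *)

(** [theta] identifies H with the group mu_q of q-th roots of unity, X is the
    group Gm on which Gm acts through the q-th power, and Y is a point. *)
Section RootStack.
Variables (k : fieldType) (q : nat) (q_gt0 : (0 < q)%N) (q_neq0 : q%:R != 0 :> k).
Implicit Types A B C D : calg k.

Variables (H : kgroup k) (theta : kgroup_hom H (Gm k)).
Hypothesis theta_inj : forall A, injective (theta A).
Hypothesis thetaX : forall A (h : H A), ((theta A h) ^+ q)%g = 1%g.
Hypothesis theta_surj : forall (A : calg k) (u : units A),
  (u ^+ q = 1)%g -> exists h, theta A h = u.

Variables (X : kfunctor k) (aX : kaction (Gm k) X).
Variables (coord : forall A : calg k, X A -> units A).
Variables (of_coord : forall A : calg k, units A -> X A).
Hypothesis coordK : forall A, cancel (coord (A := A)) (of_coord (A := A)).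
Hypothesis of_coordK : forall A, cancel (of_coord (A := A)) (coord (A := A)).
Hypothesis coord_nat : forall A B (f : alg_hom A B) (x : X A),
  coord (pts_map f x) = units_map f (coord x).
Hypothesis coord_act : forall (A : calg k) (g : units A) (x : X A),
  coord (act aX g x) = (g ^+ q * coord x)%g.

Variables (Y : kfunctor k) (aY : kaction H Y) (y0 : forall A, Y A).
Hypothesis Y_eq : forall A (y y' : Y A), y = y'.

Section Fibre.
Variables (A : calg k) (x : quot_ob aX A).
Local Notation T := (tot (qtors x)).

Definition gm_act C (g : units C) (p : alg_hom T C) : alg_hom T C :=
  act (tact (qtors x)) g p.

(** A map of Gm-spaces from the total space to X is an invertible function of
    weight q, here evaluated at points. *)
Definition sec C (p : alg_hom T C) : units C := coord (qmap (q := x) p).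

Lemma gm_act1 C (p : alg_hom T C) : gm_act 1%g p = p.
Proof. exact: (act1 (tact (qtors x)) p). Qed.

Lemma gm_actM C g h (p : alg_hom T C) : gm_act (g * h)%g p = gm_act g (gm_act h p).
Proof. exact: (actM (tact (qtors x)) g h p). Qed.

Lemma gm_act_nat C D (f : alg_hom C D) g (p : alg_hom T C) :
  f ** gm_act g p = gm_act (units_map f g) (f ** p).
Proof. exact: (act_nat (tact (qtors x)) f g p). Qed.

Lemma sec_nat C D (f : alg_hom C D) (p : alg_hom T C) :
  sec (f ** p) = units_map f (sec p).
Proof. by rewrite /sec -coord_nat -qmap_nat. Qed.

Lemma sec_act C g (p : alg_hom T C) : sec (gm_act g p) = (g ^+ q * sec p)%g.
Proof. by rewrite /sec qmap_equiv coord_act. Qed.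

(** The total space of the mu_q-torsor: the locus where the function of weight q
    is 1. *)
Definition fib_rel (t : term T void) : Prop :=
  t = TAdd (TConst _ (uval (sec (alg_id T)))) (TOpp (TConst _ 1)).

Definition fib : calg k := pres fib_rel.
Definition fib_in : alg_hom T fib := pres_in fib_rel.

Lemma sec_fib_in : sec fib_in = 1%g.
Proof.
apply: units_inj; rewrite -[fib_in]alg_compf1 sec_nat uval_map uval1.
apply/eqP; rewrite -subr_eq0 -(rmorph1 fib_in); apply/eqP.
by have := pres_solution (erefl : fib_rel _).
Qed.

Lemma fib_ext C (f g : alg_hom fib C) : f ** fib_in = g ** fib_in -> f = g.
Proof. by move=> fg; apply: pres_hom_ext => // -[]. Qed.

Section Lift.
Variables (C : calg k) (p : alg_hom T C) (p1 : sec p = 1%g).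

Fact fib_solution : solution fib_rel p (fun v : void => match v with end).
Proof.
move=> t ->; rewrite -[LHS]/(p (uval (sec (alg_id T))) - p 1).
by rewrite -uval_map -sec_nat alg_compf1 p1 rmorph1 subrr.
Qed.

Definition fib_lift : alg_hom fib C := pres_lift fib_solution.

Lemma fib_lift_in : fib_lift ** fib_in = p.
Proof. exact: pres_lift_in. Qed.

End Lift.

Lemma sec_fib_comp C (e : alg_hom fib C) : sec (e ** fib_in) = 1%g.
Proof. by rewrite sec_nat sec_fib_in units_map1. Qed.

Fact fib_act_subproof C (h : H C) (e : alg_hom fib C) :
  sec (gm_act (theta C h) (e ** fib_in)) = 1%g.
Proof. by rewrite sec_act sec_fib_comp mulg1 thetaX. Qed.

Definition fib_act_fun C (h : H C) (e : alg_hom fib C) : alg_hom fib C :=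
  fib_lift (fib_act_subproof h e).

Lemma fib_actE C (h : H C) (e : alg_hom fib C) :
  fib_act_fun h e ** fib_in = gm_act (theta C h) (e ** fib_in).
Proof. exact: fib_lift_in. Qed.

Definition fib_act : kaction H (kspec fib).
Proof.
refine (@KAction k H (kspec fib) fib_act_fun _ _ _).
- by move=> C e; apply: fib_ext; rewrite fib_actE kghom1 gm_act1.
- by move=> C g h e; apply: fib_ext; rewrite !fib_actE ghomM gm_actM.
- move=> C D f h e; apply: fib_ext; rewrite -[pts_map _ _]/(f ** _).
  by rewrite -alg_compA !fib_actE gm_act_nat alg_compA ghom_nat.
Defined.

Definition fib_torsor : torsor H A.
Proof.
refine (@Torsor k H A fib (fib_in ** tproj (qtors x)) fib_act _ _ _).
- move=> C h e; rewrite !alg_compA fib_actE; exact: tact_proj.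
- move=> C e e'; rewrite !alg_compA => /(tact_simply_transitive (t := qtors x)).
  move=> [g [gE g_uniq]].
  have [|h hE] := theta_surj (u := g).
    by have := sec_act g (e ** fib_in); rewrite [gm_act _ _]gE !sec_fib_comp mulg1.
  exists h; split; first by apply: fib_ext; rewrite fib_actE hE.
  move=> h' h'E; apply: theta_inj; rewrite hE; apply: g_uniq.
  by rewrite -h'E; apply/esym/fib_actE.
- have [A' [c [c_cover [s sc]]]] := tlocal_section (qtors x).
  exists (rootext q (sec s)), (root_in (sec s) ** c).
  split; first exact: etale_cover_root.
  pose r := troot q_gt0 (sec s).
  have s1 : sec (gm_act r^-1%g (root_in (sec s) ** s)) = 1%g.
    by rewrite sec_act sec_nat expVgn trootX mulVg.
  exists (fib_lift s1); rewrite alg_compA fib_lift_in.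
  rewrite -sc alg_compA; exact: tact_proj.
Defined.

Definition fib_ob : quot_ob aY A.
Proof.
exact: (@QuotOb k H Y aY A fib_torsor (fun C p => y0 C)
  (fun B C f p => Y_eq _ _) (fun C g p => Y_eq _ _)).
Defined.

Fact rpt_subproof C (p : alg_hom T C) (r : units C) :
  (r ^+ q)%g = sec p -> sec (gm_act r^-1%g p) = 1%g.
Proof. by move=> rE; rewrite sec_act expVgn rE mulVg. Qed.

(** A q-th root r of the value of the function at p moves p into the locus where
    this function is 1. *)
Definition rpt C (p : alg_hom T C) (r : units C) (rE : (r ^+ q)%g = sec p) :
  alg_hom fib C := fib_lift (rpt_subproof rE).

Lemma rpt_in C (p : alg_hom T C) r (rE : (r ^+ q)%g = sec p) :
  rpt rE ** fib_in = gm_act r^-1%g p.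
Proof. exact: fib_lift_in. Qed.

Lemma rpt_nat C D (f : alg_hom C D) (p : alg_hom T C) r (rE : (r ^+ q)%g = sec p)
    (p' : alg_hom T D) r' (r'E : (r' ^+ q)%g = sec p') :
  f ** p = p' -> units_map f r = r' -> f ** rpt rE = rpt r'E.
Proof.
move=> fp fr; apply: fib_ext.
by rewrite -alg_compA !rpt_in gm_act_nat fp units_mapV fr.
Qed.

Lemma rpt_twist C (p : alg_hom T C) r (rE : (r ^+ q)%g = sec p)
    r' (r'E : (r' ^+ q)%g = sec p) h :
  r' = (theta C h * r)%g -> rpt r'E = fib_act_fun h^-1%g (rpt rE).
Proof.
move=> r'_r; apply: fib_ext; rewrite fib_actE !rpt_in -gm_actM r'_r.
by rewrite invgM kghomV unitsC.
Qed.

End Fibre.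

Section FullyFaithful.
Variables (A A' : calg k) (x : quot_ob aX A) (y : quot_ob aX A').
Local Notation T := (tot (qtors x)).
Local Notation T' := (tot (qtors y)).

Fact fib_hom_subproof (f : quot_hom x y) : sec (fib_in x ** qtot f) = 1%g.
Proof. by rewrite /sec qhom_map -[RHS](sec_fib_in x). Qed.

Definition fib_hom (f : quot_hom x y) : quot_hom (fib_ob x) (fib_ob y).
Proof.
refine (@QuotHom k H Y aY A A' (fib_ob x) (fib_ob y) (qbase f)
  (fib_lift (fib_hom_subproof f)) _ _ _).
- by rewrite /= alg_compA fib_lift_in -!alg_compA qhom_proj.
- move=> C h e; apply: fib_ext; rewrite -alg_compA fib_lift_in.
  rewrite -[RHS]/(fib_act_fun h (e ** _) ** fib_in y) fib_actE alg_compA fib_actE.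
  by rewrite -alg_compA fib_lift_in alg_compA; apply: (qhom_act f).
- by move=> C e; apply: Y_eq.
Defined.

Section Extend.
Variable psi : quot_hom (fib_ob x) (fib_ob y).

(** The value at p of the extension of psi to the whole torsor, when the
    value of the function at p has a q-th root r. *)
Definition ext_pt C (p : alg_hom T C) r (rE : (r ^+ q)%g = sec p) : alg_hom T' C :=
  gm_act r (rpt rE ** qtot psi ** fib_in y).

Lemma ext_pt_nat C D (f : alg_hom C D) (p : alg_hom T C) r (rE : (r ^+ q)%g = sec p)
    (p' : alg_hom T D) r' (r'E : (r' ^+ q)%g = sec p') :
  f ** p = p' -> units_map f r = r' -> f ** ext_pt rE = ext_pt r'E.
Proof.
move=> fp fr; rewrite /ext_pt gm_act_nat fr !alg_compA.
by rewrite (rpt_nat rE r'E).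
Qed.

(** Two q-th roots of the same unit differ by an element of mu_q, with which psi
    commutes. *)
Lemma ext_pt_twist C (p : alg_hom T C) r (rE : (r ^+ q)%g = sec p)
    r' (r'E : (r' ^+ q)%g = sec p) :
  ext_pt r'E = ext_pt rE.
Proof.
have [|h hE] := theta_surj (u := (r' * r^-1)%g).
  by rewrite unitXM expVgn rE r'E mulgV.
have r'_r : r' = (theta C h * r)%g by rewrite hE mulgVK.
rewrite /ext_pt (rpt_twist rE r'E r'_r).
have -> : fib_act_fun h^-1%g (rpt rE) ** qtot psi
   = fib_act_fun h^-1%g (rpt rE ** qtot psi) by exact: (qhom_act psi).
by rewrite fib_actE -gm_actM r'_r kghomV unitsC mulgA mulVg mul1g.
Qed.

Let u := sec (alg_id T) : units T.
Let S := rootext q u.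

Fact taut_rootE : (troot q_gt0 u ^+ q)%g = sec (root_in u) :> units S.
Proof. by rewrite trootX -sec_nat alg_compf1. Qed.

(** The formula is applied to the tautological point over the extension by the
    tautological root, and the result descends by [root_equalizer]. *)
Lemma ext_exists : exists phi : alg_hom T' T,
  forall C (p : alg_hom T C) r (rE : (r ^+ q)%g = sec p), p ** phi = ext_pt rE.
Proof.
pose j1 := root_in (q := q) (1%g : units S).
pose j2 := root_twist q_gt0 u.
have j2E : j2 ** root_in u = j1 ** root_in u by exact: root_lift_in.
pose w := ext_pt taut_rootE.
have rE1 : (units_map j1 (troot q_gt0 u) ^+ q)%g = sec (j1 ** root_in u).
  by rewrite -units_mapX taut_rootE sec_nat.
have rE2 : (units_map j2 (troot q_gt0 u) ^+ q)%g = sec (j1 ** root_in u).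
  by rewrite -units_mapX taut_rootE -sec_nat j2E.
have jw : j1 ** w = j2 ** w.
  rewrite (ext_pt_nat taut_rootE rE1) // (ext_pt_nat taut_rootE rE2) //.
  exact: ext_pt_twist.
have [|phi phiE] := alg_hom_factor (root_in_inj q_gt0 (u := u)) (w := w).
  move=> c; apply: root_equalizer.
  exact: (congr1 (fun h : alg_hom T' _ => h c) jw).
exists phi => C p r rE.
have rE' : (r ^+ q)%g = units_map p u by rewrite rE -sec_nat alg_compf1.
rewrite -[X in X ** phi](root_lift_in rE') -alg_compA phiE.
apply: ext_pt_nat; first exact: root_lift_in.
exact: root_lift_root.
Qed.

Lemma fib_hom_full : exists f : quot_hom x y, fib_hom f = psi.
Proof.
have [phi phiE] := ext_exists.
pose r := troot q_gt0 u.
have iI : injective (root_in (q := q) u) by exact: root_in_inj.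
have phi_proj : phi ** tproj (qtors y) = tproj (qtors x) ** qbase psi.
  apply: (alg_comp_inj iI); rewrite alg_compA (phiE _ _ _ taut_rootE).
  rewrite [LHS]tact_proj -!alg_compA.
  have E : qtot psi ** (fib_in y ** tproj (qtors y))
      = fib_in x ** tproj (qtors x) ** qbase psi.
    exact: (qhom_proj psi).
  rewrite E !alg_compA rpt_in; congr (_ ** _).
  exact: tact_proj.
have phi_act C (g : units C) (p : kspec T C) :
    act (tact (qtors x)) g p ** phi = act (tact (qtors y)) g (p ** phi).
  pose C' := rootext q (sec p); pose s := troot q_gt0 (sec p).
  pose i : alg_hom C C' := root_in (sec p).
  have sE : (s ^+ q)%g = sec (i ** p) by rewrite trootX sec_nat.
  have gsE : ((units_map i g * s) ^+ q)%g = sec (i ** gm_act g p).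
    by rewrite gm_act_nat sec_act unitXM sE.
  apply: (alg_comp_inj (root_in_inj q_gt0 (u := sec p))).
  rewrite alg_compA (phiE _ _ _ gsE) [RHS]gm_act_nat alg_compA (phiE _ _ _ sE).
  rewrite /ext_pt gm_actM; congr (gm_act _ (gm_act _ (_ ** _ ** _))).
  apply: fib_ext; rewrite !rpt_in gm_act_nat -gm_actM.
  by rewrite invgM -mulgA mulVg mulg1.
have phi_map C (p : kspec T C) : qmap (q := y) (p ** phi) = qmap (q := x) p.
  apply: (can_inj (coordK (A := C))); rewrite -[LHS]/(sec (p ** phi)) -[RHS]/(sec p).
  rewrite -[in RHS](alg_compf1 p) !sec_nat; congr units_map.
  apply: (units_map_inj iI); rewrite -!sec_nat alg_compf1.
  by rewrite (phiE _ _ _ taut_rootE) sec_act sec_nat sec_fib_in units_map1 mulg1 taut_rootE.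
pose f : quot_hom x y := QuotHom phi_proj phi_act phi_map.
exists f; apply: quot_hom_ext => //; apply: fib_ext.
rewrite fib_lift_in.
have E1 : (1 ^+ q)%g = sec (fib_in x) by rewrite sec_fib_in expg1n.
rewrite [LHS](phiE _ _ _ E1) /ext_pt gm_act1.
have -> : rpt E1 = alg_id _.
  by apply: fib_ext; rewrite rpt_in invg1 gm_act1 alg_comp1f.
by rewrite alg_comp1f.
Qed.

End Extend.

(** After adjoining a root, every point is a translate of a point of the locus
    where the function is 1. *)
Lemma fib_hom_faithful : injective fib_hom.
Proof.
move=> f g fg; apply: quot_hom_ext.
  exact: (congr1 (fun h => qbase h) fg).
have fgE : fib_in x ** qtot f = fib_in x ** qtot g.
  have := congr1 (fun h : quot_hom (fib_ob x) (fib_ob y) => qtot h ** fib_in y) fg.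
  by rewrite /= !fib_lift_in.
apply: (alg_comp_inj (root_in_inj q_gt0 (u := sec (alg_id T)))).
have key (h : quot_hom x y) : gm_act (troot q_gt0 (sec (alg_id T)))^-1%g
    (root_in (sec (alg_id T)) ** qtot h) = rpt taut_rootE ** (fib_in x ** qtot h).
  by rewrite alg_compA rpt_in; apply/esym/(qhom_act h).
have := etrans (key f) (etrans (congr1 _ fgE) (esym (key g))).
move=> /(congr1 (gm_act (troot q_gt0 (sec (alg_id T))))).
by rewrite -!gm_actM !mulgV !gm_act1.
Qed.

Lemma fib_hom_bij : bijective fib_hom.
Proof.
have [back backE] := choice fib_hom_full.
by exists back => // f; apply: fib_hom_faithful.
Qed.

End FullyFaithful.

Definition fib_functor : fun_over (quotient_stack aX) (quotient_stack aY).
Proof.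
refine (@FunOver k (quotient_stack aX) (quotient_stack aY) fib_ob fib_hom _ _ _).
- by [].
- move=> A x; apply: quot_hom_ext => //; apply: fib_ext.
  by rewrite fib_lift_in alg_comp1f [LHS]alg_compf1.
- move=> A B C x y z g f; apply: quot_hom_ext => //; apply: fib_ext.
  by rewrite /= fib_lift_in -alg_compA fib_lift_in !alg_compA fib_lift_in.
Defined.

(** * The bundle induced by a torsor under roots of unity *)

Section Graded.
Variables (A : calg k) (y : quot_ob aY A).
Local Notation E := (tot (qtors y)).

Definition h_act C (h : H C) (e : alg_hom E C) : alg_hom E C :=
  act (tact (qtors y)) h e.

Lemma h_act1 C (e : alg_hom E C) : h_act 1%g e = e.
Proof. exact: (act1 (tact (qtors y)) e). Qed.

Lemma h_actM C g h (e : alg_hom E C) : h_act (g * h)%g e = h_act g (h_act h e).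
Proof. exact: (actM (tact (qtors y)) g h e). Qed.

Lemma h_act_nat C D (f : alg_hom C D) h (e : alg_hom E C) :
  f ** h_act h e = h_act (gpts_map f h) (f ** e).
Proof. exact: (act_nat (tact (qtors y)) f h e). Qed.

Lemma taut_torsion C : exists h : H (rootext q (1%g : units C)),
  theta _ h = troot q_gt0 1%g.
Proof. by apply: theta_surj; rewrite trootX units_map1. Qed.

(** The coaction, that is the action of the universal element x of mu_q on the
    universal point, expanded in powers of x. *)
Lemma coaction_exists : exists pi : 'I_q -> E -> E,
  forall e C (p : alg_hom E C) (h : H C),
    h_act h p e = \sum_i p (pi i e) * uval (theta C h) ^+ i.
Proof.
have [h0 h0E] := taut_torsion E.
have [pi piE] := choice (fun e => root_span q_gt0 (h_act h0 (root_in 1%g) e)).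
exists (fun i e => pi e i) => e C p h.
have rE : (theta C h ^+ q)%g = units_map p 1%g by rewrite thetaX units_map1.
have <- : root_lift rE ** h_act h0 (root_in 1%g) = h_act h p.
  rewrite h_act_nat root_lift_in; congr h_act; apply: theta_inj.
  by rewrite ghom_nat [RHS](esym (root_lift_root q_gt0 rE)) h0E.
rewrite /= piE rmorph_sum; apply: eq_bigr => i _; rewrite rmorphM rmorphXn.
rewrite (alg_comp_appl _ (root_lift_in rE)) -[root_lift _ _]uval_map.
by rewrite (root_lift_root q_gt0).
Qed.

Variable pi : 'I_q -> E -> E.
Hypothesis piE : forall e C (p : alg_hom E C) (h : H C),
    h_act h p e = \sum_i p (pi i e) * uval (theta C h) ^+ i.

(** The elements of degree i for the grading by Z / q defined by the action. *)
Definition homog (i : nat) (e : E) : Prop :=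
  forall C (p : alg_hom E C) (h : H C), h_act h p e = p e * uval (theta C h) ^+ i.

Lemma sum_pi e : \sum_i pi i e = e.
Proof.
have := piE e (alg_id E) 1%g; rewrite h_act1 /= => {2}->.
by apply: eq_bigr => i _; rewrite kghom1 uval1 expr1n mulr1.
Qed.

(** Associativity of the action of the product of h and a universal root of unity,
    compared in powers of the latter. *)
Lemma homog_pi (i : 'I_q) e : homog i (pi i e).
Proof.
move=> C p h; have [h1 h1E] := taut_torsion C.
pose j := root_in (q := q) (1%g : units C).
pose c (i : 'I_q) := p (pi i e) * uval (theta C h) ^+ i.
suff /root_comb_inj -> : root_comb q_gt0 1%g (fun i => h_act h p (pi i e))
  = root_comb q_gt0 (1%g : units C) c by [].
have := congr1 (fun f : alg_hom E _ => f e) (h_actM h1 (gpts_map j h) (j ** p)).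
rewrite /= -h_act_nat !piE => /esym.
rewrite /root_comb; under eq_bigr => i' _ do rewrite h1E.
move=> ->; apply: eq_bigr => i' _.
rewrite ghomM h1E ghom_nat uvalM exprMn rmorphM rmorphXn -uval_map -/j /=.
by rewrite -mulrA [_ ^+ _ * uval (troot _ _) ^+ _]mulrC.
Qed.

Lemma pi_homog (i : 'I_q) e : homog i e -> forall j, pi j e = if j == i then e else 0.
Proof.
move=> ie; have [h0 h0E] := taut_torsion E.
apply: (@root_comb_inj _ _ q_gt0 _ (1%g : units E)).
have := ie _ (root_in 1%g) h0; rewrite piE h0E {1}/root_comb => ->.
rewrite /root_comb (bigD1 i) //= eqxx big1 ?addr0 // => j /negPf ->.
by rewrite rmorph0 mul0r.
Qed.

Lemma pi_add i e e' : pi i (e + e') = pi i e + pi i e'.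
Proof.
move: i; have [h0 h0E] := taut_torsion E.
apply: (@root_comb_inj _ _ q_gt0 _ (1%g : units E)).
have := rmorphD (h_act h0 (root_in 1%g)) e e'; rewrite !piE h0E.
rewrite -big_split {1}/root_comb => ->.
by rewrite /root_comb; apply: eq_bigr => i _; rewrite rmorphD mulrDl.
Qed.

Lemma homogD i e e' : homog i e -> homog i e' -> homog i (e + e').
Proof. by move=> ie ie' C p h; rewrite !rmorphD ie ie' mulrDl. Qed.

Lemma homogM i j e e' : homog i e -> homog j e' -> homog (i + j) (e * e').
Proof. by move=> ie je' C p h; rewrite !rmorphM ie je' mulrACA exprD. Qed.

Lemma homog_base a : homog 0 (tproj (qtors y) a).
Proof.
move=> C p h; rewrite expr0 mulr1.
exact: (congr1 (fun f : alg_hom A C => f a) (tact_proj (t := qtors y) h p)).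
Qed.

Lemma homog1 : homog 0 1.
Proof. by move=> C p h; rewrite expr0 !rmorph1 mulr1. Qed.

Lemma homog_modq i j e : i = j %[mod q] -> homog i e -> homog j e.
Proof.
move=> ij ie C p h; rewrite ie; congr (_ * _).
have theta_mod n : uval (theta C h) ^+ n = uval (theta C h) ^+ (n %% q).
  rewrite {1}(divn_eq n q) exprD mulnC exprM -[_ ^+ q]uvalX thetaX uval1 expr1n.
  by rewrite mul1r.
by rewrite theta_mod ij -theta_mod.
Qed.

Lemma homogq : homog q 1.
Proof. by apply: (@homog_modq 0) homog1; rewrite modnn mod0n. Qed.

Local Notation gen := (option (nat * E)).
Local Notation V i e := (TVar A (Some (i, e))).

(** The generator (i, e) stands for e t^i in the ring of the z t^i with z
    homogeneous of degree i, and [None] stands for t^-q. Negative exponents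
    are left out since t^q is invertible. In this form a
    homomorphism from the ring is a family of maps on the homogeneous
    elements, and no basis of the ring is ever needed. *)
Inductive ind_rel : term A gen -> Prop :=
| ind_rel_add i e e' : homog i e -> homog i e' ->
    ind_rel (TAdd (V i (e + e')) (TOpp (TAdd (V i e) (V i e'))))
| ind_rel_mul i j e e' : homog i e -> homog j e' ->
    ind_rel (TAdd (TMul (V i e) (V j e')) (TOpp (V (i + j)%N (e * e'))))
| ind_rel_base a :
    ind_rel (TAdd (V 0%N (tproj (qtors y) a)) (TOpp (TConst _ a)))
| ind_rel_unit :
    ind_rel (TAdd (TMul (V q 1) (TVar A None)) (TOpp (TConst _ 1)))
| ind_rel_non i e : ~ homog i e -> ind_rel (V i e).

Definition ind : calg k := pres ind_rel.
Definition ind_proj : alg_hom A ind := pres_in ind_rel.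
Definition ind_var (i : nat) (e : E) : ind := pres_var ind_rel (Some (i, e)).

Lemma ind_varD i e e' : homog i e -> homog i e' ->
  ind_var i (e + e') = ind_var i e + ind_var i e'.
Proof. by move=> ie ie'; apply/subr0_eq/(pres_solution (ind_rel_add ie ie')). Qed.

Lemma ind_varM i j e e' : homog i e -> homog j e' ->
  ind_var i e * ind_var j e' = ind_var (i + j) (e * e').
Proof. by move=> ie je'; apply/subr0_eq/(pres_solution (ind_rel_mul ie je')). Qed.

Lemma ind_var_base a : ind_var 0 (tproj (qtors y) a) = ind_proj a.
Proof. by apply/subr0_eq/(pres_solution (ind_rel_base a)). Qed.

Lemma ind_var01 : ind_var 0 1 = 1.
Proof. by have := ind_var_base 1; rewrite !rmorph1. Qed.

Lemma ind_var_unit : ind_var q 1 * pres_var ind_rel None = 1.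
Proof.
rewrite -(rmorph1 ind_proj).
by apply/subr0_eq/(pres_solution (ind_rel_unit)).
Qed.

Lemma ind_var_non i e : ~ homog i e -> ind_var i e = 0.
Proof. by move=> ie; apply/(pres_solution (ind_rel_non ie)). Qed.

Definition ind_unit : units ind := mkunit ind_var_unit.

Definition ind_sec C (p : alg_hom ind C) : units C := units_map p ind_unit.

Lemma uval_ind_sec C (p : alg_hom ind C) : uval (ind_sec p) = p (ind_var q 1).
Proof. by []. Qed.

Lemma ind_sec_nat C D (f : alg_hom C D) (p : alg_hom ind C) :
  ind_sec (f ** p) = units_map f (ind_sec p).
Proof. exact: units_map_comp. Qed.

Lemma ind_ext C (p p' : alg_hom ind C) :
  (forall i e, homog i e -> p (ind_var i e) = p' (ind_var i e)) -> p = p'.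
Proof.
move=> pp'; apply: pres_hom_ext.
  apply: alg_hom_ext => a.
  by rewrite -[LHS]/(p (ind_proj a)) -[RHS]/(p' (ind_proj a)) -!ind_var_base pp' //;
    apply: homog_base.
case=> [[i e]|].
  have [ie|ie] := pselect (homog i e); first exact: pp'.
  by rewrite -/(ind_var i e) ind_var_non // !rmorph0.
apply: (uval_mulI (u := ind_sec p)).
rewrite {2}(_ : ind_sec p = ind_sec p'); last first.
  by apply: units_inj; rewrite !uval_ind_sec pp' //; apply: homogq.
by rewrite !uval_ind_sec -!rmorphM ind_var_unit !rmorph1.
Qed.

Section IndLift.
Variables (C : calg k) (g : alg_hom A C) (v : nat -> E -> C) (w : C).
Hypothesis vD : forall i e e', homog i e -> homog i e' ->
  v i (e + e') = v i e + v i e'.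
Hypothesis vM : forall i j e e', homog i e -> homog j e' ->
  v i e * v j e' = v (i + j)%N (e * e').
Hypothesis v_base : forall a, v 0%N (tproj (qtors y) a) = g a.
Hypothesis v_unit : v q 1 * w = 1.
Hypothesis v_non : forall i e, ~ homog i e -> v i e = 0.

Fact ind_solution :
  solution ind_rel g (fun o => if o is Some (i, e) then v i e else w).
Proof.
move=> _ [i e e' ie ie'|i j e e' ie je'|a||i e ie] /=.
- by rewrite vD // subrr.
- by rewrite vM // subrr.
- by rewrite v_base subrr.
- by rewrite v_unit rmorph1 subrr.
- exact: v_non.
Qed.

Definition ind_lift : alg_hom ind C := pres_lift ind_solution.

Lemma ind_lift_proj : ind_lift ** ind_proj = g.
Proof. exact: pres_lift_in. Qed.

Lemma ind_lift_var i e : ind_lift (ind_var i e) = v i e.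
Proof. exact: (pres_lift_var ind_solution). Qed.

End IndLift.

Lemma ind_act_exists C (g : units C) (p : alg_hom ind C) : exists p' : alg_hom ind C,
  p' ** ind_proj = p ** ind_proj /\
  forall i e, p' (ind_var i e) = uval g ^+ i * p (ind_var i e).
Proof.
pose v i e := uval g ^+ i * p (ind_var i e).
have vD i e e' : homog i e -> homog i e' -> v i (e + e') = v i e + v i e'.
  by move=> ie ie'; rewrite /v ind_varD // rmorphD mulrDr.
have vM i j e e' : homog i e -> homog j e' -> v i e * v j e' = v (i + j)%N (e * e').
  by move=> ie je'; rewrite /v mulrACA -exprD -rmorphM ind_varM.
have v_base a : v 0%N (tproj (qtors y) a) = (p ** ind_proj) a.
  by rewrite /v expr0 mul1r ind_var_base.
have v_unit : v q 1 * (uval g^-1%g ^+ q * p (pres_var ind_rel None)) = 1.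
  by rewrite /v mulrACA -exprMn uvalMV expr1n -rmorphM ind_var_unit rmorph1 mulr1.
have v_non i e : ~ homog i e -> v i e = 0.
  by move=> ie; rewrite /v ind_var_non // rmorph0 mulr0.
exists (ind_lift vD vM v_base v_unit v_non); split; first exact: ind_lift_proj.
by move=> i e; rewrite ind_lift_var.
Qed.

Definition ind_act_fun C (g : units C) (p : alg_hom ind C) : alg_hom ind C :=
  projT1 (cid (ind_act_exists g p)).

Lemma ind_act_proj C (g : units C) (p : alg_hom ind C) :
  ind_act_fun g p ** ind_proj = p ** ind_proj.
Proof. by rewrite /ind_act_fun; case: cid => p' []. Qed.

Lemma ind_act_var C (g : units C) (p : alg_hom ind C) i e :
  ind_act_fun g p (ind_var i e) = uval g ^+ i * p (ind_var i e).
Proof. by rewrite /ind_act_fun; case: cid => p' []. Qed.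

Definition ind_act : kaction (Gm k) (kspec ind).
Proof.
refine (@KAction k (Gm k) (kspec ind) ind_act_fun _ _ _).
- move=> C p; apply: ind_ext => i e _.
  by rewrite ind_act_var uval1 expr1n mul1r.
- move=> C g h p; apply: ind_ext => i e _.
  by rewrite !ind_act_var uvalM exprMn mulrA.
- move=> C D f g p; apply: ind_ext => i e _.
  by rewrite ind_act_var /= ind_act_var rmorphM rmorphXn uval_map.
Defined.

Lemma ind_actM C (g h : units C) (p : alg_hom ind C) :
  ind_act_fun (g * h)%g p = ind_act_fun g (ind_act_fun h p).
Proof. exact: (actM ind_act g h p). Qed.

Lemma ind_act1 C (p : alg_hom ind C) : ind_act_fun 1%g p = p.
Proof. exact: (act1 ind_act p). Qed.

Lemma ind_act_nat C D (f : alg_hom C D) (g : units C) (p : alg_hom ind C) :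
  f ** ind_act_fun g p = ind_act_fun (units_map f g) (f ** p).
Proof. exact: (act_nat ind_act f g p). Qed.

Lemma ind_sec_act C (g : units C) (p : alg_hom ind C) :
  ind_sec (ind_act_fun g p) = (g ^+ q * ind_sec p)%g.
Proof. by apply: units_inj; rewrite uvalM !uval_ind_sec ind_act_var uvalX. Qed.

(** The bijection between points of the torsor Spec E and points of the induced
    bundle at which t^q = 1, as a relation: p corresponds to e when p (z t^i) = e z
    for z homogeneous of degree i. *)
Definition agree C (p : alg_hom ind C) (e : alg_hom E C) : Prop :=
  forall i z, homog i z -> e z = p (ind_var i z).

Lemma agree_inj C (p p' : alg_hom ind C) (e : alg_hom E C) :
  agree p e -> agree p' e -> p = p'.
Proof. by move=> pe pe'; apply: ind_ext => i z iz; rewrite -(pe i) // (pe' i). Qed.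

Lemma agree_fun C (p : alg_hom ind C) (e e' : alg_hom E C) :
  agree p e -> agree p e' -> e = e'.
Proof.
move=> pe pe'; apply: alg_hom_ext => z; rewrite -(sum_pi z) !rmorph_sum.
by apply: eq_bigr => i _; rewrite (pe i) ?(pe' i) //; apply: homog_pi.
Qed.

Lemma agree_nat C D (f : alg_hom C D) (p : alg_hom ind C) (e : alg_hom E C) :
  agree p e -> agree (f ** p) (f ** e).
Proof. by move=> pe i z iz /=; rewrite (pe i). Qed.

Lemma agree_act C (h : H C) (p : alg_hom ind C) (e : alg_hom E C) :
  agree p e -> agree (ind_act_fun (theta C h) p) (h_act h e).
Proof. by move=> pe i z iz; rewrite iz ind_act_var (pe i) // mulrC. Qed.

Lemma agree_proj C (p : alg_hom ind C) (e : alg_hom E C) :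
  agree p e -> e ** tproj (qtors y) = p ** ind_proj.
Proof.
move=> pe; apply: alg_hom_ext => a /=; rewrite (pe 0%N) ?ind_var_base //.
exact: homog_base.
Qed.

Lemma agree_ind_sec C (p : alg_hom ind C) (e : alg_hom E C) :
  agree p e -> ind_sec p = 1%g.
Proof.
move=> pe; apply: units_inj; rewrite uval_ind_sec -(pe q) ?rmorph1 //.
exact: homogq.
Qed.

Lemma agree_to_ind C (e : alg_hom E C) : exists p, agree p e.
Proof.
pose v i z := if `[< homog i z >] then e z else 0.
have vE i z : homog i z -> v i z = e z by rewrite /v; case: asboolP.
have vD i z z' : homog i z -> homog i z' -> v i (z + z') = v i z + v i z'.
  by move=> iz iz'; rewrite !vE ?rmorphD //; apply: homogD.
have vM i j z z' : homog i z -> homog j z' -> v i z * v j z' = v (i + j)%N (z * z').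
  by move=> iz jz'; rewrite !vE ?rmorphM //; apply: homogM.
have v_base a : v 0%N (tproj (qtors y) a) = (e ** tproj (qtors y)) a.
  by rewrite vE //; apply: homog_base.
have v_unit : v q 1 * 1 = 1 by rewrite vE ?rmorph1 ?mulr1 //; apply: homogq.
have v_non i z : ~ homog i z -> v i z = 0 by rewrite /v; case: asboolP.
exists (ind_lift vD vM v_base v_unit v_non) => i z iz.
by rewrite ind_lift_var vE.
Qed.

(** As p (t^q) = 1, the value p (z t^i) depends only on i modulo q, which makes
    z |-> \sum_i p (z_i t^i), where z_i are the components of z, multiplicative. *)
Lemma agree_of_ind C (p : alg_hom ind C) : ind_sec p = 1%g -> exists e, agree p e.
Proof.
move=> p1; pose e (z : E) : C := \sum_(i < q) p (ind_var i (pi i z)).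
have pq : p (ind_var q 1) = 1 by rewrite -uval_ind_sec p1.
have p_shift i z m : homog i z -> p (ind_var (m * q + i) z) = p (ind_var i z).
  move=> iz; elim: m => [|m IHm]; first by rewrite mul0n add0n.
  rewrite mulSn -addnA -{1}[z]mul1r -ind_varM; first by rewrite rmorphM pq mul1r.
    exact: homogq.
  by apply: homog_modq iz; rewrite modnMDl.
have eE i z : homog i z -> e z = p (ind_var i z).
  move=> iz; have iq : (i %% q < q)%N by rewrite ltn_mod.
  have iqz : homog (Ordinal iq) z by apply: homog_modq iz; rewrite /= modn_mod.
  rewrite /e (bigD1 (Ordinal iq)) //= (pi_homog iqz) eqxx big1 => [|j ji].
    by rewrite addr0 {2}(divn_eq i q) p_shift.
  rewrite (pi_homog iqz) (negPf ji).
  have j0 : homog j 0 by move=> D p' h; rewrite !rmorph0 mul0r.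
  suff -> : ind_var j 0 = 0 by rewrite rmorph0.
  by apply: (addrI (ind_var j 0)); rewrite -ind_varD // !addr0.
have eD : {morph e : z z' / z + z'}.
  move=> z z'; rewrite /e -big_split; apply: eq_bigr => i _.
  by rewrite pi_add ind_varD ?rmorphD //; apply: homog_pi.
have e0 : e 0 = 0 by apply: (addrI (e 0)); rewrite -eD !addr0.
have eB : zmod_morphism e.
  by move=> z z'; apply: (addIr (e z')); rewrite -eD !subrK.
have e_sum (I : Type) (r : seq I) (F : I -> E) :
    e (\sum_(i <- r) F i) = \sum_(i <- r) e (F i) by apply: big_morph.
have eM : monoid_morphism e.
  split.
    by rewrite (eE _ _ homog1) ind_var01 rmorph1.
  move=> z z'; rewrite -{1}(sum_pi z) -{1}(sum_pi z') mulr_suml e_sum.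
  rewrite -{2}(sum_pi z) -{2}(sum_pi z') !e_sum mulr_suml; apply: eq_bigr => i _.
  rewrite mulr_sumr e_sum mulr_sumr; apply: eq_bigr => j _.
  have iz := homog_pi i z; have jz' := homog_pi j z'.
  by rewrite (eE _ _ (homogM iz jz')) (eE _ _ iz) (eE _ _ jz') -rmorphM ind_varM.
have e_str c : e (calg_str E c) = calg_str C c.
  rewrite -(alg_hom_str (tproj (qtors y))) (eE 0%N); last exact: homog_base.
  by rewrite ind_var_base !alg_hom_str.
pose eA := GRing.isZmodMorphism.Build E C e eB.
pose eMM := GRing.isMonoidMorphism.Build E C e eM.
pose F : {rmorphism E -> C} := HB.pack e eA eMM.
by exists (@AlgHom k E C F e_str).
Qed.

Lemma ind_sec_normalize C (p : alg_hom ind C) (r : units C) :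
  (r ^+ q)%g = ind_sec p -> ind_sec (ind_act_fun r^-1%g p) = 1%g.
Proof. by move=> rE; rewrite ind_sec_act expVgn rE mulVg. Qed.

Lemma ind_act_cancel C (g : units C) (p p' : alg_hom ind C) :
  ind_act_fun g p = p' <-> p = ind_act_fun g^-1%g p'.
Proof.
by split=> [<-|->]; rewrite -ind_actM ?mulVg ?mulgV ind_act1.
Qed.

(** An element g that fixes p satisfies g^q = 1; after dividing p by a q-th root of
    its value of t^q, it fixes a point of the torsor Spec E, so g = 1. *)
Lemma ind_act_stab C (g : units C) (p : alg_hom ind C) :
  ind_act_fun g p = p -> g = 1%g.
Proof.
move=> gp.
have gq : (g ^+ q = 1)%g.
  by apply: (mulIg (ind_sec p)); rewrite -ind_sec_act gp mul1g.
have [h hE] := theta_surj gq.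
pose i := root_in (q := q) (ind_sec p); pose s := troot q_gt0 (ind_sec p).
have sE : (s ^+ q)%g = ind_sec (i ** p) by rewrite trootX ind_sec_nat.
have [e pe] := agree_of_ind (ind_sec_normalize sE).
have gp' : ind_act_fun (theta _ (gpts_map i h)) (ind_act_fun s^-1%g (i ** p))
    = ind_act_fun s^-1%g (i ** p).
  rewrite -ind_actM unitsC ind_actM; congr ind_act_fun.
  by rewrite ghom_nat hE -ind_act_nat gp.
have he : h_act (gpts_map i h) e = e.
  by apply: (agree_fun _ pe); rewrite -gp'; apply: agree_act.
have [h' [_ uniq]] :=
  tact_simply_transitive (t := qtors y) (erefl (e ** tproj (qtors y))).
have h1 : gpts_map i h = 1%g.
  by rewrite -(uniq _ he); apply: uniq; apply: h_act1.
apply: (units_map_inj (root_in_inj q_gt0 (u := ind_sec p))).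
rewrite units_map1 -hE; apply: etrans (esym (ghom_nat theta i h)) _.
by rewrite h1 kghom1.
Qed.

Lemma ind_act_free C (g g' : units C) (p : alg_hom ind C) :
  ind_act_fun g p = ind_act_fun g' p -> g = g'.
Proof.
move=> gg'; apply: (mulgI g'^-1%g); rewrite mulVg; apply: (@ind_act_stab _ _ p).
by rewrite ind_actM gg' -ind_actM mulVg ind_act1.
Qed.

(** As the action is free, an element that moves p to p' over C' is unique, hence
    it has the same two images as in [root_equalizer] and comes from C. *)
Lemma ind_act_descent C (u : units C) (p p' : alg_hom ind C)
    (g : units (rootext q u)) :
  ind_act_fun g (root_in u ** p) = root_in u ** p' ->
  exists g0, ind_act_fun g0 p = p'.
Proof.
move=> gE; pose j1 := root_in (q := q) (1%g : units (rootext q u)).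
pose j2 := root_twist q_gt0 u.
have j2E : j2 ** root_in u = j1 ** root_in u by exact: root_lift_in.
have jg : units_map j1 g = units_map j2 g.
  apply: (@ind_act_free _ _ _ (j1 ** (root_in u ** p))).
  transitivity (j1 ** (root_in u ** p')); first by rewrite -ind_act_nat gE.
  rewrite [in RHS]alg_compA -j2E -alg_compA -ind_act_nat gE.
  by rewrite !alg_compA j2E.
have [c cE] := root_equalizer (congr1 (@uval _) jg).
have [c' c'E] := root_equalizer (congr1 (fun u : units _ => uval u^-1%g) jg).
have iI : injective (root_in (q := q) u) by exact: root_in_inj.
have cc' : c * c' = 1 by apply: iI; rewrite rmorphM cE c'E rmorph1 uvalMV.
exists (mkunit cc'); apply: (alg_comp_inj iI); rewrite ind_act_nat -gE.
by congr ind_act_fun; apply: units_inj; apply: cE.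
Qed.

(** After adjoining q-th roots of the values of t^q at p and at p', both points are
    translates of points of the torsor Spec E, on which mu_q acts transitively. *)
Lemma ind_act_trans C (p p' : alg_hom ind C) :
  p ** ind_proj = p' ** ind_proj -> exists g, ind_act_fun g p = p'.
Proof.
move=> pp'.
pose i1 := root_in (q := q) (ind_sec p); pose s1 := troot q_gt0 (ind_sec p).
pose i2 := root_in (q := q) (ind_sec (i1 ** p')).
pose s2 := troot q_gt0 (ind_sec (i1 ** p')).
have E1 : ((units_map i2 s1) ^+ q)%g = ind_sec (i2 ** (i1 ** p)).
  rewrite -units_mapX trootX [RHS]ind_sec_nat; congr units_map.
  exact/esym/ind_sec_nat.
have E2 : (s2 ^+ q)%g = ind_sec (i2 ** (i1 ** p')).
  by rewrite trootX; apply/esym/ind_sec_nat.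
have [e pe] := agree_of_ind (ind_sec_normalize E1).
have [e' pe'] := agree_of_ind (ind_sec_normalize E2).
have [h [he _]] : exists! h, h_act h e = e'.
  apply: (tact_simply_transitive (t := qtors y)).
  rewrite (agree_proj pe) (agree_proj pe') !ind_act_proj.
  by rewrite -!alg_compA pp'.
have /ind_act_descent[g gE] :
    ind_act_fun (s2 * theta _ h * (units_map i2 s1)^-1)%g (i2 ** (i1 ** p))
    = i2 ** (i1 ** p').
  rewrite !ind_actM; apply/ind_act_cancel; apply: agree_inj pe'.
  by rewrite -he; apply: agree_act.
exact: ind_act_descent gE.
Qed.

Definition ind_torsor : torsor (Gm k) A.
Proof.
refine (@Torsor k (Gm k) A ind ind_proj ind_act _ _ _).
- by move=> C g p; apply: ind_act_proj.
- move=> C p p' /ind_act_trans[g gE]; exists g; split=> // g' g'E.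
  by apply: (@ind_act_free _ _ _ p); rewrite gE.
- have [A' [c [c_cover [s sc]]]] := tlocal_section (qtors y).
  exists A', c; split=> //; have [p ps] := agree_to_ind s.
  by exists p; rewrite -(agree_proj ps).
Defined.

Definition ind_ob : quot_ob aX A.
Proof.
refine (@QuotOb k (Gm k) X aX A ind_torsor (fun C p => of_coord (ind_sec p)) _ _).
- move=> B C f p; apply: (can_inj (coordK (A := C))).
  by rewrite coord_nat !of_coordK; apply: ind_sec_nat.
- move=> C g p; apply: (can_inj (coordK (A := C))).
  by rewrite coord_act !of_coordK; apply: ind_sec_act.
Defined.

Lemma fib_ind_iso : iso_in_fibre (X := quotient_stack aY) (fib_ob ind_ob) y.
Proof.
have k1 : ind_sec (fib_in ind_ob) = 1%g.
  by have := sec_fib_in ind_ob; rewrite /sec of_coordK.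
have [e ke] := agree_of_ind k1.
have [p1 p1E] := agree_to_ind (alg_id E).
have wp1 : sec (x := ind_ob) p1 = 1%g by rewrite /sec of_coordK (agree_ind_sec p1E).
pose x' := fib_ob ind_ob.
have f_proj : e ** tproj (qtors y) = tproj (qtors x') ** alg_id A.
  by rewrite (agree_proj ke) alg_compf1.
have f_act C (h : H C) (p : kspec (tot (qtors x')) C) :
    act (tact (qtors x')) h p ** e = act (tact (qtors y)) h (p ** e).
  apply: (@agree_fun _ (ind_act_fun (theta C h) (p ** fib_in ind_ob))).
    rewrite -[ind_act_fun _ _](fib_actE h p); exact: agree_nat.
  by apply: agree_act; apply: agree_nat.
have f_map C (p : kspec (tot (qtors x')) C) : qmap (q := y) (p ** e) = qmap (q := x') p.
  exact: Y_eq.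
pose f := @QuotHom k H Y aY A A x' y (alg_id A) e f_proj f_act f_map.
apply: (@quot_hom_iso k H Y aY A x' y f (fib_lift wp1)) => //=.
  apply: fib_ext; rewrite -alg_compA fib_lift_in alg_comp1f.
  apply: agree_inj ke; rewrite -[X in agree _ X]alg_compf1; exact: agree_nat.
apply: agree_fun p1E.
by have := agree_nat (fib_lift wp1) ke; rewrite [X in agree X](fib_lift_in wp1).
Qed.

End Graded.

Lemma root_stack_iso : stack_iso (quotient_stack aX) (quotient_stack aY).
Proof.
exists fib_functor; split=> [A B x y|A y]; first exact: fib_hom_bij.
have [pi piE] := coaction_exists y.
by exists (ind_ob piE); apply: fib_ind_iso.
Qed.

End RootStack.

(** * Gale duals *)

Section CokerFacts.
Variables (p q : nat) (M : 'M[int]_(p, q)).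

Lemma coker_proj_eq v w :
  coker_proj M v = coker_proj M w <-> exists u : 'cV_q, v - w = M *m u.
Proof.
have E : (coker_proj M v == coker_proj M w) = (v - w \in im_pred M).
  by rewrite (Quotient.idealrBE (im_pred M)).
split; first by move/eqP; rewrite E => /asboolP.
by move=> vw; apply/eqP; rewrite E; apply/asboolP.
Qed.

Lemma coker_proj_surj x : exists v, coker_proj M v = x.
Proof. by exists (repr x); rewrite /coker_proj reprK. Qed.

Fact coker_proj_additive : zmod_morphism (coker_proj M).
Proof. by move=> v w; rewrite /coker_proj raddfB. Qed.

HB.instance Definition _ :=
  GRing.isZmodMorphism.Build 'cV[int]_p (coker M) (coker_proj M) coker_proj_additive.

Lemma coker_proj0 v : coker_proj M v = 0 <-> exists u : 'cV_q, v = M *m u.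
Proof. by rewrite -(raddf0 (coker_proj M)) coker_proj_eq subr0. Qed.

End CokerFacts.

Section IntMatrices.

Lemma mulmx_ext p q (M N : 'M[int]_(p, q)) :
  (forall x : 'cV_q, M *m x = N *m x) -> M = N.
Proof.
move=> MN; apply/matrixP => i j.
by have := congr1 (fun c : 'cV_p => c i 0) (MN (delta_mx j 0)); rewrite -!colE !mxE.
Qed.

Lemma delta_sum n (x : 'cV[int]_n) : x = \sum_j delta_mx j 0 *~ x j 0.
Proof.
rewrite {1}[x]matrix_sum_delta; apply: eq_bigr => j _.
by rewrite big_ord1 -scaler_int intz.
Qed.

Lemma additive_lin_of (N : zmodType) n (f : {additive 'cV[int]_n -> N}) x :
  f x = lin_of (fun j => f (delta_mx j 0)) x.
Proof. by rewrite {1}[x]delta_sum raddf_sum; apply: eq_bigr => j _; rewrite raddfMz. Qed.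

Lemma additive_ext (N : zmodType) n (f g : {additive 'cV[int]_n -> N}) :
  (forall j, f (delta_mx j 0) = g (delta_mx j 0)) -> f =1 g.
Proof.
by move=> fg x; rewrite !additive_lin_of; apply: eq_bigr => j _; rewrite fg.
Qed.

Lemma lift_mx (N : zmodType) a b (p : {additive 'cV[int]_a -> N})
    (f : {additive 'cV[int]_b -> N}) :
  (forall t, exists x, p x = t) -> exists F : 'M[int]_(a, b), forall x, p (F *m x) = f x.
Proof.
move=> p_surj.
have [v vE] := choice (fun j : 'I_b => p_surj (f (delta_mx j 0))).
pose F : 'M[int]_(a, b) := \matrix_(i, j) v j i 0.
pose g : {additive 'cV[int]_b -> N} :=
  GRing.Additive.clone _ _ (p \o mulmx F) _.
exists F; apply: (@additive_ext _ _ g f) => j /=.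
rewrite -colE -vE; congr (p _); apply/matrixP => i l.
by rewrite !mxE [l]ord1.
Qed.

Lemma factor_mx a b r (R : 'M[int]_(a, r)) (T : 'M[int]_(a, b)) :
  (forall x : 'cV_b, exists y : 'cV_r, T *m x = R *m y) -> exists K, T = R *m K.
Proof.
move=> TR; have [v vE] := choice (fun j : 'I_b => TR (delta_mx j 0)).
exists (\matrix_(i, j) v j i 0); apply/matrixP => i j.
have := congr1 (fun c : 'cV_a => c i 0) (vE j); rewrite -colE !mxE => ->.
by apply: eq_bigr => l _; rewrite mxE.
Qed.

Lemma mulmx_injl a b r (R : 'M[int]_(a, r)) (K L : 'M[int]_(r, b)) :
  injective (fun y : 'cV_r => R *m y) -> R *m K = R *m L -> K = L.
Proof. by move=> RI KL; apply: mulmx_ext => x; apply: RI; rewrite !mulmxA KL. Qed.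

End IntMatrices.

Section GaleComparison.
Variable S : stacky_fan.
Implicit Types D : gale_datum S.

Definition gale_mx D := (row_mx (gd_B D) (gd_R D))^T.

(** F, with K, is a map between the two resolutions that lifts the identity of N, and
    H is the homotopy between the two lifts of beta; T is the transpose of the
    map that they induce from the cone of one lift to that of the other. *)
Definition comparison D D' (T : 'M[int]_(sf_m S + gd_r D, sf_m S + gd_r D')) : Prop :=
  exists (F : 'M[int]_(sf_d S + gd_r D', sf_d S + gd_r D)) H K,
    [/\ forall x, gd_p D' (F *m x) = gd_p D x,
        F *m gd_R D = gd_R D' *m K,
        F *m gd_B D = gd_B D' + gd_R D' *m H &
        T = block_mx 1%:M H^T 0 K^T].

Arguments comparison : clear implicits.

Lemma comparison_exists D D' : exists T, comparison D D' T.
Proof.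
have [F FE] := lift_mx (gd_p D) (gd_p_surj D').
have [x|K KE] := @factor_mx _ _ _ (gd_R D') (F *m gd_R D).
  apply/gd_exact; rewrite -mulmxA FE; apply/gd_exact.
  by exists x.
have [x|H HE] := @factor_mx _ _ _ (gd_R D') (F *m gd_B D - gd_B D').
  by apply/gd_exact; rewrite mulmxBl raddfB -mulmxA FE !gd_lift subrr.
exists (block_mx 1%:M H^T 0 K^T), F, H, K; split=> //.
by rewrite -HE addrC subrK.
Qed.

Lemma comparison_im D D' T : comparison D D' T ->
  forall u : 'cV_(sf_d S + gd_r D'), exists u', T *m (gale_mx D' *m u) = gale_mx D *m u'.
Proof.
move=> [F [H [K [FE FR FB ->]]]] u; exists (F^T *m u).
rewrite !mulmxA; congr (_ *m _); rewrite /gale_mx -trmx_mul mul_mx_row FR FB.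
rewrite !tr_row_mx mul_block_col mul1mx mul0mx add0r.
by rewrite linearD /= !trmx_mul.
Qed.

(** The composite of F with a comparison in the other direction is homotopic to
    the identity by some L, whose transpose, extended by zero, is the homotopy
    between T T' and the identity. *)
Lemma comparison_inv D D' T T' : comparison D D' T -> comparison D' D T' ->
  exists W, T *m T' = 1%:M + gale_mx D *m W.
Proof.
move=> [F [H [K [FE FR FB ->]]]] [G [H' [K' [GE GR GB ->]]]].
have [x|L LE] := @factor_mx _ _ _ (gd_R D) (G *m F - 1%:M).
  by apply/gd_exact; rewrite mulmxBl mul1mx raddfB -mulmxA GE FE subrr.
have GF : G *m F = 1%:M + gd_R D *m L by rewrite -LE addrC subrK.
have KK : K' *m K = 1%:M + L *m gd_R D.
  apply: (mulmx_injl (@gd_R_inj _ D)).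
  rewrite mulmxA -GR -mulmxA -FR mulmxA GF mulmxDl mulmxDr mul1mx mulmx1.
  by rewrite mulmxA.
have HH : H' + K' *m H = L *m gd_B D.
  apply: (mulmx_injl (@gd_R_inj _ D)); apply: (addrI (gd_B D)).
  rewrite mulmxDr addrA -GB !mulmxA -GR -mulmxA -mulmxDr -FB mulmxA GF.
  by rewrite mulmxDl mul1mx.
exists (row_mx 0 L^T).
rewrite mulmx_block !mul1mx !mulmx1 !mul0mx !mulmx0 !addr0 !add0r.
rewrite /gale_mx tr_row_mx mul_col_row !mulmx0 -!trmx_mul -linearD /=.
rewrite KK HH scalar_mx_block add_block_mx !addr0 !add0r.
by rewrite linearD /= trmx1.
Qed.

(** The class of g generates the cokernel and has order n, with n = 0 for infinite
    order. *)
Definition cyclic_coker p q (M : 'M[int]_(p, q)) (g : 'cV[int]_p) (n : nat) : Prop :=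
  (forall v, exists j (u : 'cV_q), v = g *~ j + M *m u) /\
  (forall j : int, (exists u : 'cV_q, g *~ j = M *m u) <-> (n %| j)%Z).

Lemma cyclic_gale D D' n (w : 'I_(sf_m S) -> int) :
  (exists g, cyclic_coker (gale_mx D) g n /\
     forall i, exists u : 'cV_(sf_d S + gd_r D),
       col_mx (delta_mx i 0) 0 = g *~ w i + gale_mx D *m u) ->
  (exists g, cyclic_coker (gale_mx D') g n /\
     forall i, exists u : 'cV_(sf_d S + gd_r D'),
       col_mx (delta_mx i 0) 0 = g *~ w i + gale_mx D' *m u).
Proof.
move=> [g [[g_gen g_ord] gw]].
have [T TE] := comparison_exists D' D.
have [T' T'E] := comparison_exists D D'.
have [W WE] := comparison_inv TE T'E.
have [W' W'E] := comparison_inv T'E TE.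
have mulMz a b (A : 'M[int]_(a, b)) (x : 'cV_b) (j : int) :
    A *m (x *~ j) = (A *m x) *~ j by rewrite (raddfMz (mulmx A)).
exists (T *m g); split; first split.
- move=> v; have [j [u vE]] := g_gen (T' *m v); exists j.
  have [u' u'E] := comparison_im TE u.
  exists (u' - W *m v); rewrite mulmxBr -u'E -mulMz addrA -mulmxDr -vE.
  by rewrite !mulmxA WE mulmxDl mul1mx addrK.
- move=> j; rewrite -g_ord -mulMz; split=> [[u uE]|[u ->]]; last exact: comparison_im.
  have [u' u'E] := comparison_im T'E u; exists (u' - W' *m (g *~ j)).
  by rewrite mulmxBr -u'E -uE !mulmxA W'E mulmxDl mul1mx addrK.
- move=> i; have [u uE] := gw i; have [u' u'E] := comparison_im TE u.
  exists u'; rewrite -u'E -mulMz -mulmxDr -uE.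
  have [F [H [K [_ _ _ ->]]]] := TE.
  by rewrite mul_block_col mul1mx !mulmx0 mul0mx !addr0.
Qed.

End GaleComparison.

(** * Characters of cyclic cokernels *)

Section IntPower.
Variable A : comPzRingType.
Implicit Type u v : units A.

Definition zexp u (j : int) : units A :=
  match j with Posz n => (u ^+ n)%g | Negz n => (u^-1 ^+ n.+1)%g end.

Lemma zexp_sub u (m n : nat) : zexp u (m%:Z - n%:Z) = (u ^+ m * u^-1 ^+ n)%g.
Proof.
have [le_nm|lt_mn] := leqP n m.
  by rewrite subzn //= -{2}(subnK le_nm) expgnDr -mulgA expVgn mulgV mulg1.
have -> : m%:Z - n%:Z = Negz (n - m).-1.
  by rewrite NegzE prednK ?subn_gt0 // -subzn ?opprB // ltnW.
rewrite /= prednK ?subn_gt0 // -{2}(subnKC (ltnW lt_mn)) expgnDr mulgA.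
by rewrite !expVgn mulgV mul1g.
Qed.

Lemma int_diff (j : int) : exists m n : nat, j = m%:Z - n%:Z.
Proof.
case: j => n; first by exists n, 0%N; rewrite subr0.
by exists 0%N, n.+1; rewrite sub0r NegzE.
Qed.

Lemma zexpD u i j : zexp u (i + j) = (zexp u i * zexp u j)%g.
Proof.
have [m [n ->]] := int_diff i; have [m' [n' ->]] := int_diff j.
rewrite addrACA -opprD -!PoszD !zexp_sub !expgnDr.
apply: units_inj; rewrite !uvalM; exact: mulrACA.
Qed.

Lemma zexpM (u : units A) (n : nat) j : zexp u (j * n%:Z) = zexp (u ^+ n)%g j.
Proof.
have [m [m' ->]] := int_diff j; rewrite mulrBl -!PoszM !zexp_sub.
by rewrite -expVgn -!expgnA ![(n * _)%N]mulnC.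
Qed.

Lemma zexp1n j : zexp (1 : units A)%g j = 1%g.
Proof. by case: j => n /=; rewrite ?invg1 expg1n. Qed.

End IntPower.

Section DiagFacts.
Variables (M : zmodType) (A : comPzRingType) (chi : diag_pts M A).

Lemma diag0 : sval chi 0 = 1%g.
Proof. by apply: (mulgI (sval chi 0)); rewrite -(svalP chi) addr0 mulg1. Qed.

Lemma diagN x : sval chi (- x) = ((sval chi x)^-1)%g.
Proof. by apply: (mulgI (sval chi x)); rewrite -(svalP chi) subrr mulgV diag0. Qed.

Lemma diagMn x n : sval chi (x *+ n) = (sval chi x ^+ n)%g.
Proof. by elim: n => [|n IHn]; rewrite ?mulr0n ?diag0 // mulrS expgS (svalP chi) IHn. Qed.

Lemma diagMz x j : sval chi (x *~ j) = zexp (sval chi x) j.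
Proof. by case: j => n /=; rewrite ?diagMn // NegzE mulrNz diagN diagMn -expVgn. Qed.

End DiagFacts.

(** A character of a cyclic group of order n is determined by its value at a
    generator, which can be any unit u with u^n = 1. *)
Section CyclicDiag.
Variables (k : fieldType) (p q : nat) (M : 'M[int]_(p, q)).
Variables (g : 'cV[int]_p) (n : nat) (cyc : cyclic_coker M g n).

Let g0 := coker_proj M g.

Let coker_gen x : exists j, x = g0 *~ j.
Proof.
have [v <-] := coker_proj_surj x; have [j [u ->]] := cyc.1 v; exists j.
rewrite raddfD raddfMz /= [X in _ + X](_ : _ = 0) ?addr0 //.
by apply/coker_proj0; exists u.
Qed.

Let g0_ord j : g0 *~ j = 0 -> (n %| j)%Z.
Proof. by rewrite -raddfMz => /coker_proj0; rewrite cyc.2. Qed.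

Lemma cyclic_eval_inj (A : calg k) : injective (diag_eval k g0 A).
Proof.
move=> chi psi /= chi_psi; apply: diag_ext => x.
by have [j ->] := coker_gen x; rewrite !diagMz chi_psi.
Qed.

Lemma cyclic_evalX (A : calg k) (chi : diag_pts (coker M) A) :
  (diag_eval k g0 A chi ^+ n)%g = 1%g.
Proof.
rewrite /= -diagMn -[g0 *+ n]/(g0 *~ n%:Z) -raddfMz.
rewrite [X in sval chi X](_ : _ = 0) ?diag0 //.
by apply/coker_proj0; rewrite cyc.2.
Qed.

Lemma cyclic_eval_surj (A : calg k) (u : units A) :
  (u ^+ n)%g = 1%g -> exists chi, diag_eval k g0 A chi = u.
Proof.
move=> un; have [e eE] := choice coker_gen.
have zexp_eq i j : g0 *~ i = g0 *~ j -> zexp u i = zexp u j.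
  move=> ij; have /g0_ord/dvdzP[c cE] : g0 *~ (i - j) = 0.
    by rewrite mulrzBr ij subrr.
  by rewrite -(subrK j i) zexpD cE zexpM un zexp1n mul1g.
have chiM x y : zexp u (e (x + y)) = (zexp u (e x) * zexp u (e y))%g.
  by rewrite -zexpD; apply: zexp_eq; rewrite mulrzDr -!eE.
exists (exist _ (fun x => zexp u (e x)) chiM) => /=.
by rewrite (zexp_eq _ 1) -?eE //= expg1.
Qed.

Lemma cyclic_eval_weight (A : calg k) (chi : diag_pts (coker M) A) v (w : nat) u :
  v = g *~ w%:Z + M *m u ->
  diag_eval k (coker_proj M v) A chi = (diag_eval k g0 A chi ^+ w)%g.
Proof.
move=> ->; rewrite /= -diagMn; congr (sval chi _); rewrite raddfD raddfMz /=.
by rewrite [X in _ + X](_ : _ = 0) ?addr0 //; apply/coker_proj0; exists u.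
Qed.

End CyclicDiag.

Import Order.TTheory Num.Theory.

(** * The fan of projective space *)

Section ConeFacts.
Variable V : vectType rat.

Lemma cone1P (v x : V) : cone [:: v] x <-> exists2 c, 0 <= c & x = c *: v.
Proof.
split=> [[c c0 ->]|[c c0 ->]]; first by exists (c ord0); rewrite ?big_ord1.
by exists (fun=> c) => //; rewrite big_ord1.
Qed.

Variables (T : eqType) (t0 : T) (f : T -> V).

Lemma sum_map_nth (s : seq T) (c : 'I_(size (map f s)) -> rat) : uniq s ->
  \sum_i c i *: (map f s)`_i
  = \sum_(t <- s) (if insub (index t s) is Some i then c i else 0) *: f t.
Proof.
move=> s_uniq.
pose c' i := if insub i is Some j then c j else 0.
transitivity (\sum_(0 <= i < size s) c' i *: (map f s)`_i).
  by rewrite -(size_map f) big_mkord; apply: eq_bigr => i _; rewrite /c' valK.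
rewrite (big_nth t0) [in RHS]big_nat [LHS]big_nat; apply: eq_bigr => i /andP[_ i_lt].
by rewrite (nth_map t0) // index_uniq.
Qed.

Lemma cone_mapP (s : seq T) x : uniq s ->
  cone (map f s) x <->
  exists2 c : T -> rat, forall i, 0 <= c i & x = \sum_(t <- s) c t *: f t.
Proof.
move=> s_uniq; split=> [[c c0 ->]|[c c0 ->]].
  rewrite sum_map_nth //.
  exists (fun t => if insub (index t s) is Some i then c i else 0) => // t.
  by case: insub.
exists (fun i => c (nth t0 s i)) => //; rewrite sum_map_nth //.
rewrite big_seq [RHS]big_seq; apply: eq_bigr => t ts.
by rewrite insubT ?size_map ?index_mem //= => i; rewrite nth_index.
Qed.

Lemma free_mapP (s : seq T) : uniq s ->
  (forall c : T -> rat, \sum_(t <- s) c t *: f t = 0 -> {in s, forall t, c t = 0}) ->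
  free (map f s).
Proof.
move=> s_uniq fs; apply/(@freeP _ _ _ (in_tuple (map f s))) => c c0 i.
have is_lt : (i < size s)%N by rewrite -(size_map f).
move: c0; rewrite sum_map_nth // => /fs/(_ (nth t0 s i) (mem_nth _ is_lt)).
by rewrite index_uniq // valK.
Qed.

End ConeFacts.

Section ProjectiveFan.
Variable d : nat.
Local Notation V := 'cV[rat]_d.
Local Notation idx := 'I_(d + 1).
Local Notation last := (rshift d (ord0 : 'I_1)).

(** Q^d is identified with the quotient of Q^(d+1) by the line of constant
    vectors: [hcoord] lifts a vector to the representative with last coordinate
    0, and [hvec] is the projection. In this model the rays are the images of
    the basis vectors. *)
Definition hcoord (v : V) (i : idx) : rat :=
  if split i is inl j then v j 0 else 0.

Definition hvec (y : idx -> rat) : V :=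
  \col_j (y (lshift 1 j) - y last).

Definition pray (i : idx) : V := hvec (fun j => (i == j)%:R).

Lemma hcoord_hvec y i : hcoord (hvec y) i = y i - y last.
Proof.
rewrite /hcoord; case: split_ordP => [j ->|j ->]; first by rewrite mxE.
by rewrite [j]ord1 subrr.
Qed.

Lemma hvec_hcoord v c : hvec (fun i => hcoord v i - c) = v.
Proof.
apply/matrixP => j l; rewrite mxE [l]ord1 /hcoord (unsplitK (inl j)) (unsplitK (inr ord0)).
by rewrite sub0r opprK subrK.
Qed.

Lemma hcoordD v v' i : hcoord (v + v') i = hcoord v i + hcoord v' i.
Proof. by rewrite /hcoord; case: split => j; rewrite ?mxE ?addr0. Qed.

Lemma hcoordZ c v i : hcoord (c *: v) i = c * hcoord v i.
Proof. by rewrite /hcoord; case: split => j; rewrite ?mxE ?mulr0. Qed.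

Lemma hvec_sum y : hvec y = \sum_i y i *: pray i.
Proof.
apply/matrixP => j l; rewrite mxE summxE.
under eq_bigr => i _ do rewrite !mxE mulrBr.
rewrite sumrB; congr (_ - _).
  rewrite (bigD1 (lshift 1 j)) //= eqxx mulr1 big1 ?addr0 // => i.
  by move=> /negPf ->; rewrite mulr0.
rewrite (bigD1 last) //= eqxx mulr1 big1 ?addr0 // => i.
by move=> /negPf ->; rewrite mulr0.
Qed.

(** The cone spanned by the rays in I, described without the rays: the
    coordinates outside I are minimal. This does not depend on the
    representative, and it makes intersections and faces easy. *)
Definition pcone (I : {set idx}) : set V :=
  [set v | forall i, i \notin I -> forall j, hcoord v i <= hcoord v j].

(** Normalize the representative so that its minimum, reached at i0, is 0. *)
Lemma pcone_decomp (I : {set idx}) i0 v : i0 \notin I -> pcone I v ->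
  v = \sum_(i in I) (hcoord v i - hcoord v i0) *: pray i.
Proof.
move=> i0I vI; rewrite -[LHS](hvec_hcoord v (hcoord v i0)) hvec_sum.
rewrite (bigID (mem I)) /= [X in _ + X]big1 ?addr0 // => i iI.
have -> : hcoord v i = hcoord v i0 by apply/le_anti; rewrite !vI.
by rewrite subrr scale0r.
Qed.

Lemma hcoord_comb (I : {set idx}) (c : idx -> rat) i :
  hcoord (\sum_(j in I) c j *: pray j) i
  = (if i \in I then c i else 0) - (if last \in I then c last else 0).
Proof.
have -> : \sum_(j in I) c j *: pray j = hvec (fun j => if j \in I then c j else 0).
  rewrite hvec_sum big_mkcond; apply: eq_bigr => j _.
  by case: ifP; rewrite ?scale0r.
exact: hcoord_hvec.
Qed.

Lemma pcone_comb (I : {set idx}) (c : idx -> rat) :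
  (forall i, 0 <= c i) -> pcone I (\sum_(j in I) c j *: pray j).
Proof.
move=> c0 i iI j; rewrite !hcoord_comb (negPf iI) lerD2r.
by case: ifP.
Qed.

Lemma proper_notin (I : {set idx}) : I != [set: idx]%SET -> exists i, i \notin I.
Proof.
rewrite -finset.subTset => /subsetPn[i _ iI]; by exists i.
Qed.

Lemma pcone_cone (I : {set idx}) : I != [set: idx]%SET ->
  pcone I = cone [seq pray i | i <- enum I].
Proof.
move=> /proper_notin[i0 i0I]; apply/seteqP; split=> v.
  move=> vI; apply/(cone_mapP last); first exact: enum_uniq.
  exists (fun i => Num.max 0 (hcoord v i - hcoord v i0)) => [i|].
    by rewrite le_max lexx.
  rewrite [LHS](pcone_decomp i0I vI) big_enum; apply: eq_bigr => i iI.
  by rewrite max_r // subr_ge0 vI.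
move=> /(cone_mapP last)[|c c0 ->]; first exact: enum_uniq.
by rewrite big_enum; apply: pcone_comb.
Qed.

Lemma pcone_simplicial (I : {set idx}) :
  I != [set: idx]%SET -> simplicial_cone (pcone I).
Proof.
move=> Iproper; exists [seq pray i | i <- enum I]; last exact: pcone_cone.
have [i0 i0I] := proper_notin Iproper.
apply: (free_mapP last) => [|c]; first exact: enum_uniq.
rewrite big_enum => c0 i; rewrite mem_enum => iI.
have h0 j : hcoord 0 j = 0 by rewrite /hcoord; case: split => // l; rewrite mxE.
have := hcoord_comb I c i0; rewrite c0 h0 (negPf i0I) sub0r => /eqP.
rewrite eq_sym oppr_eq0 => /eqP cmax.
by have := hcoord_comb I c i; rewrite c0 h0 iI cmax subr0.
Qed.

Lemma pconeS (I J : {set idx}) : J \subset I -> pcone J `<=` pcone I.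
Proof.
move=> JI v vJ i iI; apply: vJ; apply: contra iI; exact: (fintype.subsetP JI).
Qed.

Lemma pconeI (I J : {set idx}) : pcone I `&` pcone J = pcone (I :&: J)%SET.
Proof.
apply/seteqP; split=> v.
  move=> [vI vJ] i; rewrite inE negb_and => /orP[/vI|/vJ]; exact.
by move=> vIJ; split=> i iI; apply: vIJ; rewrite inE negb_and iI ?orbT.
Qed.

(** The sum of the x_j - x_i0 over the j in I that are not in J is nonnegative on
    the cone of I and vanishes exactly on the cone of J. *)
Lemma pcone_face (I J : {set idx}) : I != [set: idx]%SET -> J \subset I ->
  face (pcone J) (pcone I).
Proof.
move=> /proper_notin[i0 i0I] JI.
pose u (v : V) : rat^o := \sum_(j in (I :\: J)%SET) (hcoord v j - hcoord v i0).
have u_lin : linear u.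
  move=> c v w; rewrite /u scaler_sumr -big_split; apply: eq_bigr => j _ /=.
  by rewrite !hcoordD !hcoordZ scalerBr opprD addrACA.
pose U : {linear V -> rat^o} := HB.pack u (GRing.isLinear.Build _ _ _ _ u u_lin).
have u_ge0 v j : pcone I v -> 0 <= hcoord v j - hcoord v i0.
  by move=> vI; rewrite subr_ge0 vI.
exists U; split=> [v vI|]; first by apply: sumr_ge0 => j _; apply: u_ge0.
apply/seteqP; split=> v.
  move=> vJ; have vI := pconeS JI vJ.
  split=> //; apply: big1 => j; rewrite inE => /andP[jJ jI].
  apply/eqP; rewrite subr_eq0; apply/eqP/le_anti; rewrite vJ //= vI //.
move=> [vI /eqP]; rewrite /= psumr_eq0; last by move=> j _; apply: u_ge0.
move=> /allP v0 i iJ j; have [iI|iI] := boolP (i \in I); last exact: vI.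
have := v0 i (mem_index_enum _); rewrite inE iI iJ /= subr_eq0 => /eqP ->.
exact: vI.
Qed.

(** A functional that is nonnegative on the rays vanishes on a positive
    combination of rays only if it vanishes on each of them. *)
Lemma face_pcone (I : {set idx}) tau : I != [set: idx]%SET -> face tau (pcone I) ->
  exists2 J : {set idx}, J \subset I & tau = pcone J.
Proof.
move=> Iproper [u [u0 ->]]; have [i0 i0I] := proper_notin Iproper.
pose J := [set i in I | u (pray i) == 0]%SET.
have JI : J \subset I by apply/fintype.subsetP => i; rewrite inE => /andP[].
have i0J : i0 \notin J by apply: contra i0I; exact: (fintype.subsetP JI).
have uray i : i \in I -> 0 <= u (pray i).
  move=> iI; apply: u0.
  have -> : pray i = \sum_(j in I) (j == i)%:R *: pray j.
    rewrite (bigD1 i) //= eqxx scale1r big1 ?addr0 // => j /andP[_ /negPf ->].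
    by rewrite scale0r.
  by apply: pcone_comb => j; case: eqP.
exists J => //; apply/seteqP; split=> v.
  move=> [vI /=]; rewrite [v in u v](pcone_decomp i0I vI) linear_sum => /eqP.
  have ge0 j : j \in I -> 0 <= u ((hcoord v j - hcoord v i0) *: pray j).
    by move=> jI; rewrite linearZ; apply: mulr_ge0; rewrite ?subr_ge0 ?vI ?uray.
  rewrite psumr_eq0 // => /allP v0 i iJ j.
  have [iI|iI] := boolP (i \in I); last exact: vI.
  have := v0 i (mem_index_enum _); rewrite iI /= linearZ mulf_eq0 subr_eq0.
  by move: iJ; rewrite inE iI /= => /negPf -> /[!orbF] /eqP ->; apply: vI.
move=> vJ; have vI := pconeS JI vJ.
split=> //=; rewrite [v in u v](pcone_decomp i0J vJ) linear_sum.
apply: big1 => i; rewrite inE => /andP[_ /eqP ui].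
by rewrite linearZ /= ui scaler0.
Qed.

Definition pfan : set (set V) :=
  [set pcone I | I in [set I : {set idx} | I != [set: idx]%SET]].

Lemma proper_sub (I J : {set idx}) :
  J \subset I -> I != [set: idx]%SET -> J != [set: idx]%SET.
Proof.
move=> JI /proper_notin[i iI]; apply/eqP => JT; move/fintype.subsetP/(_ i): JI.
by rewrite JT inE (negPf iI) => /(_ isT).
Qed.

Lemma pfan_simplicial : simplicial_fan pfan.
Proof.
split.
- by apply: finite_image; apply: finite_finset.
- exists (pcone finset.set0), finset.set0 => //=.
  by apply/eqP => /finset.setP/(_ last); rewrite !inE.
- by move=> _ [I IT <-]; apply: pcone_simplicial.
- move=> _ tau [I IT <-] /(face_pcone IT)[J JI ->]; exists J => //=.
  exact: proper_sub JI IT.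
- move=> _ _ [I IT <-] [J JT <-]; rewrite pconeI.
  by split; apply: pcone_face; rewrite ?subsetIl ?subsetIr.
Qed.

Hypothesis d_gt0 : (0 < d)%N.

Lemma other_index (i : idx) : exists j, i != j.
Proof.
case: (split_ordP i) => j ->; first by exists last; rewrite eq_lrshift.
by exists (lshift 1 (Ordinal d_gt0)); rewrite eq_rlshift.
Qed.

Lemma set1_proper (i : idx) : [set i]%SET != [set: idx]%SET.
Proof.
have [j ij] := other_index i; apply/eqP => /finset.setP/(_ j).
by rewrite !inE eq_sym (negPf ij).
Qed.

Lemma pcone_pray (I : {set idx}) i : pcone I (pray i) <-> i \in I.
Proof.
split=> [iI|iI].
  apply: contraT => niI; have [j ij] := other_index i.
  by have := iI i niI j; rewrite !hcoord_hvec eqxx (negPf ij) lerD2r ler10.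
have -> : pray i = \sum_(j in I) (j == i)%:R *: pray j.
  rewrite (bigD1 i) //= eqxx scale1r big1 ?addr0 // => j /andP[_ /negPf ->].
  by rewrite scale0r.
by apply: pcone_comb => j; case: eqP.
Qed.

Lemma pray_neq0 i : pray i != 0.
Proof.
apply/eqP => i0; have [j ij] := other_index i.
have /pcone_pray : pcone [set j]%SET (pray i).
  rewrite i0 => l _ l'; have h0 m : hcoord 0 m = 0; last by rewrite !h0.
  by rewrite /hcoord; case: split => // m'; rewrite mxE.
by rewrite inE (negPf ij).
Qed.

Lemma pcone1 i : pcone [set i]%SET = cone [:: pray i].
Proof. by rewrite (pcone_cone (set1_proper i)) enum_set1. Qed.

Lemma cone1Z (v : V) (c : rat) : 0 < c -> cone [:: c *: v] = cone [:: v].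
Proof.
move=> c0; apply/seteqP; split=> x /cone1P[b b0 ->]; apply/cone1P.
  by exists (b * c); rewrite ?scalerA // mulr_ge0 // ltW.
exists (b / c); first by rewrite divr_ge0 // ltW.
by rewrite scalerA divfK // gt_eqF.
Qed.

Lemma pfan_ray v :
  v != 0 -> pfan (cone [:: v]) -> exists i, cone [:: v] = cone [:: pray i].
Proof.
move=> v0 [I IT IE]; have [i0 i0I] := proper_notin IT.
have vI : pcone I v by rewrite IE; apply/cone1P; exists 1; rewrite ?scale1r.
have [i iI] : exists i, i \in I.
  apply/set0Pn; apply: contra_neq v0 => I0.
  by rewrite (pcone_decomp i0I vI) I0 big_set0.
have /cone1P[c c0 cE] : cone [:: v] (pray i) by rewrite -IE; apply/pcone_pray.
exists i; rewrite cE cone1Z // lt_neqAle c0 andbT eq_sym.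
by apply: contraNneq (pray_neq0 i) => c_eq0; rewrite cE c_eq0 scale0r.
Qed.

End ProjectiveFan.

(** * The stacky fan of a weighted projective stack *)

Section WeightedFan.
Variables (d : nat) (w : 'I_(d + 1) -> nat) (w_gt0 : forall i, (0 < w i)%N).
Local Notation last := (rshift d (ord0 : 'I_1)).

Definition wcol : 'M[int]_(d + 1, 1) := \col_i (w i)%:Z.

Definition wlattice : zmodType := coker wcol.

Lemma w_neq0 i : (w i)%:R != 0 :> rat.
Proof. by rewrite pnatr_eq0 -lt0n. Qed.

Let scaled (z : 'cV[int]_(d + 1)) (i : 'I_(d + 1)) : rat := (z i 0)%:~R / (w i)%:R.

(** Dividing the i-th coordinate by w_i sends the vector w to a constant vector,
    so that N maps to the space of the fan of projective space, and the i-th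
    basis vector to a positive multiple of the i-th ray. *)
Definition wproj_cv (z : 'cV[int]_(d + 1)) : 'cV[rat]_d := hvec (scaled z).

Lemma wproj_cvB z z' : wproj_cv (z - z') = wproj_cv z - wproj_cv z'.
Proof.
apply/matrixP => j l; rewrite !mxE /scaled !mxE !rmorphB /= !mulrBl.
by rewrite !opprD !opprK addrACA.
Qed.

Lemma wproj_cv_eq0 z : wproj_cv z = 0 <-> forall i, scaled z i = scaled z last.
Proof.
have h0 i : hcoord (0 : 'cV[rat]_d) i = 0.
  by rewrite /hcoord; case: split => // j; rewrite mxE.
split=> [z0 i|zc]; last first.
  by apply/matrixP => j l; rewrite !mxE zc subrr.
by apply/eqP; rewrite -subr_eq0 -(h0 i) -z0 hcoord_hvec.
Qed.

Lemma wproj_cv_wcol (u : 'cV[int]_1) : wproj_cv (wcol *m u) = 0.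
Proof.
apply/wproj_cv_eq0 => i; rewrite /scaled !mxE !big_ord1 !mxE !rmorphM /=.
by rewrite [LHS]mulrAC [RHS]mulrAC !divff ?w_neq0.
Qed.

Definition wproj_fun (x : wlattice) : 'cV[rat]_d := wproj_cv (repr x).

Lemma wproj_funE z : wproj_fun (coker_proj wcol z) = wproj_cv z.
Proof.
have : coker_proj wcol (repr (coker_proj wcol z)) = coker_proj wcol z.
  by rewrite /coker_proj reprK.
move=> /coker_proj_eq[u uE]; apply/eqP; rewrite -subr_eq0 -wproj_cvB uE.
by rewrite wproj_cv_wcol.
Qed.

Fact wproj_additive : zmod_morphism wproj_fun.
Proof.
move=> x y; have [z <-] := coker_proj_surj x; have [z' <-] := coker_proj_surj y.
by rewrite -raddfB !wproj_funE wproj_cvB.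
Qed.

Definition wproj : {additive wlattice -> 'cV[rat]_d} :=
  HB.pack wproj_fun
    (GRing.isZmodMorphism.Build wlattice 'cV[rat]_d wproj_fun wproj_additive).

Lemma wproj_ker x : wproj x = 0 <-> exists2 j : nat, (0 < j)%N & x *+ j = 0.
Proof.
split=> [|[j j0 xj]]; last first.
  have : wproj x *+ j = 0 by rewrite -raddfMn xj raddf0.
  rewrite -scaler_nat => /eqP; rewrite scaler_eq0 pnatr_eq0.
  by rewrite -[j == 0%N]negbK -lt0n j0 => /eqP.
have [z <-] := coker_proj_surj x; rewrite [wproj _]wproj_funE => /wproj_cv_eq0 zc.
exists (w last); first exact: w_gt0.
rewrite -raddfMn; apply/coker_proj0; exists (const_mx (z last 0)).
apply/matrixP => i l; rewrite mulmxnE !mxE big_ord1 !mxE [l]ord1.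
apply: (intr_inj (R := rat)); rewrite rmorphMn rmorphM /= -mulr_natr.
have := zc i; rewrite /scaled => /eqP; rewrite eqr_div ?w_neq0 // => /eqP ->.
by rewrite mulrC.
Qed.

Lemma common_denominator a (y : 'I_a -> rat) :
  exists2 j : nat, (0 < j)%N & exists z : 'I_a -> int, forall i, y i *+ j = (z i)%:~R.
Proof.
pose D := \prod_i `|denq (y i)|%N.
exists D; first by apply: prodn_gt0 => i; rewrite absz_gt0 denq_neq0.
have zE i : exists z : int, y i *+ D = z%:~R.
  exists (numq (y i) *+ \prod_(j | j != i) `|denq (y j)|%N).
  rewrite /D (bigD1 i) //= mulrnA rmorphMn; congr (_ *+ _).
  rewrite -mulr_natr -{1}[y i]divq_num_den.
  have -> : (`|denq (y i)|%N)%:R = (denq (y i))%:~R :> rat.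
    by rewrite natr_absz ger0_norm ?denq_ge0.
  by rewrite divfK // intr_eq0 denq_neq0.
by have [z zE'] := choice zE; exists z.
Qed.

Lemma wproj_span v : exists2 j : nat, (0 < j)%N & exists x, v *+ j = wproj x.
Proof.
have [j j0 [z zE]] := common_denominator (hcoord v).
exists j => //; exists (coker_proj wcol (\col_i (z i * (w i)%:Z))).
rewrite [wproj _]wproj_funE; apply/matrixP => i l.
have sE i' : scaled (\col_i (z i * (w i)%:Z)) i' = hcoord v i' *+ j.
  by rewrite /scaled mxE rmorphM /= mulfK ?zE // w_neq0.
rewrite -[in LHS](hvec_hcoord v 0) mulmxnE !mxE !sE mulrnBl.
by rewrite !subr0.
Qed.

Lemma wlattice_fg : exists s : seq wlattice, forall x, exists c : 'cV[int]_(size s),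
  x = lin_of (fun i : 'I_(size s) => s`_i) c.
Proof.
pose e (j : 'I_(d + 1)) : wlattice := coker_proj wcol (delta_mx j 0).
pose s : seq wlattice := [seq e j | j <- enum 'I_(d + 1)].
have sE : size s = (d + 1)%N by rewrite size_map size_enum_ord.
exists s => x; have [z <-] := coker_proj_surj x.
exists (\col_i z (cast_ord sE i) 0); rewrite additive_lin_of /lin_of.
rewrite [LHS](reindex (cast_ord sE)); last first.
  by apply: onW_bij; exists (cast_ord (esym sE)); [apply: cast_ordK | apply: cast_ordKV].
apply: eq_bigr => i _; rewrite mxE; congr (_ *~ _).
have i_lt : (i < d + 1)%N := ltn_ord (cast_ord sE i).
rewrite (nth_map last) ?size_enum_ord //; congr (coker_proj _ (delta_mx _ _)).
by apply: val_inj; rewrite /= nth_enum_ord.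
Qed.

Lemma wlattice_rank : \dim {: 'cV[rat]_d} = d.
Proof. by rewrite dimvf /dim /= muln1. Qed.

Definition wray (i : 'I_(d + 1)) : wlattice := coker_proj wcol (delta_mx i 0).

Lemma wproj_wray i : wproj (wray i) = (w i)%:R^-1 *: pray i.
Proof.
rewrite [wproj _]wproj_funE /wproj_cv; apply/matrixP => j l.
rewrite !mxE /scaled !mxE mulrBr.
have E m : (delta_mx i 0 m (0 : 'I_1))%:~R / (w m)%:R = (w i)%:R^-1 * (i == m)%:R :> rat.
  rewrite mxE eqxx andbT eq_sym; case: eqP => [->|_]; rewrite ?mulr1 ?mulr0 ?mul0r //.
  by rewrite mul1r.
by have := (E (lshift 1 j), E last); rewrite !mxE => -[-> ->].
Qed.

Lemma lin_wray z : lin_of wray z = coker_proj wcol z.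
Proof. by rewrite -additive_lin_of. Qed.

End WeightedFan.

(** * Weighted projective stacks of positive dimension *)

Section PositiveDimension.
Variables (d : nat) (w : 'I_(d + 1) -> nat) (w_gt0 : forall i, (0 < w i)%N).
Hypothesis d_gt0 : (0 < d)%N.

Let wV_gt0 i : 0 < (w i)%:R^-1 :> rat.
Proof. by rewrite invr_gt0 ltr0n. Qed.

Lemma cone_wray i : cone [:: wproj w_gt0 (wray w i)] = cone [:: pray i].
Proof. by rewrite (wproj_wray w_gt0) cone1Z. Qed.

Definition wps_fan : stacky_fan.
Proof.
refine (@StackyFan (wlattice w) (wlattice_fg w) d 'cV[rat]_d (wlattice_rank d)
  (wproj w_gt0) (wproj_ker w_gt0) (wproj_span w_gt0) (@pfan d) (pfan_simplicial d)
  (d + 1) (wray w) _ _ _ _ _).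
- exists [:: 0] => x; exists 0; first by rewrite inE.
  have [z <-] := coker_proj_surj x; exists z.
  by rewrite add0r lin_wray.
- move=> i; rewrite (wproj_wray w_gt0) scaler_eq0 negb_or pray_neq0 // andbT.
  by rewrite gt_eqF.
- move=> i; rewrite cone_wray -pcone1 //; exists [set i]%SET => //.
  exact: set1_proper.
- move=> i j; rewrite !cone_wray -!pcone1 // => ij.
  have : pcone [set j]%SET (pray i) by rewrite -ij; apply/pcone_pray; rewrite ?inE.
  by move=> /pcone_pray => /(_ d_gt0); rewrite inE => /eqP.
- move=> v v0 /pfan_ray => /(_ d_gt0 v0)[i ->]; exists i.
  by rewrite cone_wray.
Defined.

Lemma wcol_inj : injective (fun y : 'cV[int]_1 => wcol w *m y).
Proof.
move=> y y' /matrixP yy'; apply/matrixP => i j; rewrite (ord1 i) (ord1 j).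
have := yy' (rshift d ord0) 0; rewrite !mxE !big_ord1 !mxE.
by apply: mulfI; rewrite eqz_nat -lt0n.
Qed.

Definition wps_gale : gale_datum wps_fan.
Proof.
refine (@GaleDatum wps_fan 1 (coker_proj (wcol w)) (wcol w) wcol_inj
  (@coker_proj0 _ _ (wcol w)) (@coker_proj_surj _ _ (wcol w)) (1%:M : 'M_(d + 1)) _).
by move=> z; rewrite mul1mx [RHS]lin_wray.
Defined.

(** Modulo the image (u, w . u) of u, every (z, t) is congruent to
    (0, t - w . z). The generator is (0, -1), so that the weights have their sign. *)
Lemma wps_cyclic : exists g, cyclic_coker (gale_mx wps_gale) g 0 /\
  forall i, exists u : 'cV_(sf_d wps_fan + gd_r wps_gale),
    col_mx (delta_mx i 0) 0 = g *~ (w i)%:Z + gale_mx wps_gale *m u.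
Proof.
have ME (u : 'cV_(d + 1)) : gale_mx wps_gale *m u = col_mx u ((wcol w)^T *m u).
  by rewrite /gale_mx /= tr_row_mx trmx1 mul_col_mx mul1mx.
pose g : 'cV[int]_(d + 1 + 1) := col_mx 0 (const_mx (-1)).
have gE (j : int) : g *~ j = col_mx 0 (const_mx (- j)).
  apply/matrixP => i l; rewrite -scaler_int intz !mxE; case: splitP => m _.
    by rewrite !mxE mulr0.
  by rewrite !mxE mulrN1.
exists g; split; first split.
- move=> v; rewrite -[v]vsubmxK; set z := usubmx v; set t := dsubmx v.
  exists (((wcol w)^T *m z - t) 0 0), z; rewrite ME gE add_col_mx add0r; congr col_mx.
  by apply/matrixP => i j; rewrite (ord1 i) (ord1 j) !mxE opprB subrK.
- move=> j; rewrite dvd0z; split=> [[u]|/eqP ->].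
    rewrite ME gE => /eq_col_mx[u0]; rewrite -u0 mulmx0 => /matrixP/(_ 0 0).
    by rewrite !mxE => /eqP; rewrite oppr_eq0.
  by exists 0; rewrite mulmx0.
- move=> i; exists (delta_mx i 0); rewrite ME gE add_col_mx add0r; congr col_mx.
  by apply/matrixP => l m; rewrite [l]ord1 [m]ord1 -colE !mxE addNr.
Qed.

Lemma irrelevant_wps : irrelevant (S := wps_fan) = [set I | I != finset.set0].
Proof.
have ray_sub (I : {set 'I_(d + 1)}) i :
    `[< @sf_ray wps_fan i `<=` pcone I >] = (i \in I).
  rewrite /sf_ray /= cone_wray; apply/asboolP/idP => [iI|iI].
    apply/(pcone_pray d_gt0); apply: iI; rewrite -pcone1 //.
    by apply/(pcone_pray d_gt0); rewrite inE.
  rewrite -pcone1 // => v vi j jI; apply: vi; rewrite inE.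
  by apply: contraNneq jI => ->.
have compl (I : {set 'I_(d + 1)}) :
    [set i | ~~ `[< @sf_ray wps_fan i `<=` pcone I >]]%SET = (~: I)%SET.
  by apply/finset.setP => i; rewrite !inE ray_sub.
apply/seteqP; split=> J /=.
  move=> [_ [I IT <-] <-]; rewrite compl; apply: contraNneq IT => I0.
  by rewrite -[I]finset.setCK I0 finset.setC0.
move=> J0; exists (pcone (~: J)%SET); last by rewrite compl finset.setCK.
exists (~: J)%SET => //=; apply: contraNneq J0 => JT.
by rewrite -[J]finset.setCK JT finset.setCT.
Qed.

End PositiveDimension.

Lemma kgroup_hom_inv (k : fieldType) (G H : kgroup k) (f : kgroup_hom G H) :
  (forall A, injective (f A)) -> (forall A (h : H A), exists g, f A g = h) ->
  exists f' : kgroup_hom H G,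
    (forall A, cancel (f A) (f' A)) /\ (forall A, cancel (f' A) (f A)).
Proof.
move=> f_inj f_surj; pose f' A h := projT1 (cid (f_surj A h)).
have f'K A h : f A (f' A h) = h by rewrite /f'; case: cid.
have f'M A x y : f' A (x * y)%g = (f' A x * f' A y)%g.
  by apply: f_inj; rewrite ghomM !f'K.
have f'_nat A B (g : alg_hom A B) x : f' B (gpts_map g x) = gpts_map g (f' A x).
  by apply: f_inj; rewrite ghom_nat !f'K.
exists (KGroupHom f'M f'_nat); split=> A x /=; last exact: f'K.
by apply: f_inj; rewrite f'K.
Qed.

Definition singletons m : set {set 'I_m} := [set [set i]%SET | i in [set: 'I_m]].

Arguments singletons : clear implicits.

Definition weighted_stack (k : fieldType) m (w : 'I_m -> nat) : cat_over k :=
  quotient_stack (mcompl_act (singletons m) (fun i => Gm_pow k (w i))).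

(** A monomial is a multiple of every monomial on a subset of its variables. *)
Lemma in_ideal_coarser m (A : comPzRingType) (D D' : set {set 'I_m})
    (z : {ffun 'I_m -> A}) :
  (forall I, D I -> exists2 J, D' J & J \subset I) ->
  in_ideal (monomials D z) 1 -> in_ideal (monomials D' z) 1.
Proof.
move=> DD'; rewrite -{2}[1]/(idfun 1).
apply: (in_ideal_map (f := idfun)) => _ [I DI ->]; have [J D'J JI] := DD' I DI.
exists (\prod_(i in (I :\: J)%SET) z i), (\prod_(i in J) z i); split; first by exists J.
by rewrite /= (big_setID J) /= mulrC (finset.setIidPr JI).
Qed.

Section PositiveDimensionIso.
Variables (k : fieldType) (d : nat) (w : 'I_(d + 1) -> nat).
Hypothesis w_gt0 : forall i, (0 < w i)%N.
Hypothesis d_gt0 : (0 < d)%N.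

Lemma weighted_stack_iso (D : gale_datum (wps_fan w_gt0 d_gt0)) :
  stack_iso (weighted_stack k w) (toric_stack k D).
Proof.
have [g [g_cyc g_w]] := cyclic_gale D (wps_cyclic w_gt0 d_gt0).
pose ev := diag_eval k (coker_proj (gale_mx D) g).
have ev_surj (A : calg k) (u : units A) : exists chi, ev A chi = u.
  exact: (cyclic_eval_surj g_cyc).
have [theta [evK thetaK]] := kgroup_hom_inv (cyclic_eval_inj (k := k) g_cyc) ev_surj.
have nonempty (A : comPzRingType) (z : {ffun 'I_(d + 1) -> A}) :
    in_ideal (monomials (singletons (d + 1)) z) 1 ->
    in_ideal (monomials (irrelevant (S := wps_fan w_gt0 d_gt0)) z) 1.
  apply: in_ideal_coarser => _ [i _ <-]; exists [set i]%SET => //.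
  rewrite irrelevant_wps /=; apply/finset.set0Pn; exists i; exact: set11.
have single (A : comPzRingType) (z : {ffun 'I_(d + 1) -> A}) :
    in_ideal (monomials (irrelevant (S := wps_fan w_gt0 d_gt0)) z) 1 ->
    in_ideal (monomials (singletons (d + 1)) z) 1.
  apply: in_ideal_coarser => I; rewrite irrelevant_wps /= => /finset.set0Pn[i iI].
  by exists [set i]%SET; [exists i | rewrite finset.sub1set].
pose tau (A : calg k) (z : mcompl_pts (singletons (d + 1)) A) :
    mcompl_pts (irrelevant (S := wps_fan w_gt0 d_gt0)) A :=
  exist _ (sval z) (nonempty A (sval z) (svalP z)).
pose tau' (A : calg k) (z : mcompl_pts (irrelevant (S := wps_fan w_gt0 d_gt0)) A) :
    mcompl_pts (singletons (d + 1)) A :=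
  exist _ (sval z) (single A (sval z) (svalP z)).
apply: (@quotient_stack_iso k (Gm k) (diag_group k (DG D))
  (mcompl k (singletons (d + 1))) (mcompl k (irrelevant (S := wps_fan w_gt0 d_gt0)))
  (mcompl_act (singletons (d + 1)) (fun i => Gm_pow k (w i)))
  (mcompl_act (irrelevant (S := wps_fan w_gt0 d_gt0)) (toric_weight k D)) theta ev tau tau').
- exact: thetaK.
- exact: evK.
- by move=> A z; apply: mcompl_ext.
- by move=> A z; apply: mcompl_ext.
- by move=> A B f z; apply: mcompl_ext.
- move=> A u z; apply: mcompl_ext; apply/ffunP => i; rewrite /= !ffunE.
  congr (uval _ * _); have [v vE] := g_w i.
  have := cyclic_eval_weight (theta A u) vE; rewrite [diag_eval _ _ _ _ in RHS]thetaK.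
  by move=> e; exact: (esym e).
Qed.

End PositiveDimensionIso.

(** * Weighted projective stacks of dimension zero *)

Section DimensionZero.
Variables (w : 'I_(0 + 1) -> nat) (w_gt0 : forall i, (0 < w i)%N).
Local Notation last := (rshift 0 (ord0 : 'I_1)).

(** There are no rays, as a zero-dimensional space has no nonzero vector; beta is
    the zero map from 0 and has a finite cokernel, namely N = Z / w. *)
Definition bmu_fan : stacky_fan.
Proof.
refine (@StackyFan (wlattice w) (wlattice_fg w) 0 'cV[rat]_0 (wlattice_rank 0)
  (wproj w_gt0) (wproj_ker w_gt0) (wproj_span w_gt0) (@pfan 0) (pfan_simplicial 0)
  0 (fun i : 'I_0 => wray w (lshift 1 i)) _ _ _ _ _).
- exists [seq coker_proj (wcol w) (const_mx n%:Z) | n <- iota 0 (w last)] => x.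
  have [z <-] := coker_proj_surj x.
  pose z0 : int := z last 0; pose r := (z0 %% (w last)%:Z)%Z.
  have w0 : (w last)%:Z != 0 by rewrite eqz_nat -lt0n.
  have rE : r = `|r|%N by rewrite gez0_abs // modz_ge0.
  exists (coker_proj (wcol w) (const_mx (`|r|%N : int))).
    apply/mapP; exists `|r|%N => //; rewrite mem_iota add0n /=.
    by rewrite -ltz_nat -rE ltz_pmod // ltz_nat.
  exists 0; rewrite /lin_of big_ord0 addr0; apply/coker_proj_eq.
  exists (const_mx (z0 %/ (w last)%:Z)%Z).
  apply/matrixP => i j; rewrite !mxE big_ord1 !mxE -rE [j]ord1.
  have -> : i = last by apply: val_inj; case: i => -[].
  by rewrite -/z0 {1}(divz_eq z0 (w last)%:Z) addrK mulrC.
- by case.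
- by case.
- by move=> [].
- by move=> v /eqP[]; apply/matrixP => -[].
Defined.

Definition bmu_gale : gale_datum bmu_fan.
Proof.
refine (@GaleDatum bmu_fan 1 (coker_proj (wcol w)) (wcol w) (wcol_inj w_gt0)
  (@coker_proj0 _ _ (wcol w)) (@coker_proj_surj _ _ (wcol w)) (0 : 'M_(0 + 1, 0)) _).
by move=> z; rewrite mul0mx raddf0 /sf_beta /lin_of big_ord0.
Defined.

Lemma bmu_cyclic : exists g, cyclic_coker (gale_mx bmu_gale) g (w last) /\
  forall i : 'I_0, exists u : 'cV_(sf_d bmu_fan + gd_r bmu_gale),
    col_mx (delta_mx i 0) 0 = g *~ 0 + gale_mx bmu_gale *m u.
Proof.
have ME (u : 'cV_(0 + 1)) i j :
    (gale_mx bmu_gale *m u) i j = (w last)%:Z * u last ord0.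
  rewrite [j]ord1 /gale_mx /= tr_row_mx mul_col_mx mxE.
  case: splitP => [[]//|l _]; rewrite mxE big_ord_recl big_ord0 addr0 !mxE.
  by congr ((w _)%:Z * u _ _); apply: val_inj.
pose g : 'cV[int]_(0 + 1) := const_mx 1.
have gE (j : int) i l : (g *~ j) i l = j.
  by rewrite -scaler_int intz !mxE mulr1.
exists g; split; last by case.
split=> [v|j].
  exists (v last 0), 0; apply/matrixP => i j; rewrite mxE gE mulmx0 mxE addr0.
  by rewrite [j]ord1; congr (v _ _); apply: val_inj; case: i => -[].
split=> [[u /matrixP/(_ last 0)]|/dvdzP[c cE]].
  by rewrite gE ME => ->; apply: dvdz_mulr.
exists (const_mx c); apply/matrixP => i l; rewrite gE ME mxE cE mulrC //.
Qed.

Lemma singleton_unit (A : comPzRingType) (z : {ffun 'I_(0 + 1) -> A}) :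
  in_ideal (monomials (singletons (0 + 1)) z) 1 -> exists y, z last * y = 1.
Proof.
move=> [s sP ->]; rewrite big_seq; elim/big_ind: _ => [|a b [y <-] [y' <-]|p].
- by exists 0; rewrite mulr0.
- by exists (y + y'); rewrite mulrDr.
move=> /sP[_ [i _ <-] ->]; exists p.1; rewrite big_set1 mulrC.
by congr (_ * z _); apply: val_inj; case: i => -[].
Qed.

Lemma unit_singleton (A : comPzRingType) (u : units A) :
  in_ideal (monomials (singletons (0 + 1)) [ffun=> uval u]) 1.
Proof.
exists [:: (uval u^-1%g, uval u)]; last by rewrite big_seq1 uvalVM.
move=> p; rewrite inE => /eqP -> /=; exists [set last]%SET; first by exists last.
by rewrite big_set1 ffunE.
Qed.

Lemma bmu_stack_iso (k : fieldType) (D : gale_datum bmu_fan) :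
  (w last)%:R != 0 :> k -> stack_iso (weighted_stack k w) (toric_stack k D).
Proof.
move=> w_neq0.
have [g [g_cyc _]] := cyclic_gale D bmu_cyclic.
pose coord (A : calg k) (z : mcompl_pts (singletons (0 + 1)) A) : units A :=
  mkunit (projT2 (cid (singleton_unit (svalP z)))).
pose of_coord (A : calg k) (u : units A) : mcompl_pts (singletons (0 + 1)) A :=
  exist _ [ffun=> uval u] (unit_singleton u).
have lastE (i : 'I_(0 + 1)) : i = last by apply: val_inj; case: i => -[].
have irr0 (A : comPzRingType) (z : {ffun 'I_0 -> A}) :
    in_ideal (monomials (irrelevant (S := bmu_fan)) z) 1.
  exists [:: (1, 1)]; last by rewrite big_seq1 mulr1.
  move=> p; rewrite inE => /eqP -> /=.
  have [sigma sigmaF] := fan_neq0 (pfan_simplicial 0).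
  eexists; first by exists sigma.
  by rewrite big1 // => -[].
pose y0 (A : calg k) : mcompl_pts (irrelevant (S := bmu_fan)) A :=
  exist _ [ffun=> 0] (irr0 A _).
apply: (@root_stack_iso k (w last) (w_gt0 last) w_neq0 (diag_group k (DG D))
  (diag_eval k (coker_proj (gale_mx D) g)) _ _ _
  (mcompl k (singletons (0 + 1)))
  (mcompl_act (singletons (0 + 1)) (fun i => Gm_pow k (w i))) coord of_coord _ _ _ _
  (mcompl k (irrelevant (S := bmu_fan)))
  (mcompl_act (irrelevant (S := bmu_fan)) (toric_weight k D)) y0).
- exact: cyclic_eval_inj g_cyc.
- exact: cyclic_evalX g_cyc.
- exact: cyclic_eval_surj g_cyc.
- by move=> A z; apply: mcompl_ext; apply/ffunP => i; rewrite ffunE (lastE i).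
- by move=> A u; apply: units_inj; rewrite [LHS]ffunE.
- by move=> A B f z; apply: units_inj; rewrite [LHS]ffunE.
- by move=> A u z; apply: units_inj; rewrite [LHS]ffunE.
- by move=> A y y'; apply: mcompl_ext; apply/ffunP => -[].
Qed.

End DimensionZero.

(** * Arbitrary dimension *)

Lemma weighted_stack_toric (k : fieldType) (d : nat) (w : 'I_(d + 1) -> nat) :
  (forall n, (0 < n)%N -> n%:R != 0 :> k) -> (forall i, (0 < w i)%N) ->
  exists S : stacky_fan, inhabited (gale_datum S) /\
    forall D : gale_datum S, stack_iso (weighted_stack k w) (toric_stack k D).
Proof.
move=> k_char0 w_gt0; have [d0|d_gt0] := posnP d.
  move: w w_gt0; rewrite d0 => w w_gt0; exists (bmu_fan w_gt0).
  split; first exact: inhabits (bmu_gale w_gt0).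
  by move=> D; apply: bmu_stack_iso; apply: k_char0.
exists (wps_fan w_gt0 d_gt0); split; first exact: inhabits (wps_gale w_gt0 d_gt0).
exact: weighted_stack_iso.
Qed.

Theorem proposition4p4 (R : realType) (n : nat) (Q : n.+1.-tuple nat)
    (Q_gt0 : forall i : 'I_n.+1, (0 < tnth Q i)%N) :
  exists S : stacky_fan,
    inhabited (gale_datum S) /\
    forall D : gale_datum S,
      stack_iso (weighted_projective_stack R[i] Q) (toric_stack R[i] D).
Proof.
have char0 m : (0 < m)%N -> m%:R != 0 :> R[i] by rewrite pnatr_eq0 -lt0n.
(* The fan of dimension d has its weights indexed by 'I_(d + 1). *)
suff main m (w : 'I_m -> nat) : m = (n + 1)%N -> (forall i, (0 < w i)%N) ->
    exists S : stacky_fan, inhabited (gale_datum S) /\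
      forall D : gale_datum S, stack_iso (weighted_stack R[i] w) (toric_stack R[i] D).
  exact: (main n.+1 (tnth Q) (esym (addn1 n)) Q_gt0).
by move=> mE; move: w; rewrite mE => w; apply: weighted_stack_toric.
Qed.
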